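(* Let the Löwner differential equation $$\frac{dh}{dt}=\frac{2}{h-\lambda(t)},\qquad h(z,0)\equiv z,$$ generate slit maps $h(z,t):\mathbb H\setminus\gamma_t\to\mathbb H$, where $\gamma_t\cup\overline{\gamma_t}\cup\{\gamma(0)\}$ is an analytic curve which is mapped onto $[h^-(0,t),h^+(0,t)]$. Suppose that the limits $$\lim_{t\to+0}\frac{\lambda(t)}{\sqrt t}=c\ge0,\qquad \lim_{t\to+0}\frac{h^+(0,t)}{\sqrt t}=b$$ exist. Then $c=0$, $b=2$, the limit $\lim_{t\to+0}s(t)t^{-1/2}$ is finite, where $s(t)$ is the arc-length parameter of the slit, and, given $\epsilon>0$, the tip $\gamma(t)$ of the slit satisfies $$\lim_{t\to+0}\gamma(t)\,t^{-\frac12+\epsilon}=0 .$$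
   Context: $\mathbb H=\{z\in\mathbb C:\operatorname{Im}z>0\}$. The driving term $\lambda$ is a real-valued continuous function on an interval $[0,T]$. ''The equation generates slit maps'' means: there is a simple arc $t\mapsto\gamma(t)$, $t\in[0,T]$, with $\gamma(0)\in\mathbb R$ and $\gamma(t)\in\mathbb H$ for $t>0$, such that, writing $\gamma_t=\gamma((0,t])$ for the slit, the solution $h(\cdot,t)$ is the conformal map of $\mathbb H\setminus\gamma_t$ onto $\mathbb H$ with $h(z,t)=z+2t/z+O(1/z^2)$ near infinity; the tip is $\gamma(t)=h^{-1}(\lambda(t),t)$. Standing normalization: $\gamma(0)=0$, hence $\lambda(0)=0$. $\overline{\gamma_t}$ is the reflection of $\gamma_t$ in the real axis. Analyticity: in the arc-length parameter $s$, $\gamma(s)=x(s)+iy(s)$ is analytic on $[0,S]$ with $x$ even and $y$ odd, so that $\gamma_t\cup\overline{\gamma_t}\cup\{0\}$ is an analytic curve symmetric with respect to $\mathbb R$. The function $s=s(t)$ is the arc-length parameter of the point $\gamma(t)$ measured from $\gamma(0)$, i.e. the length of $\gamma_t$. By Schwarz reflection $h(\cdot,t)$ extends to a conformal map of $\mathbb C\setminus(\gamma_t\cup\overline{\gamma_t}\cup\{0\})$ onto $\mathbb C\setminus I(t)$, where $I(t)=[h^-(0,t),h^+(0,t)]\subset\mathbb R$ is the image of the slit; $h^-(0,t)<h^+(0,t)$ are the images of the two prime ends at $z=0$ (left and right side of the slit), and both are solutions of the Löwner equation that are singular at $t=0$, with initial value $0$. *)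

(* Defs.v *)
(* Stdlib real numbers with Coquelicot. *)
From Stdlib Require Import Reals.
From Coquelicot Require Import Coquelicot.
Local Open Scope R_scope.

Definition upper (z : C) : Prop := 0 < Im z.

Definition slit (gamma : R -> C) (t : R) (z : C) : Prop :=
  exists u : R, 0 < u <= t /\ z = gamma u.

Definition slit_domain (gamma : R -> C) (t : R) (z : C) : Prop :=
  upper z /\ ~ slit gamma t z.

(* The slit, its mirror image in the real axis, and their common base point 0. *)
Definition double_slit (gamma : R -> C) (t : R) (z : C) : Prop :=
  slit gamma t z \/ slit gamma t (Cconj z) \/ z = RtoC 0.

Definition double_slit_domain (gamma : R -> C) (t : R) (z : C) : Prop :=
  ~ double_slit gamma t z.

(* On a closed interval I the derivative is one-sided at the end points. *)
Definition is_derive_within (I : R -> Prop) (f : R -> C) (t : R) (l : C) : Prop :=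
  filterdiff (K := R_AbsRing) (U := R_NormedModule) (V := C_R_NormedModule)
    f (within I (locally t)) (fun d : R => scal d l).

Definition conformal_onto (D E : C -> Prop) (f : C -> C) : Prop :=
  (forall z, D z -> ex_derive (K := C_AbsRing) (V := C_NormedModule) f z) /\
  (forall z w, D z -> D w -> f z = f w -> z = w) /\
  (forall w, E w <-> exists z, D z /\ f z = w).

(* D t is the set of starting points whose solution is alive at time t.  Since
   division by 0 is total, h <> lam has to be required separately. *)
Definition solves_loewner (T : R) (lam : R -> R) (D : R -> C -> Prop)
    (h : C -> R -> C) : Prop :=
  (forall z, D 0 z -> h z 0 = z) /\
  (forall t z, 0 <= t <= T -> D t z ->
     h z t <> RtoC (lam t) /\
     is_derive_within (fun u => 0 <= u <= T) (h z) t
       (RtoC 2 / (h z t - RtoC (lam t)))%C).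

Definition simple_arc (T : R) (gamma : R -> C) : Prop :=
  continuous_on (fun t => 0 <= t <= T) gamma /\
  (forall t u, 0 <= t <= T -> 0 <= u <= T -> gamma t = gamma u -> t = u) /\
  gamma 0 = RtoC 0 /\
  (forall t, 0 < t <= T -> upper (gamma t)).

Record generates_slit_maps (T : R) (lam : R -> R) (h : C -> R -> C)
    (gamma : R -> C) : Prop := {
  gsm_arc : simple_arc T gamma;
  gsm_ode : solves_loewner T lam (slit_domain gamma) h;
  gsm_conformal : forall t, 0 <= t <= T ->
    conformal_onto (slit_domain gamma t) upper (fun z => h z t);
  gsm_infinity : forall t, 0 <= t <= T ->
    exists M A : R, 0 < A /\
      forall z, slit_domain gamma t z -> A < Cmod z ->
        Cmod (h z t - z - RtoC (2 * t) / z)%C <= M / (Cmod z) ^ 2;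
  (* g is the inverse of h(., t) on the upper half-plane; its value at the
     boundary point lam t is the limit from inside. *)
  gsm_tip : forall (t : R) (g : C -> C), 0 <= t <= T ->
    (forall w, upper w -> slit_domain gamma t (g w) /\ h (g w) t = w) ->
    filterlim g (within upper (locally (RtoC (lam t)))) (locally (gamma t))
}.

Definition real_segment (a b : R) (w : C) : Prop :=
  Im w = 0 /\ a <= Re w <= b.

(* h also denotes its extension by Schwarz reflection to the complement of the
   double slit.  The prime ends at 0 to the right and to the left of the slit are
   accessible along the positive and the negative real half-axis. *)
Record reflected_slit_maps (T : R) (lam : R -> R) (h : C -> R -> C)
    (gamma : R -> C) (hminus hplus : R -> R) : Prop := {
  rsm_conj : forall t z, 0 <= t <= T -> double_slit_domain gamma t z ->
    h (Cconj z) t = Cconj (h z t);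
  rsm_ode : solves_loewner T lam (double_slit_domain gamma) h;
  rsm_lt : forall t, 0 < t <= T -> hminus t < hplus t;
  rsm_conformal : forall t, 0 < t <= T ->
    conformal_onto (double_slit_domain gamma t)
      (fun w => ~ real_segment (hminus t) (hplus t) w) (fun z => h z t);
  rsm_hplus : forall t, 0 < t <= T ->
    filterlim (fun x : R => h (RtoC x) t) (at_right 0) (locally (RtoC (hplus t)));
  rsm_hminus : forall t, 0 < t <= T ->
    filterlim (fun x : R => h (RtoC x) t) (at_left 0) (locally (RtoC (hminus t)))
}.

(* Lengths of the polygons inscribed in gamma restricted to [0, t]. *)
Definition inscribed_length (gamma : R -> C) (t l : R) : Prop :=
  exists (n : nat) (u : nat -> R),
    (forall i, (i <= S n)%nat -> 0 <= u i <= t) /\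
    (forall i, (i <= n)%nat -> u i <= u (S i)) /\
    l = sum_f_R0 (fun i => Cmod (gamma (u (S i)) - gamma (u i))%C) n.

Definition arc_length (gamma : R -> C) (t : R) : Rbar :=
  Lub_Rbar (inscribed_length gamma t).

(* Analytic up to and including the end points: there the power series
   converges on both sides and so continues f past the end point. *)
Definition analytic_on (f : R -> R) (a b : R) : Prop :=
  forall s0, a <= s0 <= b ->
    exists (p : nat -> R) (r : R), 0 < r /\
      forall s, a <= s <= b -> Rabs (s - s0) < r -> is_pseries p (s - s0) (f s).

Definition analytic_slit (T : R) (gamma : R -> C) : Prop :=
  is_finite (arc_length gamma T) /\
  exists x y : R -> R,
    let S := real (arc_length gamma T) in
    analytic_on x (- S) S /\ analytic_on y (- S) S /\
    (forall s, - S <= s <= S -> x (- s) = x s /\ y (- s) = - y s) /\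
    (forall t, 0 <= t <= T ->
       let s := real (arc_length gamma t) in gamma t = (x s, y s)).

(* Main.v *)
(* c = 0.  As t -> 0, h^+ ~ b sqrt t with b (b - c) = 4.  The arguments of
   h(z, t) - h(x, t) and h(z, t) - h(-x', t), for small boundary points x and
   -x', move at rates proportional to 1 / (h(x, t) - lam) and
   1 / (lam - h(-x', t)).  If c > 0, then the first rate is larger by a factor
   r > 1, so arg (h(z) - h(x)) + r arg (h(z) - h(-x')) is nondecreasing.  For z
   near the tip it starts near (1 + r) arg z and ends near pi, which keeps arg z
   below pi / 2 by a fixed amount; but the slit is perpendicular to R at 0, being
   an analytic arc symmetric in R.

   Length.  Since (Im h)^2 decreases at rate at most 4, Im gamma(t) <= 2 sqrt t.
   For the reverse estimate, (h^2)' = 4 + 4 lam / (h - lam) with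
   lam = o(sqrt t) gives h^2 = z^2 + 4 t + o(t) wherever Im h is not too small; a
   slit of height less than (2 - d) sqrt t contradicts this just above its tip.
   Hence Im gamma(t) ~ 2 sqrt t, and s(t) ~ 2 sqrt t / y'(0). *)
Require Import Defs.
From Stdlib Require Import Reals Lra Lia ClassicalEpsilon.
From Coquelicot Require Import Coquelicot.
Local Open Scope R_scope.

(** * Calculus on a segment *)

(** The factor r comes from comparing coefficients of sqrt t. Putting h^+ ~ b sqrt t into its
    equation gives b / 2 = 2 / (b - c), so h^+ - lam ~ (b - c) sqrt t, with b - c < 2 if c > 0. No
    limit is assumed for h^-, but lam >= 0 forces |h^-| <= 2 sqrt t, and the equation then makes lam
    - h^- at least about (4 / (2 + c) + c) sqrt t, which exceeds (b - c) sqrt t. In the length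
    estimate the obstacle is the imaginary axis. The error in h^2 = z^2 + 4 t + o(t) involves log
    (Im z / Im h), and Im h is bounded below directly only where Im (h^2), nearly 2 Re z Im z, keeps
    away from 0. Since Im h is positive and harmonic, the mean value property carries the bound from
    points beside the axis to points on it. That property is proved by differentiating a circle mean
    under the integral, which takes a continuous derivative; [conformal_onto] supplies only a
    derivative, and its continuity is drawn from the dependence of trajectories on their starting
    points, by Gronwall. *)

Lemma nondecreasing_of_derive (f df : R -> R) (a b : R) :
  a <= b -> (forall x, a <= x <= b -> is_derive f x (df x)) ->
  (forall x, a <= x <= b -> 0 <= df x) -> f a <= f b.
Proof.
  intros Hab Hd Hp.
  destruct (MVT_gen f a b df) as [c [Hc Heq]].
  - intros x Hx. rewrite Rmin_left, Rmax_right in Hx by assumption. apply Hd; lra.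
  - intros x Hx. rewrite Rmin_left, Rmax_right in Hx by assumption.
    apply continuity_pt_filterlim, (ex_derive_continuous (K := R_AbsRing) f).
    exists (df x); apply Hd; lra.
  - rewrite Rmin_left, Rmax_right in Hc by assumption.
    assert (0 <= df c * (b - a)) by (apply Rmult_le_pos; [apply Hp; lra | lra]).
    lra.
Qed.

Lemma le_of_derive_le (f g df dg : R -> R) (a b : R) :
  a <= b -> (forall x, a <= x <= b -> is_derive f x (df x)) ->
  (forall x, a <= x <= b -> is_derive g x (dg x)) ->
  (forall x, a <= x <= b -> df x <= dg x) -> f b - f a <= g b - g a.
Proof.
  intros Hab Hf Hg Hle.
  assert (H : g a - f a <= g b - f b).
  { apply (nondecreasing_of_derive (fun x => g x - f x) (fun x => dg x - df x) a b Hab).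
    - intros x Hx. apply (is_derive_minus (K := R_AbsRing) (V := R_NormedModule)); auto.
    - intros x Hx. specialize (Hle x Hx). lra. }
  lra.
Qed.

(** The equation holds with one-sided derivatives at the ends of the time interval. Continuing [f]
    past each end by its tangent line makes the derivative two-sided, so that [is_derive] and the
    mean value theorem apply on the closed segment. *)
Lemma derive_on_segment_extends (f g : R -> R) (t : R) :
  0 < t ->
  (forall x, 0 <= x <= t -> forall eps, 0 < eps -> exists d, 0 < d /\
     forall u, 0 <= u <= t -> Rabs (u - x) < d ->
       Rabs (f u - f x - (u - x) * g x) <= eps * Rabs (u - x)) ->
  exists F : R -> R,
    forall x, 0 <= x <= t -> F x = f x /\ is_derive F x (g x).
Proof.
  intros Ht Hf.
  set (cl := fun u => Rmax 0 (Rmin t u)).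
  assert (Hin : forall u, 0 <= u <= t -> cl u = u).
  { intros u Hu. unfold cl. rewrite Rmin_right, Rmax_right; lra. }
  set (F := fun u => f (cl u) + (u - cl u) * g (cl u)).
  assert (HF : forall u, 0 <= u <= t -> F u = f u).
  { intros u Hu. unfold F. rewrite Hin by assumption. ring. }
  exists F. intros x Hx. split; [now apply HF|].
  apply is_derive_Reals. intros eps Heps.
  destruct (Hf x Hx (eps / 2)) as [d [Hd Hfd]]; [lra|].
  (* With this radius x + k leaves [0, t] only if x is itself the end that is crossed, and beyond
     that end [F] is exactly linear. *)
  set (d' := Rmin d (Rmin (if Rlt_dec 0 x then x else 1) (if Rlt_dec x t then t - x else 1))).
  assert (Hd' : 0 < d').
  { unfold d'. destruct (Rlt_dec 0 x), (Rlt_dec x t);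
      repeat apply Rmin_glb_lt; lra. }
  exists (mkposreal d' Hd'). intros k Hk0 Hk. simpl in Hk.
  assert (Hkd : Rabs k < d) by (eapply Rlt_le_trans; [exact Hk | apply Rmin_l]).
  assert (Hmain : Rabs (F (x + k) - F x - k * g x) <= eps / 2 * Rabs k).
  { rewrite (HF x Hx).
    destruct (Rlt_dec (x + k) 0) as [Hneg|Hnn].
    - assert (x = 0).
      { destruct (Rlt_dec 0 x) as [Hx0|]; [|lra].
        assert (Rabs k < x).
        { eapply Rlt_le_trans; [exact Hk|]. unfold d'.
          destruct (Rlt_dec 0 x); [|lra].
          eapply Rle_trans; [apply Rmin_r|apply Rmin_l]. }
        revert H; unfold Rabs; destruct (Rcase_abs k); lra. }
      subst x. assert (Hcl : cl (0 + k) = 0).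
      { unfold cl. rewrite Rmin_right, Rmax_left; lra. }
      unfold F. rewrite Hcl.
      replace (_ - _ - _) with 0 by ring. rewrite Rabs_R0.
      apply Rmult_le_pos; [lra|apply Rabs_pos].
    - destruct (Rlt_dec t (x + k)) as [Hbig|Hle].
      + assert (x = t).
        { destruct (Rlt_dec x t) as [Hxt|]; [|lra].
          assert (Rabs k < t - x).
          { eapply Rlt_le_trans; [exact Hk|]. unfold d'.
            destruct (Rlt_dec x t); [|lra].
            eapply Rle_trans; [apply Rmin_r|apply Rmin_r]. }
          revert H; unfold Rabs; destruct (Rcase_abs k); lra. }
        subst x. assert (Hcl : cl (t + k) = t).
        { unfold cl. rewrite Rmin_left, Rmax_right; lra. }
        unfold F. rewrite Hcl.
        replace (_ - _ - _) with 0 by ring. rewrite Rabs_R0.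
        apply Rmult_le_pos; [lra|apply Rabs_pos].
      + rewrite HF by lra.
        replace (f (x + k) - f x - k * g x)
          with (f (x + k) - f x - (x + k - x) * g x) by ring.
        replace (Rabs k) with (Rabs (x + k - x)) by (f_equal; ring).
        apply Hfd; [lra|]. replace (x + k - x) with k by ring. exact Hkd. }
  replace ((F (x + k) - F x) / k - g x) with ((F (x + k) - F x - k * g x) / k) by (field; exact Hk0).
  unfold Rdiv. rewrite Rabs_mult, Rabs_inv.
  assert (0 < Rabs k) by now apply Rabs_pos_lt.
  apply Rle_lt_trans with (eps / 2 * Rabs k * / Rabs k).
  - apply Rmult_le_compat_r; [left; now apply Rinv_0_lt_compat|exact Hmain].
  - rewrite Rmult_assoc, Rinv_r by lra. lra.
Qed.

Lemma is_derive_within_components (I : R -> Prop) (f : R -> C) (x : R) (l : C) :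
  I x -> is_derive_within I f x l ->
  forall eps, 0 < eps -> exists d, 0 < d /\
    forall u, I u -> Rabs (u - x) < d ->
      Rabs (Re (f u) - Re (f x) - (u - x) * Re l) <= eps * Rabs (u - x) /\
      Rabs (Im (f u) - Im (f x) - (u - x) * Im l) <= eps * Rabs (u - x).
Proof.
  intros HI [_ Hf] eps Heps.
  assert (Hlim : is_filter_lim (within I (locally x)) x).
  { intros P HP. unfold within. now apply filter_imp with (2 := HP). }
  destruct (Hf x Hlim (mkposreal eps Heps)) as [d Hd].
  exists d; split; [apply cond_pos|]. intros u HIu Hu.
  specialize (Hd u Hu HIu). simpl in Hd.
  assert (Hn : forall v : C, Rabs (Re v) <= norm (K := R_AbsRing) (V := C_R_NormedModule) v
       /\ Rabs (Im v) <= norm (K := R_AbsRing) (V := C_R_NormedModule) v).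
  { intros v. change (norm (K := R_AbsRing) (V := C_R_NormedModule) v)
      with (sqrt (Rabs (Re v) ^ 2 + Rabs (Im v) ^ 2)).
    destruct (sqrt_plus_sqr (Rabs (Re v)) (Rabs (Im v))) as [H _].
    rewrite !Rabs_Rabsolu in H.
    split; apply Rle_trans with (2 := H); [apply Rmax_l | apply Rmax_r]. }
  destruct (Hn (minus (G := C_R_NormedModule) (minus (G := C_R_NormedModule) (f u) (f x))
      (scal (minus u x) l : C_R_NormedModule))) as [H1 H2].
  change (norm (K := R_AbsRing) (V := R_NormedModule) (minus u x)) with (Rabs (u - x)) in Hd.
  split; eapply Rle_trans; [|exact Hd| |exact Hd].
  - eapply Rle_trans; [|exact H1]. right. f_equal.
  - eapply Rle_trans; [|exact H2]. right. f_equal.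
Qed.

(** * Trajectories of the Loewner equation *)

(** [X + i V] stands for h(z, .); the derivatives are the real and imaginary parts of 2 / (h - lam).
    They are two-sided even at 0 and [t], so in use [X] and [V] are extensions of the components of
    h. *)
Definition upper_trajectory (lam : R -> R) (t : R) (X V : R -> R) : Prop :=
  forall s, 0 <= s <= t -> 0 < V s /\
    is_derive X s (2 * (X s - lam s) / ((X s - lam s) ^ 2 + V s ^ 2)) /\
    is_derive V s (- (2 * V s) / ((X s - lam s) ^ 2 + V s ^ 2)).

Definition real_trajectory (lam : R -> R) (t : R) (u : R -> R) : Prop :=
  forall s, 0 <= s <= t -> u s <> lam s /\ is_derive u s (2 / (u s - lam s)).

Lemma sum_sq_pos (a v : R) : 0 < v -> 0 < a ^ 2 + v ^ 2.
Proof. intros; nra. Qed.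

Lemma trajectory_height_nonincreasing lam t X V a b :
  upper_trajectory lam t X V -> 0 <= a -> a <= b -> b <= t -> V b <= V a.
Proof.
  intros H Ha Hab Hb.
  assert (V a - V a <= V a - V b); [|lra].
  replace (V a - V b) with ((fun s => - V s) b - (fun s => - V s) a) by ring.
  apply (le_of_derive_le (fun _ => V a) (fun s => - V s) (fun _ => 0)
    (fun s => - (- (2 * V s) / ((X s - lam s) ^ 2 + V s ^ 2)))); [assumption|..].
  - intros x _. apply (is_derive_const (K := R_AbsRing) (V := R_NormedModule)).
  - intros x Hx. apply (is_derive_opp (K := R_AbsRing) (V := R_NormedModule)). apply H; lra.
  - intros x Hx. destruct (H x) as [HV _]; [lra|].
    assert (HN := sum_sq_pos (X x - lam x) _ HV).
    replace (- (- (2 * V x) / ((X x - lam x) ^ 2 + V x ^ 2)))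
      with (2 * V x * / ((X x - lam x) ^ 2 + V x ^ 2)) by (unfold Rdiv; ring).
    apply Rmult_le_pos; [lra|]. left; now apply Rinv_0_lt_compat.
Qed.

Lemma trajectory_height_sqr lam t X V a b :
  upper_trajectory lam t X V -> 0 <= a -> a <= b -> b <= t ->
  V a ^ 2 - 4 * (b - a) <= V b ^ 2.
Proof.
  intros H Ha Hab Hb.
  assert (- V b ^ 2 - (- V a ^ 2) <= 4 * b - 4 * a); [|lra].
  apply (le_of_derive_le (fun s => - V s ^ 2) (fun s => 4 * s)
    (fun s => 4 * V s ^ 2 / ((X s - lam s) ^ 2 + V s ^ 2)) (fun _ => 4)); [assumption|..].
  - intros x Hx. destruct (H x) as [HV [_ HV']]; [lra|].
    auto_derive; [repeat split; try (eexists; eauto; fail)|].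
    rewrite (is_derive_unique (fun x0 : R => V x0) _ _ HV').
    field. apply Rgt_not_eq. apply sum_sq_pos; assumption.
  - intros x Hx. auto_derive; [easy|ring].
  - intros x Hx. destruct (H x) as [HV _]; [lra|].
    assert (HN := sum_sq_pos (X x - lam x) _ HV).
    apply (Rmult_le_reg_r ((X x - lam x) ^ 2 + V x ^ 2)); [assumption|].
    unfold Rdiv. rewrite Rmult_assoc, Rinv_l by lra. assert (0 <= (X x - lam x) ^ 2) by apply pow2_ge_0. lra.
Qed.

(** By AM-GM the horizontal speed 2 a / (a^2 + V^2) is at most 1 / V, and 16 b <= 3 V(0)^2 says that
    V(0)^2 - 4 b >= (V(0) / 2)^2. This controls the initial time span on which the two boundary
    rates cannot be compared. *)
Lemma trajectory_abscissa_change lam t X V b :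
  upper_trajectory lam t X V -> 0 <= b -> b <= t -> 16 * b <= 3 * V 0 ^ 2 ->
  X b - X 0 <= 2 * b / V 0 /\ V 0 / 2 <= V b.
Proof.
  intros H H0b Hb Hb2.
  destruct (H 0) as [HV0 _]; [lra|].
  assert (Hhalf : forall s, 0 <= s <= b -> V 0 / 2 <= V s).
  { intros s Hs. assert (H1 := trajectory_height_sqr lam t X V 0 s H).
    destruct (H s) as [HVs _]; [lra|]. nra. }
  split; [|apply Hhalf; lra].
  replace (2 * b / V 0) with ((fun s => 2 * s / V 0) b - (fun s => 2 * s / V 0) 0)
    by (cbv beta; field; lra).
  apply (le_of_derive_le X (fun s => 2 * s / V 0)
    (fun s => 2 * (X s - lam s) / ((X s - lam s) ^ 2 + V s ^ 2)) (fun _ => 2 / V 0));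
    [lra|..].
  - intros x Hx; apply H; lra.
  - intros x Hx. auto_derive; [easy|field; lra].
  - intros x Hx. destruct (H x) as [HV _]; [lra|]. specialize (Hhalf x Hx).
    assert (HN := sum_sq_pos (X x - lam x) _ HV).
    set (a := X x - lam x) in *.
    apply (Rmult_le_reg_r (a ^ 2 + V x ^ 2)); [assumption|].
    unfold Rdiv. rewrite Rmult_assoc, Rinv_l by lra.
    apply (Rmult_le_reg_r (V 0)); [assumption|].
    replace (2 * / V 0 * (a ^ 2 + V x ^ 2) * V 0) with (2 * (a ^ 2 + V x ^ 2)) by (field; lra).
    assert (V 0 <= 2 * V x) by lra.
    assert (0 <= (a - V x) ^ 2) by apply pow2_ge_0.
    assert (0 <= (a + V x) ^ 2) by apply pow2_ge_0.
    destruct (Rle_dec 0 a); nra.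
Qed.

(* Since (h^2)' = 4 + 4 lam / (h - lam), the map h^2 differs from z^2 + 4 t by
   the integral of 4 lam / (h - lam).  By AM-GM the latter is controlled by the
   integral of 2 / |h - lam|^2, which is log (Im z / Im h). *)
Lemma trajectory_square_defect lam t X V e :
  0 < t -> 0 <= e -> upper_trajectory lam t X V ->
  (forall s, 0 <= s <= t -> Rabs (lam s) <= e * sqrt t) ->
  forall b, 0 <= b <= t ->
    Rabs (X b ^ 2 - V b ^ 2 - 4 * b - (X 0 ^ 2 - V 0 ^ 2))
      <= 2 * e * b + e * t * (ln (V 0) - ln (V b)) /\
    Rabs (2 * (X b * V b) - 2 * (X 0 * V 0))
      <= 2 * e * b + e * t * (ln (V 0) - ln (V b)).
Proof.
  intros Ht He H Hlam b Hb.
  set (N := fun s => (X s - lam s) ^ 2 + V s ^ 2).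
  assert (HN : forall s, 0 <= s <= t -> 0 < N s).
  { intros s Hs. apply sum_sq_pos, H, Hs. }
  set (q := sqrt t) in *. assert (Hq : q * q = t) by (apply sqrt_sqrt; lra).
  assert (Hq0 : 0 <= q) by apply sqrt_pos.
  (* [Key] serves both components of h^2: 1 / (h - lam) has real part (X - lam) / N and imaginary
     part - V / N, and [g] is one of these numerators. *)
  assert (Key : forall f g : R -> R,
    (forall s, 0 <= s <= t -> is_derive f s (4 * lam s * g s / N s) /\ g s ^ 2 <= N s) ->
    Rabs (f b - f 0) <= 2 * e * b + e * t * (ln (V 0) - ln (V b))).
  { intros f g Hf.
    (* Chosen so that G' = 2 e (1 + t / N), because (ln V)' = - 2 / N. *)
    set (G := fun s => 2 * e * s - e * t * ln (V s)).
    assert (HG : forall s, 0 <= s <= t -> is_derive G s (2 * e * (1 + t / N s))).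
    { intros s Hs. destruct (H s Hs) as [HV [_ HV']]. unfold G.
      auto_derive; [repeat split; [eexists; eauto|exact HV]|].
      rewrite (is_derive_unique (fun x0 : R => V x0) _ _ HV'). fold (N s).
      specialize (HN s Hs). field. lra. }
    assert (Hb1 : forall s, 0 <= s <= t -> Rabs (4 * lam s * g s / N s) <= 2 * e * (1 + t / N s)).
    { intros s Hs. specialize (HN s Hs). destruct (Hf s Hs) as [_ Hg].
      unfold Rdiv at 1. rewrite Rabs_mult, Rabs_inv, (Rabs_pos_eq (N s)) by lra.
      replace (2 * e * (1 + t / N s)) with (2 * e * (N s + t) * / N s) by (field; lra).
      apply Rmult_le_compat_r; [left; now apply Rinv_0_lt_compat|].
      rewrite !Rabs_mult, (Rabs_pos_eq 4) by lra.
      specialize (Hlam s Hs).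
      assert (0 <= Rabs (g s)) by apply Rabs_pos.
      assert (Rabs (g s) ^ 2 <= N s) by (rewrite pow2_abs; exact Hg).
      apply Rle_trans with (4 * (e * q) * Rabs (g s)); [apply Rmult_le_compat_r; lra|].
      assert (0 <= (q - Rabs (g s)) ^ 2) by apply pow2_ge_0.
      assert (2 * q * Rabs (g s) <= N s + t) by nra. nra. }
    assert (EG : G b - G 0 = 2 * e * b + e * t * (ln (V 0) - ln (V b))) by (unfold G; ring).
    rewrite <- EG. apply Rabs_le. split.
    - assert (- f b - - f 0 <= G b - G 0); [|lra].
      apply (le_of_derive_le (fun s => - f s) G (fun s => - (4 * lam s * g s / N s))
        (fun s => 2 * e * (1 + t / N s))); [lra|..].
      + intros s Hs. apply (is_derive_opp (K := R_AbsRing) (V := R_NormedModule)). apply Hf; lra.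
      + intros s Hs; apply HG; lra.
      + intros s Hs. destruct (Rabs_le_between' (4 * lam s * g s / N s) 0 (2 * e * (1 + t / N s))) as [Hx _].
        destruct Hx as [Hx1 Hx2]; [rewrite Rminus_0_r; apply Hb1; lra|]. lra.
    - apply (le_of_derive_le f G (fun s => 4 * lam s * g s / N s)
        (fun s => 2 * e * (1 + t / N s))); [lra|..].
      + intros s Hs; apply Hf; lra.
      + intros s Hs; apply HG; lra.
      + intros s Hs. destruct (Rabs_le_between' (4 * lam s * g s / N s) 0 (2 * e * (1 + t / N s))) as [Hx _].
        destruct Hx as [Hx1 Hx2]; [rewrite Rminus_0_r; apply Hb1; lra|]. lra. }
  split.
  - replace (X b ^ 2 - V b ^ 2 - 4 * b - (X 0 ^ 2 - V 0 ^ 2))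
      with ((fun s => X s ^ 2 - V s ^ 2 - 4 * s) b - (fun s => X s ^ 2 - V s ^ 2 - 4 * s) 0) by ring.
    apply (Key (fun s => X s ^ 2 - V s ^ 2 - 4 * s) (fun s => X s - lam s)).
    intros s Hs. destruct (H s Hs) as [HV [HX' HV']]. specialize (HN s Hs). split.
    + auto_derive; [repeat split; try (eexists; eauto; fail)|].
      rewrite (is_derive_unique (fun x0 : R => V x0) _ _ HV').
      rewrite (is_derive_unique (fun x0 : R => X x0) _ _ HX'). fold (N s).
      unfold N in *. field. lra.
    + unfold N. assert (0 <= (X s - lam s) ^ 2) by apply pow2_ge_0.
      assert (0 <= V s ^ 2) by apply pow2_ge_0. lra.
  - replace (2 * (X b * V b) - 2 * (X 0 * V 0))
      with ((fun s => 2 * (X s * V s)) b - (fun s => 2 * (X s * V s)) 0) by ring.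
    apply (Key (fun s => 2 * (X s * V s)) (fun s => - V s)).
    intros s Hs. destruct (H s Hs) as [HV [HX' HV']]. specialize (HN s Hs). split.
    + auto_derive; [repeat split; try (eexists; eauto; fail)|].
      rewrite (is_derive_unique (fun x0 : R => V x0) _ _ HV').
      rewrite (is_derive_unique (fun x0 : R => X x0) _ _ HX'). fold (N s).
      unfold N in *. field. lra.
    + unfold N. assert (0 <= (X s - lam s) ^ 2) by apply pow2_ge_0.
      assert (0 <= V s ^ 2) by apply pow2_ge_0. lra.
Qed.

(** Here atan ((X - u) / V) is pi / 2 - arg (h - u). From (h - u)' = - 2 (h - u) / ((h - lam) (u -
    lam)), the argument moves at the rate Im (- 2 / ((h - lam) (u - lam))), and only 1 / (h - lam)
    is not real there. *)
Lemma trajectory_angle_derive lam t X V u s :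
  upper_trajectory lam t X V -> real_trajectory lam t u -> 0 <= s <= t ->
  is_derive (fun s => atan ((X s - u s) / V s)) s
    (- (2 * V s / (((X s - lam s) ^ 2 + V s ^ 2) * (u s - lam s)))).
Proof.
  intros H Hu Hs. destruct (H s Hs) as [HV [HX' HV']].
  destruct (Hu s Hs) as [Hne Hu'].
  assert (HN := sum_sq_pos (X s - lam s) _ HV).
  assert (HN2 := sum_sq_pos (X s - u s) _ HV).
  auto_derive; [repeat split; try (eexists; eauto); lra|].
  rewrite (is_derive_unique (fun x0 : R => V x0) _ _ HV').
  rewrite (is_derive_unique (fun x0 : R => X x0) _ _ HX').
  rewrite (is_derive_unique (fun x0 : R => u x0) _ _ Hu').
  field. repeat split; try lra; nra.
Qed.

(* With u and v the images of boundary points on the two sides of the slit, the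
   harmonic measures of the two sides seen from z change at rates proportional
   to 1 / (u - lam) and 1 / (lam - v). *)
Lemma trajectory_angle_sum_nonincreasing lam t X V u v r a b :
  upper_trajectory lam t X V -> real_trajectory lam t u -> real_trajectory lam t v ->
  0 <= a -> a <= b -> b <= t ->
  (forall s, a <= s <= b -> 0 < u s - lam s /\ r * (u s - lam s) <= lam s - v s /\ 0 < lam s - v s) ->
  atan ((X b - u b) / V b) + r * atan ((X b - v b) / V b)
    <= atan ((X a - u a) / V a) + r * atan ((X a - v a) / V a).
Proof.
  intros H Hu Hv Ha Hab Hb Hr.
  set (N := fun s => (X s - lam s) ^ 2 + V s ^ 2).
  set (f := fun s => - (atan ((X s - u s) / V s) + r * atan ((X s - v s) / V s))).
  assert (f a <= f b); [|unfold f in *; lra].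
  apply (nondecreasing_of_derive f (fun s =>
    - (- (2 * V s / (N s * (u s - lam s))) + r * (- (2 * V s / (N s * (v s - lam s))))))); [assumption|..].
  - intros x Hx. unfold f.
    apply (is_derive_opp (K := R_AbsRing) (V := R_NormedModule)
      (fun s => atan ((X s - u s) / V s) + r * atan ((X s - v s) / V s))).
    apply (is_derive_plus (K := R_AbsRing) (V := R_NormedModule)
      (fun s => atan ((X s - u s) / V s)) (fun s => r * atan ((X s - v s) / V s))).
    + apply (trajectory_angle_derive lam t); auto; lra.
    + apply (is_derive_scal (fun s => atan ((X s - v s) / V s))).
      apply (trajectory_angle_derive lam t); auto; lra.
  - intros x Hx. destruct (H x) as [HV _]; [lra|].
    assert (HN := sum_sq_pos (X x - lam x) _ HV). fold (N x) in HN.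
    destruct (Hr x Hx) as [Hp [Hrr Hq]].
    replace (- (- (2 * V x / (N x * (u x - lam x))) + r * - (2 * V x / (N x * (v x - lam x)))))
      with (2 * V x * (lam x - v x - r * (u x - lam x)) * / (N x * (u x - lam x) * (lam x - v x)))
      by (field; repeat split; lra).
    apply Rmult_le_pos; [nra|]. left. apply Rinv_0_lt_compat.
    repeat apply Rmult_lt_0_compat; assumption.
Qed.

(** * Trajectories obtained from the slit maps *)

Lemma slit_domain_antitone gamma s t z :
  s <= t -> slit_domain gamma t z -> slit_domain gamma s z.
Proof.
  intros Hst [Hz Hn]. split; [exact Hz|]. intros [u [Hu Hzu]].
  apply Hn. exists u. split; [lra|exact Hzu].
Qed.

Lemma loewner_field_components (w : C) (l : R) :
  w <> RtoC l ->
  Re (RtoC 2 / (w - RtoC l))%C = 2 * (Re w - l) / ((Re w - l) ^ 2 + Im w ^ 2) /\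
  Im (RtoC 2 / (w - RtoC l))%C = - (2 * Im w) / ((Re w - l) ^ 2 + Im w ^ 2).
Proof.
  intros Hw. destruct w as [a v].
  assert (HN : (a - l) ^ 2 + v ^ 2 <> 0).
  { intros H0. apply Hw. unfold RtoC.
    assert (0 <= (a - l) ^ 2) by apply pow2_ge_0.
    assert (0 <= v ^ 2) by apply pow2_ge_0.
    assert (a - l = 0) by (apply Rsqr_0_uniq; unfold Rsqr; lra).
    assert (v = 0) by (apply Rsqr_0_uniq; unfold Rsqr; lra).
    f_equal; lra. }
  unfold Cdiv, Cinv, Cmult, Cminus, Cplus, Copp, RtoC, Re, Im; simpl in *.
  assert ((a - l) * ((a - l) * 1) + v * (v * 1) <> 0) by (intros E; apply HN; lra).
  split; field; repeat split; lra.
Qed.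

Lemma loewner_components_extend T lam (D : R -> C -> Prop) h t z :
  solves_loewner T lam D h -> 0 < t <= T -> (forall s, 0 <= s <= t -> D s z) ->
  exists X V : R -> R, forall s, 0 <= s <= t ->
    X s = Re (h z s) /\ V s = Im (h z s) /\
    is_derive X s (2 * (X s - lam s) / ((X s - lam s) ^ 2 + V s ^ 2)) /\
    is_derive V s (- (2 * V s) / ((X s - lam s) ^ 2 + V s ^ 2)).
Proof.
  intros [_ Hode] Ht HD.
  assert (Hd : forall s, 0 <= s <= t -> forall eps, 0 < eps -> exists d, 0 < d /\
    forall u, 0 <= u <= t -> Rabs (u - s) < d ->
      Rabs (Re (h z u) - Re (h z s) -
        (u - s) * Re (RtoC 2 / (h z s - RtoC (lam s)))%C) <= eps * Rabs (u - s) /\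
      Rabs (Im (h z u) - Im (h z s) -
        (u - s) * Im (RtoC 2 / (h z s - RtoC (lam s)))%C) <= eps * Rabs (u - s)).
  { intros s Hs eps Heps.
    destruct (Hode s z) as [_ Hw]; [lra|now apply HD|].
    destruct (is_derive_within_components (fun u => 0 <= u <= T) (h z) s _ (conj (proj1 Hs) (Rle_trans _ _ _ (proj2 Hs) (proj2 Ht))) Hw eps Heps)
      as [d [Hd0 Hd]].
    exists d; split; [exact Hd0|]. intros u Hu; apply Hd; lra. }
  destruct (derive_on_segment_extends (fun s => Re (h z s))
    (fun s => Re (RtoC 2 / (h z s - RtoC (lam s)))%C) t) as [X HX]; [lra| |].
  { intros s Hs eps Heps. destruct (Hd s Hs eps Heps) as [d [Hd0 Hd1]].
    exists d; split; [exact Hd0|]. intros u Hu Hus; now apply Hd1. }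
  destruct (derive_on_segment_extends (fun s => Im (h z s))
    (fun s => Im (RtoC 2 / (h z s - RtoC (lam s)))%C) t) as [V HV]; [lra| |].
  { intros s Hs eps Heps. destruct (Hd s Hs eps Heps) as [d [Hd0 Hd1]].
    exists d; split; [exact Hd0|]. intros u Hu Hus; now apply Hd1. }
  exists X, V. intros s Hs.
  destruct (HX s Hs) as [HX0 HX1], (HV s Hs) as [HV0 HV1].
  destruct (Hode s z) as [Hne _]; [lra|now apply HD|].
  destruct (loewner_field_components _ _ Hne) as [E1 E2].
  rewrite E1 in HX1. rewrite E2 in HV1. rewrite HX0, HV0. split; [reflexivity|split; [reflexivity|split; assumption]].
Qed.

Lemma slit_trajectory T lam h gamma t z :
  generates_slit_maps T lam h gamma -> 0 < t <= T -> slit_domain gamma t z ->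
  exists X V, upper_trajectory lam t X V /\ X 0 = Re z /\ V 0 = Im z /\
    forall s, 0 <= s <= t -> X s = Re (h z s) /\ V s = Im (h z s).
Proof.
  intros Hg Ht Hz.
  assert (HD : forall s, 0 <= s <= t -> slit_domain gamma s z).
  { intros s Hs. apply slit_domain_antitone with t; [lra|exact Hz]. }
  destruct (loewner_components_extend T lam _ h t z (gsm_ode _ _ _ _ Hg) Ht HD) as [X [V HXV]].
  destruct (HXV 0) as [E1 [E2 _]]; [lra|].
  rewrite (proj1 (gsm_ode _ _ _ _ Hg)) in E1, E2 by (apply HD; lra).
  exists X, V. repeat split; try assumption; try (apply HXV; assumption).
  destruct (HXV s H) as [_ [-> _]].
  destruct (gsm_conformal _ _ _ _ Hg s) as [_ [_ Hon]]; [lra|].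
  apply (Hon (h z s)). exists z; split; [now apply HD|reflexivity].
Qed.

Lemma continuous_on_segment_extends (f : R -> R) (T : R) :
  0 <= T -> continuous_on (fun t => 0 <= t <= T) f ->
  exists F, (forall x, continuity_pt F x) /\ forall x, 0 <= x <= T -> F x = f x.
Proof.
  intros HT Hf. set (cl := fun u => Rmax 0 (Rmin T u)).
  assert (Hcl : forall u, 0 <= cl u <= T).
  { intros u. unfold cl. split; [apply Rmax_l|]. apply Rmax_lub; [lra|apply Rmin_l]. }
  assert (Hlip : forall u v, Rabs (cl u - cl v) <= Rabs (u - v)).
  { assert (Hcase : forall u, (u <= 0 /\ cl u = 0) \/ (0 <= u <= T /\ cl u = u) \/ (T <= u /\ cl u = T)).
    { intros u. unfold cl. destruct (Rle_dec u 0); [left|right; destruct (Rle_dec u T); [left|right]];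
        (split; [lra|]).
      - rewrite Rmin_right, Rmax_left; lra.
      - rewrite Rmin_right, Rmax_right; lra.
      - rewrite Rmin_left, Rmax_right; lra. }
    intros u v. destruct (Hcase u) as [[? ->]|[[? ->]|[? ->]]], (Hcase v) as [[? ->]|[[? ->]|[? ->]]];
    unfold Rabs; repeat match goal with |- context [Rcase_abs ?a] => destruct (Rcase_abs a) end; lra. }
  exists (fun u => f (cl u)). split.
  - intros x. apply continuity_pt_filterlim. intros P HP.
    specialize (Hf (cl x) (Hcl x) P HP). destruct Hf as [d Hd].
    exists d. intros y Hy. apply Hd; [|apply Hcl].
    unfold ball in *; simpl in *; unfold AbsRing_ball, abs, minus, plus, opp in *; simpl in *.
    eapply Rle_lt_trans; [apply Hlip|exact Hy].
  - intros x Hx. f_equal. unfold cl. rewrite Rmin_right, Rmax_right; lra.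
Qed.

Lemma nonvanishing_positive (f : R -> R) (T : R) :
  (forall x, 0 <= x <= T -> continuity_pt f x) -> (forall x, 0 <= x <= T -> f x <> 0) ->
  0 < f 0 -> forall x, 0 <= x <= T -> 0 < f x.
Proof.
  intros Hc Hn H0 x Hx. destruct (Rlt_le_dec 0 (f x)) as [|Hle]; [assumption|exfalso].
  assert (f x <> 0) by now apply Hn.
  assert (0 < x). { destruct (Req_dec x 0) as [->|]; lra. }
  destruct (Ranalysis5.IVT_interv (fun y => - f y) 0 x) as [y [Hy Hfy]]; try lra.
  - intros a Ha. apply continuity_pt_opp. apply Hc; lra.
  - apply (Hn y); lra.
Qed.

Lemma is_derive_continuity_pt (f : R -> R) x l : is_derive f x l -> continuity_pt f x.
Proof.
  intros H. apply continuity_pt_filterlim, (ex_derive_continuous (K := R_AbsRing) f).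
  now exists l.
Qed.

(** [generates_slit_maps] speaks of the open half-plane only, so real starting points go through the
    reflected extension; its symmetry under conjugation keeps their trajectories real. *)
Lemma real_axis_trajectory T lam h gamma hminus hplus x :
  0 < T -> generates_slit_maps T lam h gamma ->
  reflected_slit_maps T lam h gamma hminus hplus -> x <> 0 ->
  exists u, real_trajectory lam T u /\ u 0 = x /\
    forall s, 0 <= s <= T -> h (RtoC x) s = RtoC (u s).
Proof.
  intros HT Hg Hr Hx.
  assert (Hup : forall s, 0 <= s <= T -> ~ slit gamma s (RtoC x)).
  { intros s Hs [u [Hu Hxu]]. destruct (gsm_arc _ _ _ _ Hg) as [_ [_ [_ Hp]]].
    assert (H := Hp u ltac:(lra)). rewrite <- Hxu in H. unfold upper, RtoC, Im in H; simpl in H; lra. }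
  assert (Hconj : Cconj (RtoC x) = RtoC x) by (unfold Cconj, RtoC; simpl; f_equal; ring).
  assert (HD : forall s, 0 <= s <= T -> double_slit_domain gamma s (RtoC x)).
  { intros s Hs [H|[H|H]].
    - now apply (Hup s).
    - rewrite Hconj in H. now apply (Hup s).
    - apply Hx. now injection H. }
  destruct (loewner_components_extend T lam _ h T (RtoC x) (rsm_ode _ _ _ _ _ _ Hr) ltac:(lra) HD)
    as [X [V HXV]].
  assert (Him : forall s, 0 <= s <= T -> Im (h (RtoC x) s) = 0).
  { intros s Hs. assert (E := rsm_conj _ _ _ _ _ _ Hr s (RtoC x) Hs (HD s Hs)).
    rewrite Hconj in E. apply (f_equal Im) in E. rewrite im_conj in E. lra. }
  assert (Heq : forall s, 0 <= s <= T -> h (RtoC x) s = RtoC (X s)).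
  { intros s Hs. destruct (HXV s Hs) as [E [_ _]]. rewrite E.
    apply injective_projections; [reflexivity|apply Him, Hs]. }
  exists X. split; [|split; [|exact Heq]].
  - intros s Hs. destruct (HXV s Hs) as [E [E2 [Hd _]]].
    assert (Hne : X s <> lam s).
    { intros Hl. destruct (proj2 (rsm_ode _ _ _ _ _ _ Hr) s (RtoC x) Hs (HD s Hs)) as [Hn _].
      apply Hn. rewrite Heq by assumption. now rewrite Hl. }
    split; [exact Hne|]. rewrite E2, Him in Hd by assumption.
    replace (2 / (X s - lam s)) with (2 * (X s - lam s) / ((X s - lam s) ^ 2 + 0 ^ 2)); [exact Hd|].
    field. lra.
  - destruct (HXV 0) as [E _]; [lra|]. rewrite E.
    rewrite (proj1 (rsm_ode _ _ _ _ _ _ Hr)) by (apply HD; lra). reflexivity.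
Qed.

Lemma real_trajectory_side T lam u :
  0 < T -> continuous_on (fun t => 0 <= t <= T) lam -> real_trajectory lam T u ->
  (lam 0 < u 0 -> forall s, 0 <= s <= T -> lam s < u s) /\
  (u 0 < lam 0 -> forall s, 0 <= s <= T -> u s < lam s).
Proof.
  intros HT Hl Hu.
  destruct (continuous_on_segment_extends lam T ltac:(lra) Hl) as [L [HLc HL]].
  assert (HLc' : forall x, 0 <= x <= T -> continuity_pt (fun s => u s - L s) x).
  { intros x Hx. apply continuity_pt_minus; [|apply HLc].
    eapply is_derive_continuity_pt. apply Hu; assumption. }
  assert (Hne : forall x, 0 <= x <= T -> u x - L x <> 0).
  { intros x Hx. rewrite HL by assumption. destruct (Hu x Hx) as [H _]. lra. }
  split; intros H0 s Hs.
  - assert (0 < u s - L s); [|rewrite HL in *; lra].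
    apply (nonvanishing_positive (fun s => u s - L s) T); auto.
    rewrite HL; lra.
  - assert (0 < - (u s - L s)); [|rewrite HL in *; lra].
    apply (nonvanishing_positive (fun s => - (u s - L s)) T); auto.
    + intros x Hx. apply continuity_pt_opp. auto.
    + intros x Hx. specialize (Hne x Hx). lra.
    + rewrite HL; lra.
Qed.

(** The tip is not in the domain of h(., t). Statements about it are made at the preimage of lam t +
    i e for a small e > 0, which survives to time t and ends near lam t. *)
Lemma hull_tip_approx T lam h gamma t sigma :
  generates_slit_maps T lam h gamma -> 0 < t <= T -> 0 < sigma ->
  exists z, slit_domain gamma t z /\
    Rabs (Re z - Re (gamma t)) < sigma /\ Rabs (Im z - Im (gamma t)) < sigma /\
    Rabs (Re (h z t) - lam t) < sigma /\ Im (h z t) < sigma.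
Proof.
  intros Hg Ht Hs.
  destruct (gsm_conformal _ _ _ _ Hg t) as [_ [_ Hon]]; [lra|].
  (* [gsm_tip] takes a total function. Guarding the relation by [upper w] lets choice produce one,
     with arbitrary values off the half-plane. *)
  set (P := fun w z => upper w -> slit_domain gamma t z /\ h z t = w).
  assert (Hex : forall w, exists z, P w z).
  { intros w. destruct (classic (upper w)) as [Hw|Hw].
    - destruct (proj1 (Hon w) Hw) as [z Hz]. exists z. intros _. exact Hz.
    - exists (RtoC 0). intros H; contradiction. }
  set (g := fun w => proj1_sig (constructive_indefinite_description _ (Hex w))).
  assert (Hgw : forall w, P w (g w)).
  { intros w. unfold g. apply proj2_sig. }
  assert (Hlim := gsm_tip _ _ _ _ Hg t g ltac:(lra) Hgw).
  destruct (Hlim (ball (gamma t) (mkposreal sigma Hs))) as [d Hd].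
  { now exists (mkposreal sigma Hs). }
  set (e := Rmin (d / 2) (sigma / 2)).
  assert (He : 0 < e /\ e < d /\ e < sigma).
  { assert (Hd0 := cond_pos d). unfold e. split; [apply Rmin_glb_lt; lra|].
    split; [eapply Rle_lt_trans; [apply Rmin_l|lra]|eapply Rle_lt_trans; [apply Rmin_r|lra]]. }
  set (w := (lam t, e) : C).
  assert (Hw : upper w) by (unfold upper, w, Im; simpl; lra).
  assert (Hb : ball (gamma t) (mkposreal sigma Hs) (g w)).
  { apply Hd; [|exact Hw].
    split; unfold w; simpl; unfold ball; simpl; unfold AbsRing_ball, abs, minus, plus, opp; simpl.
    - rewrite Rplus_opp_r, Rabs_R0. apply cond_pos.
    - rewrite Ropp_0, Rplus_0_r, Rabs_pos_eq; lra. }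
  destruct (Hgw w Hw) as [Hdom Hval].
  exists (g w). split; [exact Hdom|].
  destruct Hb as [Hb1 Hb2]. unfold ball in Hb1, Hb2; simpl in Hb1, Hb2.
  unfold AbsRing_ball, abs, minus, plus, opp in Hb1, Hb2; simpl in Hb1, Hb2.
  rewrite Hval. unfold w, Re, Im; simpl.
  repeat split; try assumption.
  - replace (lam t - lam t) with 0 by ring. now rewrite Rabs_R0.
  - lra.
Qed.

Lemma hull_height_le T lam h gamma t :
  generates_slit_maps T lam h gamma -> 0 < t <= T -> Im (gamma t) <= 2 * sqrt t.
Proof.
  intros Hg Ht. apply Rnot_lt_le. intros Hlt.
  assert (Hs0 : 0 < sqrt t) by (apply sqrt_lt_R0; lra).
  assert (Hss : sqrt t * sqrt t = t) by (apply sqrt_sqrt; lra).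
  (* Half the excess: then V 0 > 2 sqrt t + g while V t < g, against V 0 ^ 2 - 4 t <= V t ^ 2. *)
  set (g := (Im (gamma t) - 2 * sqrt t) / 2). assert (Hg0 : 0 < g) by (unfold g; lra).
  destruct (hull_tip_approx T lam h gamma t g Hg Ht Hg0) as [z [Hz [_ [Hiz [_ Hv]]]]].
  destruct (slit_trajectory T lam h gamma t z Hg Ht Hz) as [X [V [Htr [_ [HV0 Heq]]]]].
  assert (H1 := trajectory_height_sqr lam t X V 0 t Htr ltac:(lra) ltac:(lra) ltac:(lra)).
  destruct (Htr t) as [HVt _]; [lra|].
  destruct (Heq t) as [_ HV]; [lra|].
  apply Rabs_lt_between' in Hiz.
  assert (V 0 > 2 * sqrt t + g) by (unfold g in *; lra).
  nra.
Qed.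

(** * Boundary trajectories *)

(** Limits are taken in this form throughout: [K] collects the coefficients of the linear errors,
    and the bound [e0] allows quadratic errors to be absorbed. *)
Lemma le_of_le_add_eps (x y K e0 : R) :
  0 < e0 -> (forall e, 0 < e < e0 -> x <= y + K * e) -> x <= y.
Proof.
  intros He0 H. apply Rnot_lt_le. intros Hlt.
  assert (HK : 0 < Rabs K + 1) by (assert (0 <= Rabs K) by apply Rabs_pos; lra).
  set (e := Rmin (e0 / 2) ((x - y) / (2 * (Rabs K + 1)))).
  assert (H1 : 0 < (x - y) / (2 * (Rabs K + 1))) by (apply Rdiv_lt_0_compat; lra).
  assert (He : 0 < e) by (unfold e; apply Rmin_glb_lt; lra).
  assert (He1 : e <= e0 / 2) by apply Rmin_l.
  assert (He2 : e <= (x - y) / (2 * (Rabs K + 1))) by apply Rmin_r.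
  assert (He3 : e * (Rabs K + 1) <= (x - y) / 2).
  { apply Rle_trans with ((x - y) / (2 * (Rabs K + 1)) * (Rabs K + 1)).
    - apply Rmult_le_compat_r; lra.
    - right. field. lra. }
  specialize (H e ltac:(lra)).
  assert (K * e <= Rabs K * e) by (apply Rmult_le_compat_r; [lra|apply Rle_abs]).
  nra.
Qed.

Lemma at_right_0_eps (f : R -> R) (l : R) :
  filterlim f (at_right 0) (locally l) <->
  forall eps, 0 < eps -> exists d, 0 < d /\ forall t, 0 < t < d -> Rabs (f t - l) < eps.
Proof.
  split.
  - intros H eps Heps.
    destruct (H (fun y => Rabs (y - l) < eps)) as [d Hd].
    { exists (mkposreal eps Heps). intros y Hy. exact Hy. }
    exists d. split; [apply cond_pos|]. intros t Ht. apply Hd; [|lra].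
    unfold ball; simpl; unfold AbsRing_ball, abs, minus, plus, opp; simpl.
    rewrite Ropp_0, Rplus_0_r, Rabs_pos_eq; lra.
  - intros H Q [e He]. destruct (H e (cond_pos e)) as [d [Hd0 Hd]].
    exists (mkposreal d Hd0). intros t Ht Ht0. apply He.
    unfold ball in Ht |- *; simpl in Ht |- *; unfold AbsRing_ball, abs, minus, plus, opp in Ht |- *; simpl in Ht |- *.
    apply Hd. rewrite Ropp_0, Rplus_0_r, Rabs_pos_eq in Ht; lra.
Qed.

Lemma sqrt_asymptotic (f : R -> R) (c : R) :
  filterlim (fun t => f t / sqrt t) (at_right 0) (locally c) ->
  forall eps, 0 < eps -> exists d, 0 < d /\
    forall t, 0 < t < d -> Rabs (f t - c * sqrt t) <= eps * sqrt t.
Proof.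
  intros H eps Heps. destruct (proj1 (at_right_0_eps _ _) H eps Heps) as [d [Hd0 Hd]].
  exists d; split; [exact Hd0|]. intros t Ht. specialize (Hd t Ht).
  assert (Hs : 0 < sqrt t) by (apply sqrt_lt_R0; lra).
  replace (f t - c * sqrt t) with ((f t / sqrt t - c) * sqrt t) by (field; lra).
  rewrite Rabs_mult, (Rabs_pos_eq (sqrt t)) by lra.
  apply Rmult_le_compat_r; lra.
Qed.

(* u x and v x are the images under the flow of the boundary points x and -x. *)
Definition right_boundary_flow (lam : R -> R) (T : R) (hp : R -> R) (u : R -> R -> R) : Prop :=
  (forall x, 0 < x -> real_trajectory lam T (u x) /\ u x 0 = x /\
     (forall s, 0 <= s <= T -> lam s < u x s) /\
     (forall s, 0 < s <= T -> hp s <= u x s)) /\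
  (forall t, 0 < t <= T -> forall eps, 0 < eps -> exists x0, 0 < x0 /\
     forall x, 0 < x < x0 -> u x t < hp t + eps).

Definition left_boundary_flow (lam : R -> R) (T : R) (v : R -> R -> R) : Prop :=
  forall x, 0 < x -> real_trajectory lam T (v x) /\ v x 0 = - x /\
     (forall s, 0 <= s <= T -> v x s < lam s).

(** h^+(0, t) is given only as a limit of h(x, t) for each fixed t, so it is not known to solve the
    equation. Since h(x, t) increases with x, the limit is an infimum, which gives [hp <= u x]. *)
Lemma boundary_flows_exist T lam h gamma hminus hplus :
  0 < T -> continuous_on (fun t => 0 <= t <= T) lam -> lam 0 = 0 ->
  generates_slit_maps T lam h gamma ->
  reflected_slit_maps T lam h gamma hminus hplus ->
  exists u v, right_boundary_flow lam T hplus u /\ left_boundary_flow lam T v.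
Proof.
  intros HT Hlc Hl0 Hg Hr.
  assert (Hex : forall x, exists w, x <> 0 -> real_trajectory lam T w /\ w 0 = x /\
    forall s, 0 <= s <= T -> h (RtoC x) s = RtoC (w s)).
  { intros x. destruct (Req_dec x 0) as [Hx|Hx].
    - exists (fun _ => 0). intros; contradiction.
    - destruct (real_axis_trajectory T lam h gamma hminus hplus x HT Hg Hr Hx) as [w Hw].
      exists w; intros _; exact Hw. }
  set (w := fun x => proj1_sig (constructive_indefinite_description _ (Hex x))).
  assert (Hw : forall x, x <> 0 -> real_trajectory lam T (w x) /\ w x 0 = x /\
    forall s, 0 <= s <= T -> h (RtoC x) s = RtoC (w x s)).
  { intros x. unfold w. apply proj2_sig. }
  assert (Hlim : forall t, 0 < t <= T -> forall eps, 0 < eps -> exists x0, 0 < x0 /\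
     forall x, 0 < x < x0 -> Rabs (w x t - hplus t) < eps).
  { intros t Ht eps Heps.
    destruct (rsm_hplus _ _ _ _ _ _ Hr t Ht (ball (RtoC (hplus t)) (mkposreal eps Heps))) as [d Hd].
    { now exists (mkposreal eps Heps). }
    exists d; split; [apply cond_pos|]. intros x Hx.
    assert (Hb : ball (RtoC (hplus t)) (mkposreal eps Heps) (h (RtoC x) t)).
    { apply Hd; [|lra].
      unfold ball; simpl; unfold AbsRing_ball, abs, minus, plus, opp; simpl.
      rewrite Ropp_0, Rplus_0_r, Rabs_pos_eq; lra. }
    destruct (Hw x ltac:(lra)) as [_ [_ E]]. rewrite E in Hb by lra.
    destruct Hb as [Hb _]. exact Hb. }
  (* Injectivity of h(., s) prevents two real trajectories from meeting, so their initial order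
     persists. *)
  assert (Hmono : forall x y, 0 < x -> x < y -> forall t, 0 < t <= T -> w x t < w y t).
  { intros x y Hx Hxy t Ht.
    destruct (Hw x ltac:(lra)) as [Hx1 [Hx2 Hx3]], (Hw y ltac:(lra)) as [Hy1 [Hy2 Hy3]].
    assert (0 < w y t - w x t); [|lra].
    apply (nonvanishing_positive (fun s => w y s - w x s) T); try lra.
    - intros s Hs. apply continuity_pt_minus; eapply is_derive_continuity_pt;
        [apply Hy1|apply Hx1]; lra.
    - intros s Hs. destruct (Req_dec s 0) as [->|Hs0]; [lra|]. intros E0.
      destruct (rsm_conformal _ _ _ _ _ _ Hr s ltac:(lra)) as [_ [Hinj _]].
      assert (HD : forall p, 0 < p -> double_slit_domain gamma s (RtoC p)).
      { intros p Hp. destruct (gsm_arc _ _ _ _ Hg) as [_ [_ [_ Hpos]]].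
        intros [[q [Hq1 Hq2]]|[[q [Hq1 Hq2]]|H]].
        - assert (H := Hpos q ltac:(lra)). rewrite <- Hq2 in H. unfold upper, RtoC, Im in H; simpl in H; lra.
        - assert (H := Hpos q ltac:(lra)). rewrite <- Hq2 in H. unfold upper, RtoC, Im in H; simpl in H; lra.
        - injection H; lra. }
      assert (E : RtoC y = RtoC x).
      { apply Hinj; try (apply HD; lra). rewrite Hx3, Hy3 by lra. f_equal; lra. }
      injection E; lra. }
  exists w, (fun x => w (- x)). split; [split|].
  - intros x Hx. destruct (Hw x ltac:(lra)) as [H1 [H2 H3]].
    split; [exact H1|]. split; [exact H2|]. split.
    + apply (proj1 (real_trajectory_side T lam (w x) HT Hlc H1)). lra.
    + intros s Hs. apply Rnot_lt_le. intros Hlt.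
      destruct (Hlim s Hs (hplus s - w x s) ltac:(lra)) as [x0 [Hx0 Hlx]].
      set (y := Rmin (x0 / 2) (x / 2)).
      assert (Hy : 0 < y < x0 /\ y < x).
      { assert (y <= x0 / 2) by apply Rmin_l. assert (y <= x / 2) by apply Rmin_r.
        assert (0 < y) by (apply Rmin_glb_lt; lra). lra. }
      assert (A := Hlx y ltac:(lra)). assert (B := Hmono y x ltac:(lra) ltac:(lra) s Hs).
      apply Rabs_lt_between' in A. lra.
  - intros t Ht eps Heps. destruct (Hlim t Ht eps Heps) as [x0 [Hx0 Hlx]].
    exists x0; split; [exact Hx0|]. intros x Hx. specialize (Hlx x Hx).
    apply Rabs_lt_between' in Hlx. lra.
  - intros x Hx. destruct (Hw (- x) ltac:(lra)) as [H1 [H2 H3]].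
    split; [exact H1|]. split; [exact H2|].
    apply (proj2 (real_trajectory_side T lam (w (- x)) HT Hlc H1)). lra.
Qed.

Lemma right_flow_nondecreasing lam T hp u x a b :
  right_boundary_flow lam T hp u -> 0 < x -> 0 <= a -> a <= b -> b <= T -> u x a <= u x b.
Proof.
  intros [Hu _] Hx Ha Hab Hb. destruct (Hu x Hx) as [Htr [_ [Hl _]]].
  apply (nondecreasing_of_derive (u x) (fun s => 2 / (u x s - lam s))); [assumption|..].
  - intros s Hs. apply Htr; lra.
  - intros s Hs. specialize (Hl s ltac:(lra)). apply Rlt_le, Rdiv_lt_0_compat; lra.
Qed.

(** An integrated form of (h^+)' = 2 / (h^+ - lam) that asks for no derivative of h^+. Take [u x]
    close to [hp] at time a: it increases, so it stays above [hp a], and its speed is at most 2 /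
    (hp a - m). *)
Lemma hplus_increment_le lam T hp u a b m :
  right_boundary_flow lam T hp u -> 0 < a -> a <= b -> b <= T ->
  (forall s, a <= s <= b -> lam s <= m) -> m < hp a ->
  (hp b - hp a) * (hp a - m) <= 2 * (b - a).
Proof.
  intros Hfl Ha Hab HbT Hlm Hm. assert (Hfl' := Hfl). destruct Hfl as [Hu Hlim].
  apply le_of_le_add_eps with (K := hp a - m) (e0 := 1); [lra|].
  intros e He. destruct (Hlim a ltac:(lra) e ltac:(lra)) as [x0 [Hx0 Hx]].
  set (x := x0 / 2). specialize (Hx x ltac:(unfold x; lra)).
  assert (Hx0' : 0 < x) by (unfold x; lra).
  destruct (Hu x Hx0') as [Htr [_ [_ Hhp]]].
  assert (Hinc : u x b - u x a <= 2 / (hp a - m) * b - 2 / (hp a - m) * a).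
  { apply (le_of_derive_le (u x) (fun s => 2 / (hp a - m) * s)
      (fun s => 2 / (u x s - lam s)) (fun _ => 2 / (hp a - m))); [assumption|..].
    - intros s Hs. apply Htr; lra.
    - intros s Hs. auto_derive; [easy|ring].
    - intros s Hs. assert (A := Hhp a ltac:(lra)).
      assert (B := right_flow_nondecreasing lam T hp u x a s Hfl' Hx0' ltac:(lra) ltac:(lra) ltac:(lra)).
      specialize (Hlm s Hs).
      apply Rmult_le_compat_l; [lra|]. apply Rinv_le_contravar; lra. }
  assert (A := Hhp b ltac:(lra)).
  apply Rle_trans with ((2 / (hp a - m) * (b - a) + e) * (hp a - m)).
  - apply Rmult_le_compat_r; lra.
  - right. field. lra.
Qed.

(** Now [u x] is taken close to [hp] at the final time b, where it is largest; its speed on [a, b]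
    is at least 2 / (hp b + e - m). *)
Lemma hplus_increment_ge lam T hp u a b m :
  right_boundary_flow lam T hp u -> 0 < a -> a <= b -> b <= T ->
  (forall s, a <= s <= b -> m <= lam s) ->
  2 * (b - a) <= (hp b - hp a) * (hp b - m).
Proof.
  intros Hfl Ha Hab HbT Hlm. assert (Hfl' := Hfl). destruct Hfl as [Hu Hlim].
  apply le_of_le_add_eps with (K := Rabs (hp b - hp a) + Rabs (hp b - m) + 1) (e0 := 1); [lra|].
  intros e He. destruct (Hlim b ltac:(lra) e ltac:(lra)) as [x0 [Hx0 Hx]].
  set (x := x0 / 2). specialize (Hx x ltac:(unfold x; lra)).
  assert (Hx0' : 0 < x) by (unfold x; lra).
  destruct (Hu x Hx0') as [Htr [_ [Hl Hhp]]].
  set (D := hp b + e - m).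
  assert (HD : 0 < D).
  { unfold D. specialize (Hlm b ltac:(lra)). specialize (Hl b ltac:(lra)). lra. }
  assert (Hinc : 2 / D * b - 2 / D * a <= u x b - u x a).
  { apply (le_of_derive_le (fun s => 2 / D * s) (u x) (fun _ => 2 / D)
      (fun s => 2 / (u x s - lam s))); [assumption|..].
    - intros s Hs. auto_derive; [easy|ring].
    - intros s Hs. apply Htr; lra.
    - intros s Hs.
      assert (B := right_flow_nondecreasing lam T hp u x s b Hfl' Hx0' ltac:(lra) ltac:(lra) ltac:(lra)).
      specialize (Hlm s Hs). specialize (Hl s ltac:(lra)).
      apply Rmult_le_compat_l; [lra|]. apply Rinv_le_contravar; unfold D; lra. }
  assert (A := Hhp a ltac:(lra)).
  assert (F : 2 * (b - a) <= (hp b + e - hp a) * D).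
  { apply Rle_trans with (2 / D * (b - a) * D); [right; field; lra|].
    apply Rmult_le_compat_r; lra. }
  apply Rle_trans with (1 := F). unfold D.
  assert (hp b - hp a <= Rabs (hp b - hp a)) by apply Rle_abs.
  assert (hp b - m <= Rabs (hp b - m)) by apply Rle_abs.
  nra.
Qed.

(** Formally b / 2 = 2 / (b - c), from (h^+)' = 2 / (h^+ - lam). Without a derivative of h^+,
    increments over [q^2 t, t] are used. There lam lies between about c q sqrt t and c sqrt t, so
    the two bounds on b agree only as q -> 1, after t -> 0. *)
Lemma hplus_limit_equation lam T hp u b c :
  0 < T -> 0 <= c -> right_boundary_flow lam T hp u ->
  (forall eps, 0 < eps -> exists d, 0 < d /\
    forall t, 0 < t < d -> Rabs (lam t - c * sqrt t) <= eps * sqrt t) ->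
  (forall eps, 0 < eps -> exists d, 0 < d /\
    forall t, 0 < t < d -> Rabs (hp t - b * sqrt t) <= eps * sqrt t) ->
  b * (b - c) = 4 /\ c < b.
Proof.
  intros HT Hc Hfl Hlam Hhp.
  assert (Hge : c <= b).
  { apply le_of_le_add_eps with (K := 2) (e0 := 1); [lra|]. intros e He.
    destruct (Hlam e ltac:(lra)) as [d1 [Hd1 H1]], (Hhp e ltac:(lra)) as [d2 [Hd2 H2]].
    set (t := Rmin (T / 2) (Rmin (d1 / 2) (d2 / 2))).
    assert (Ht : 0 < t) by (unfold t; repeat apply Rmin_glb_lt; lra).
    assert (t <= T / 2) by apply Rmin_l.
    assert (t <= d1 / 2) by (eapply Rle_trans; [apply Rmin_r|apply Rmin_l]).
    assert (t <= d2 / 2) by (eapply Rle_trans; [apply Rmin_r|apply Rmin_r]).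
    specialize (H1 t ltac:(lra)). specialize (H2 t ltac:(lra)).
    apply Rabs_le_between' in H1. apply Rabs_le_between' in H2.
    assert (Hlh : lam t <= hp t).
    { apply le_of_le_add_eps with (K := 1) (e0 := 1); [lra|]. intros e' He'.
      destruct Hfl as [Hu Hl]. destruct (Hl t ltac:(lra) e' ltac:(lra)) as [x0 [Hx0 Hx]].
      specialize (Hx (x0 / 2) ltac:(lra)). destruct (Hu (x0 / 2) ltac:(lra)) as [_ [_ [A _]]].
      specialize (A t ltac:(lra)). lra. }
    assert (Hs : 0 < sqrt t) by (apply sqrt_lt_R0; lra).
    apply (Rmult_le_reg_r (sqrt t)); [assumption|]. lra. }
  (* Increments of hp between q^2 t and t, for fixed q < 1 and t -> 0. *)
  assert (Hq : forall q, 0 < q < 1 -> 2 * (1 + q) <= b * (b - c * q) /\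
      (c < q * b -> b * (q * b - c) <= 2 * (1 + q))).
  { intros q Hq.
    assert (Hsmall : forall e, 0 < e -> exists t, 0 < t <= T /\ forall s, 0 < s <= t ->
        (c - e) * sqrt s <= lam s <= (c + e) * sqrt s /\
        (b - e) * sqrt s <= hp s <= (b + e) * sqrt s).
    { intros e He. destruct (Hlam e He) as [d1 [Hd1 H1]], (Hhp e He) as [d2 [Hd2 H2]].
      exists (Rmin (T / 2) (Rmin (d1 / 2) (d2 / 2))).
      set (t := Rmin (T / 2) (Rmin (d1 / 2) (d2 / 2))).
      assert (Ht : 0 < t) by (unfold t; repeat apply Rmin_glb_lt; lra).
      assert (t <= T / 2) by apply Rmin_l.
      assert (t <= d1 / 2) by (eapply Rle_trans; [apply Rmin_r|apply Rmin_l]).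
      assert (t <= d2 / 2) by (eapply Rle_trans; [apply Rmin_r|apply Rmin_r]).
      split; [lra|]. intros s Hs.
      specialize (H1 s ltac:(lra)). specialize (H2 s ltac:(lra)).
      apply Rabs_le_between' in H1. apply Rabs_le_between' in H2. lra. }
    assert (Hsq : forall t, 0 < t -> sqrt (q ^ 2 * t) = q * sqrt t).
    { intros t Ht. rewrite sqrt_mult by nra. rewrite sqrt_pow2; lra. }
    assert (Hqq : 0 < q ^ 2 < 1) by (split; nra).
    split.
    - apply (Rmult_le_reg_l (1 - q)); [lra|].
      apply le_of_le_add_eps with (K := 4 * (b + c + 2)) (e0 := 1); [lra|].
      intros e He. destruct (Hsmall e ltac:(lra)) as [t [Ht Hs]].
      assert (Hr0 : 0 < sqrt t) by (apply sqrt_lt_R0; lra).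
      assert (Hrr : sqrt t * sqrt t = t) by (apply sqrt_sqrt; lra).
      assert (Hq2 : 0 < q ^ 2 * t <= t).
      { split; [apply Rmult_lt_0_compat; lra|]. rewrite <- (Rmult_1_l t) at 2.
        apply Rmult_le_compat_r; lra. }
      assert (I := hplus_increment_ge lam T hp u (q ^ 2 * t) t (c * q * sqrt t - e * sqrt t) Hfl
        ltac:(lra) ltac:(lra) ltac:(lra)).
      assert (Hm : forall s, q ^ 2 * t <= s <= t -> c * q * sqrt t - e * sqrt t <= lam s).
      { intros s Hss. destruct (Hs s ltac:(lra)) as [Hl _].
        assert (sqrt (q ^ 2 * t) <= sqrt s) by (apply sqrt_le_1; lra).
        assert (sqrt s <= sqrt t) by (apply sqrt_le_1; lra).
        rewrite Hsq in * by lra. nra. }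
      specialize (I Hm).
      destruct (Hs t ltac:(lra)) as [_ Ht1], (Hs (q ^ 2 * t) ltac:(lra)) as [_ Ht2].
      rewrite Hsq in Ht2 by lra. set (r := sqrt t) in *.
      assert (J1 : hp t - hp (q ^ 2 * t) <= (b * (1 - q) + 2 * e) * r) by nra.
      assert (J2 : hp t - (c * q * r - e * r) <= (b - c * q + 2 * e) * r) by nra.
      assert (J3 : 0 <= hp t - (c * q * r - e * r)).
      { assert (c * q <= c) by nra. nra. }
      assert (J4 : 2 * (t - q ^ 2 * t) <= (b * (1 - q) + 2 * e) * r * ((b - c * q + 2 * e) * r)).
      { eapply Rle_trans; [exact I|].
        apply Rle_trans with ((b * (1 - q) + 2 * e) * r * (hp t - (c * q * r - e * r))).
        - apply Rmult_le_compat_r; assumption.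
        - apply Rmult_le_compat_l; [|assumption]. nra. }
      assert (J5 : 2 * (1 - q ^ 2) <= (b * (1 - q) + 2 * e) * (b - c * q + 2 * e)).
      { apply (Rmult_le_reg_r (r * r)); [nra|]. rewrite Hrr at 1. lra. }
      assert (0 <= b * q) by nra. assert (0 <= c * q) by nra.
      assert (e * e <= e) by nra.
      assert (0 <= b * q * e) by nra. assert (0 <= c * q * e) by nra. assert (0 <= c * e) by nra.
      nra.
    - intros Hcq. apply (Rmult_le_reg_l (1 - q)); [lra|].
      apply le_of_le_add_eps with (K := 2 * (b + q * b)) (e0 := (q * b - c) / 3); [lra|].
      intros e He. destruct (Hsmall e ltac:(lra)) as [t [Ht Hs]].
      assert (Hr0 : 0 < sqrt t) by (apply sqrt_lt_R0; lra).
      assert (Hrr : sqrt t * sqrt t = t) by (apply sqrt_sqrt; lra).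
      assert (Hq2 : 0 < q ^ 2 * t <= t).
      { split; [apply Rmult_lt_0_compat; lra|]. rewrite <- (Rmult_1_l t) at 2.
        apply Rmult_le_compat_r; lra. }
      destruct (Hs t ltac:(lra)) as [_ Ht1], (Hs (q ^ 2 * t) ltac:(lra)) as [_ Ht2].
      rewrite Hsq in Ht2 by lra.
      assert (Hm : forall s, q ^ 2 * t <= s <= t -> lam s <= (c + e) * sqrt t).
      { intros s Hss. destruct (Hs s ltac:(lra)) as [Hl _].
        assert (sqrt s <= sqrt t) by (apply sqrt_le_1; lra). nra. }
      set (r := sqrt t) in *.
      assert (K1 : (q * b - c - 2 * e) * r <= hp (q ^ 2 * t) - (c + e) * r) by nra.
      assert (K2 : 0 < (q * b - c - 2 * e) * r) by (apply Rmult_lt_0_compat; lra).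
      assert (I := hplus_increment_le lam T hp u (q ^ 2 * t) t ((c + e) * r) Hfl
        ltac:(lra) ltac:(lra) ltac:(lra) Hm ltac:(lra)).
      assert (J1 : (b * (1 - q) - 2 * e) * r <= hp t - hp (q ^ 2 * t)) by nra.
      assert (J5 : (b * (1 - q) - 2 * e) * (q * b - c - 2 * e) <= 2 * (1 - q ^ 2)).
      { destruct (Rle_dec (b * (1 - q) - 2 * e) 0) as [Hn|Hn].
        - assert (0 <= 2 * (1 - q ^ 2)) by nra. nra.
        - apply (Rmult_le_reg_r (r * r)); [nra|]. rewrite Hrr at 2.
          apply Rle_trans with ((hp t - hp (q ^ 2 * t)) * (hp (q ^ 2 * t) - (c + e) * r)); [|lra].
          replace (_ * _ * (r * r)) with (((b * (1 - q) - 2 * e) * r) * ((q * b - c - 2 * e) * r)) by ring.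
          apply Rmult_le_compat; try lra. apply Rmult_le_pos; lra. }
      assert (0 < q * b) by lra. assert (0 <= c * e) by nra. assert (0 <= b * q * e) by nra.
      nra. }
  assert (Hlow : 4 <= b * (b - c)).
  { apply le_of_le_add_eps with (K := 2 + b * c) (e0 := 1); [lra|]. intros e He.
    destruct (Hq (1 - e) ltac:(lra)) as [H _]. nra. }
  assert (Hcb : c < b).
  { destruct Hge as [|E]; [assumption|]. subst. rewrite Rminus_diag in Hlow. lra. }
  split; [|assumption]. apply Rle_antisym; [|assumption].
  (* With q = 1 - e, the bound e < (b - c) / b is the condition c < q b under which the upper
     estimate holds. *)
  apply le_of_le_add_eps with (K := b * b) (e0 := Rmin 1 ((b - c) / b)).
  { apply Rmin_glb_lt; [lra|]. apply Rdiv_lt_0_compat; lra. }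
  intros e He. assert (e < 1) by (eapply Rlt_le_trans; [apply He|apply Rmin_l]).
  assert (e < (b - c) / b) by (eapply Rlt_le_trans; [apply He|apply Rmin_r]).
  assert (e * b < b - c).
  { apply Rlt_le_trans with ((b - c) / b * b); [|right; field; lra].
    apply Rmult_lt_compat_r; lra. }
  destruct (Hq (1 - e) ltac:(lra)) as [_ H3]. specialize (H3 ltac:(nra)). nra.
Qed.

(** * Vanishing of the limit of lam / sqrt t *)

Lemma is_derive_scal_sqrt (k s : R) : 0 < s -> is_derive (fun s => k * sqrt s) s (k / 2 / sqrt s).
Proof.
  intros Hs. assert (0 < sqrt s) by now apply sqrt_lt_R0.
  auto_derive; [exact Hs|field; lra].
Qed.

(** [u x] approaches [hp] only pointwise in time, and a bound uniform on [t1, t] is needed. So [u x]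
    is compared with [hp] at one early time t0; after it, u x >= hp >= (b - e) sqrt s bounds the
    speed by that of 4 / (b - c - 2 e) sqrt s. As b (b - c) = 4, the resulting coefficient is close
    to b. *)
Lemma right_flow_sqrt_bound lam T hp u b c e t t1 :
  right_boundary_flow lam T hp u -> 0 < e -> 0 < b -> c + 2 * e < b -> 0 < t1 <= t -> t <= T ->
  (forall s, 0 < s <= t -> lam s <= (c + e) * sqrt s) ->
  (forall s, 0 < s <= t -> (b - e) * sqrt s <= hp s <= (b + e) * sqrt s) ->
  exists x0, 0 < x0 /\ forall x, 0 < x < x0 -> forall s, t1 <= s <= t ->
    u x s <= (4 / (b - c - 2 * e) + e) * sqrt s.
Proof.
  intros [Hu Hlim] He Hb Hbc Ht1 Ht Hl Hh.
  (* Makes the value at t0 = k^2 t1, which is at most (b + 2 e) sqrt t0, no larger than e sqrt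
     t1. *)
  set (k := Rmin 1 (e / (b + 2 * e))).
  assert (Hk : 0 < k <= 1).
  { unfold k. split; [|apply Rmin_l].
    apply Rmin_glb_lt; [lra|apply Rdiv_lt_0_compat; lra]. }
  assert (Hke : k * (b + 2 * e) <= e).
  { apply Rle_trans with (e / (b + 2 * e) * (b + 2 * e)); [|right; field; lra].
    apply Rmult_le_compat_r; [lra|apply Rmin_r]. }
  assert (Hkk : 0 < k ^ 2 <= 1) by (split; nra).
  set (t0 := k ^ 2 * t1).
  assert (Ht0 : 0 < t0 <= t1) by (unfold t0; split; nra).
  assert (Hr1 : 0 < sqrt t1) by (apply sqrt_lt_R0; lra).
  assert (Hs0 : sqrt t0 = k * sqrt t1).
  { unfold t0. rewrite sqrt_mult, sqrt_pow2; lra. }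
  assert (Hr0 : 0 < sqrt t0) by (apply sqrt_lt_R0; lra).
  destruct (Hlim t0 ltac:(lra) (e * sqrt t0) ltac:(nra)) as [x0 [Hx0 Hx]].
  exists x0; split; [exact Hx0|]. intros x Hxx s Hs.
  specialize (Hx x Hxx). destruct (Hu x ltac:(lra)) as [Htr [_ [_ Hhp]]].
  assert (I : u x s - u x t0 <= 4 / (b - c - 2 * e) * sqrt s - 4 / (b - c - 2 * e) * sqrt t0).
  { apply (le_of_derive_le (u x) (fun s => 4 / (b - c - 2 * e) * sqrt s)
      (fun s => 2 / (u x s - lam s)) (fun s => 4 / (b - c - 2 * e) / 2 / sqrt s)); [lra|..].
    - intros w Hw; apply Htr; lra.
    - intros w Hw. apply is_derive_scal_sqrt; lra.
    - intros w Hw. assert (0 < sqrt w) by (apply sqrt_lt_R0; lra).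
      specialize (Hl w ltac:(lra)). destruct (Hh w ltac:(lra)) as [Hw1 _].
      specialize (Hhp w ltac:(lra)).
      replace (4 / (b - c - 2 * e) / 2 / sqrt w) with (2 / ((b - c - 2 * e) * sqrt w))
        by (field; lra).
      apply Rmult_le_compat_l; [lra|]. apply Rinv_le_contravar; [|lra].
      apply Rmult_lt_0_compat; lra. }
  destruct (Hh t0 ltac:(lra)) as [_ Hh0].
  assert (Hss : sqrt t1 <= sqrt s) by (apply sqrt_le_1; lra).
  assert (A : (b + 2 * e) * sqrt t0 <= e * sqrt t1) by (rewrite Hs0; nra).
  assert (B : 0 <= 4 / (b - c - 2 * e) * sqrt t0).
  { apply Rmult_le_pos; [|lra]. apply Rlt_le, Rdiv_lt_0_compat; lra. }
  assert (e * sqrt t1 <= e * sqrt s) by (apply Rmult_le_compat_l; lra).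
  lra.
Qed.

(** Two passes through the equation. As lam >= 0 > v, (v^2)' = 4 (- v) / (lam - v) <= 4, whence - v
    <= x + 2 sqrt s. Put back, this gives lam - v <= (2 + c + 2 e) sqrt s and so a lower bound for
    the speed of - v. Integrating from t0 = e^2 t1 costs the factor 1 - e. *)
Lemma left_flow_sqrt_bound lam T v c e t t1 :
  left_boundary_flow lam T v -> 0 < e < 1 -> 0 <= c -> 0 < t1 <= t -> t <= T ->
  (forall s, 0 <= s <= t -> 0 <= lam s <= (c + e) * sqrt s) ->
  exists x0, 0 < x0 /\ forall x, 0 < x < x0 -> forall s, t1 <= s <= t ->
    4 / (2 + c + 2 * e) * (1 - e) * sqrt s <= - v x s /\ - v x s <= x + 2 * sqrt s.
Proof.
  intros Hv He Hc Ht1 Ht Hl.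
  set (t0 := e ^ 2 * t1).
  assert (Hee : 0 < e ^ 2 < 1) by (split; nra).
  assert (Ht0 : 0 < t0 <= t1) by (unfold t0; split; nra).
  assert (Hr1 : 0 < sqrt t1) by (apply sqrt_lt_R0; lra).
  assert (Hs0 : sqrt t0 = e * sqrt t1).
  { unfold t0. rewrite sqrt_mult, sqrt_pow2; lra. }
  assert (Hr0 : 0 < sqrt t0) by (apply sqrt_lt_R0; lra).
  (* From t0 on, x <= e sqrt s, which is half of the 2 e in the denominator; the other half is the
     error of lam. *)
  exists (e * sqrt t0). split; [apply Rmult_lt_0_compat; lra|].
  intros x Hx s Hs. destruct (Hv x ltac:(lra)) as [Htr [Hv0 Hvl]].
  assert (Hneg : forall w, 0 <= w <= t -> v x w <= - x).
  { intros w Hw. assert (v x w - v x 0 <= (fun _ => 0) w - (fun _ => 0) 0); [|lra].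
    apply (le_of_derive_le (v x) (fun _ => 0) (fun s => 2 / (v x s - lam s)) (fun _ => 0)); [lra|..].
    - intros y Hy; apply Htr; lra.
    - intros y Hy. apply (is_derive_const (K := R_AbsRing) (V := R_NormedModule)).
    - intros y Hy. specialize (Hvl y ltac:(lra)).
      assert (/ (v x y - lam y) < 0) by (apply Rinv_lt_0_compat; lra). unfold Rdiv. lra. }
  assert (Hup : forall w, 0 <= w <= t -> - v x w <= x + 2 * sqrt w).
  { intros w Hw.
    assert (I : v x w ^ 2 - v x 0 ^ 2 <= 4 * w - 4 * 0).
    { apply (le_of_derive_le (fun s => v x s ^ 2) (fun s => 4 * s)
        (fun s => 2 * v x s * (2 / (v x s - lam s))) (fun _ => 4)); [lra|..].
      - intros y Hy. destruct (Htr y ltac:(lra)) as [Hne Hd].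
        auto_derive; [repeat split; eexists; eauto|].
        rewrite (is_derive_unique (fun x0 : R => v x x0) _ _ Hd). ring.
      - intros y Hy. auto_derive; [easy|ring].
      - intros y Hy. specialize (Hvl y ltac:(lra)). specialize (Hneg y ltac:(lra)).
        destruct (Hl y ltac:(lra)) as [Hl1 _].
        replace (2 * v x y * (2 / (v x y - lam y))) with (4 * (- v x y) * / (lam y - v x y))
          by (field; lra).
        apply (Rmult_le_reg_r (lam y - v x y)); [lra|].
        rewrite Rmult_assoc, Rinv_l by lra. lra. }
    rewrite Hv0 in I. assert (Hw0 := sqrt_pos w).
    assert (sqrt w * sqrt w = w) by (apply sqrt_sqrt; lra).
    specialize (Hneg w Hw). nra. }
  split; [|apply Hup; lra].
  assert (I : 4 / (2 + c + 2 * e) * sqrt s - 4 / (2 + c + 2 * e) * sqrt t0 <= - v x s - - v x t0).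
  { apply (le_of_derive_le (fun s => 4 / (2 + c + 2 * e) * sqrt s) (fun s => - v x s)
      (fun s => 4 / (2 + c + 2 * e) / 2 / sqrt s) (fun s => - (2 / (v x s - lam s)))); [lra|..].
    - intros w Hw. apply is_derive_scal_sqrt; lra.
    - intros w Hw. apply (is_derive_opp (K := R_AbsRing) (V := R_NormedModule)). apply Htr; lra.
    - intros w Hw. assert (0 < sqrt w) by (apply sqrt_lt_R0; lra).
      assert (sqrt t0 <= sqrt w) by (apply sqrt_le_1; lra).
      specialize (Hvl w ltac:(lra)). specialize (Hup w ltac:(lra)).
      destruct (Hl w ltac:(lra)) as [_ Hl2].
      replace (4 / (2 + c + 2 * e) / 2 / sqrt w) with (2 / ((2 + c + 2 * e) * sqrt w))
        by (field; lra).
      replace (- (2 / (v x w - lam w))) with (2 / (lam w - v x w)) by (field; lra).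
      apply Rmult_le_compat_l; [lra|]. apply Rinv_le_contravar; [lra|]. nra. }
  specialize (Hneg t0 ltac:(lra)).
  assert (Hss : sqrt t1 <= sqrt s) by (apply sqrt_le_1; lra).
  assert (0 < 4 / (2 + c + 2 * e)) by (apply Rdiv_lt_0_compat; lra).
  rewrite Hs0 in I. assert (e * sqrt t1 <= e * sqrt s) by (apply Rmult_le_compat_l; lra).
  nra.
Qed.

Lemma atan_le_id x : 0 <= x -> atan x <= x.
Proof.
  intros Hx.
  assert (atan x - atan 0 <= x - 0); [|rewrite atan_0 in *; lra].
  apply (le_of_derive_le atan (fun x => x) (fun x => / (1 + x ^ 2)) (fun _ => 1)); [assumption|..].
  - intros y Hy. auto_derive; [easy|]. field. nra.
  - intros y Hy. apply (is_derive_id (K := R_AbsRing)).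
  - intros y Hy. rewrite <- Rinv_1. apply Rinv_le_contravar; nra.
Qed.

(** The compared quantities are the coefficients of sqrt s in the upper bound of u - lam and in the
    lower bound of lam - v. At e = 0 the claim is b - c < 4 / (2 + c) + c, which follows from b - c
    < 2, that is from (b - c)^2 < b (b - c) = 4; continuity in e does the rest. *)
Lemma exists_boundary_rate_gap b c :
  0 < c -> b * (b - c) = 4 -> c < b ->
  exists e, 0 < e < 1 /\ e < c /\ c + 2 * e < b /\
    0 < 4 / (b - c - 2 * e) + e - (c - e) /\
    4 / (b - c - 2 * e) + e - (c - e) < 4 / (2 + c + 2 * e) * (1 - e) + (c - e).
Proof.
  intros Hc Hb Hcb.
  set (f := fun e => 4 / (2 + c + 2 * e) * (1 - e) + (c - e) - (4 / (b - c - 2 * e) + e - (c - e))).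
  assert (Hb4 : 4 / (b - c) = b) by (apply Rmult_eq_reg_r with (b - c); [field_simplify|]; lra).
  assert (Hf0 : 0 < f 0).
  { unfold f. replace (b - c - 2 * 0) with (b - c) by ring. rewrite Hb4.
    replace (2 + c + 2 * 0) with (2 + c) by ring.
    assert (b - c < 2) by nra.
    assert ((b - c) * (2 + c) < 4 + 2 * c) by nra.
    assert (b - c < 4 / (2 + c) + c); [|lra].
    apply (Rmult_lt_reg_r (2 + c)); [lra|].
    replace ((4 / (2 + c) + c) * (2 + c)) with (4 + c * (2 + c)) by (field; lra). nra. }
  assert (Hcont : continuity_pt f 0).
  { apply derivable_continuous_pt. unfold f. apply ex_derive_Reals_0. auto_derive; repeat split; lra. }
  destruct (Hcont (f 0) Hf0) as [d [Hd Hfd]].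
  set (e := Rmin (d / 2) (Rmin (1 / 2) (Rmin (c / 2) ((b - c) / 4)))).
  assert (He : 0 < e) by (unfold e; repeat apply Rmin_glb_lt; lra).
  assert (H1 : e <= d / 2) by apply Rmin_l.
  assert (H2 : e <= 1 / 2) by (eapply Rle_trans; [apply Rmin_r|apply Rmin_l]).
  assert (H3 : e <= c / 2).
  { eapply Rle_trans; [apply Rmin_r|]. eapply Rle_trans; [apply Rmin_r|]. apply Rmin_l. }
  assert (H4 : e <= (b - c) / 4).
  { eapply Rle_trans; [apply Rmin_r|]. eapply Rle_trans; [apply Rmin_r|]. apply Rmin_r. }
  exists e. repeat split; try lra.
  - assert (b <= 4 / (b - c - 2 * e)); [|lra]. rewrite <- Hb4 at 1.
    apply Rmult_le_compat_l; [lra|]. apply Rinv_le_contravar; lra.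
  - assert (Hfe : R_dist (f e) (f 0) < f 0).
    { apply Hfd. split; [split; [exact I|lra]|]. simpl. unfold R_dist.
      rewrite Rminus_0_r, Rabs_pos_eq; lra. }
    unfold R_dist in Hfe. apply Rabs_lt_between' in Hfe. unfold f in *. lra.
Qed.

(** In terms of atan = pi / 2 - arg, the weighted sum is nonincreasing. For a point near the tip it
    is at most a small multiple of [sg] at an early time [a], because the slit is perpendicular to
    the axis; at time t it should be at least about (r - 1) pi / 2. Half of that value already
    contradicts monotonicity. *)
Lemma driving_limit_zero T lam h gamma hp u v b c :
  0 < T -> 0 <= c -> lam 0 = 0 -> generates_slit_maps T lam h gamma ->
  right_boundary_flow lam T hp u -> left_boundary_flow lam T v ->
  (forall eps, 0 < eps -> exists d, 0 < d /\
    forall t, 0 < t < d -> Rabs (lam t - c * sqrt t) <= eps * sqrt t) ->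
  (forall eps, 0 < eps -> exists d, 0 < d /\
    forall t, 0 < t < d -> Rabs (hp t - b * sqrt t) <= eps * sqrt t) ->
  (forall eps, 0 < eps -> exists d, 0 < d /\
    forall t, 0 < t < d -> Rabs (Re (gamma t)) <= eps * Im (gamma t)) ->
  c = 0.
Proof.
  intros HT Hc Hl0 Hg Hu Hv Hlam Hhp Hperp.
  destruct (hplus_limit_equation lam T hp u b c HT Hc Hu Hlam Hhp) as [Hb Hcb].
  destruct Hc as [Hc|Hc]; [exfalso|auto].
  destruct (exists_boundary_rate_gap b c Hc Hb Hcb) as [e [He [Hec [Hceb [HP HPQ]]]]].
  set (P := 4 / (b - c - 2 * e) + e - (c - e)) in *.
  set (Q := 4 / (2 + c + 2 * e) * (1 - e) + (c - e)) in *.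
  set (r := Q / P).
  assert (Hr : 1 < r).
  { apply (Rmult_lt_reg_r P); [assumption|]. unfold r. replace (Q / P * P) with Q by (field; lra). lra. }
  assert (HrP : r * P = Q) by (unfold r; field; lra).
  assert (HPI := PI_RGT_0).
  (* Each atan at time [a] will be at most 20 sg, so the weighted sum there is at most half of (r -
     1) pi / 4. *)
  set (sg := Rmin (1 / 10) ((r - 1) * PI / 4 / (40 * (1 + r)))).
  assert (Hsg : 0 < sg).
  { apply Rmin_glb_lt; [lra|]. apply Rdiv_lt_0_compat; [|lra].
    apply Rdiv_lt_0_compat; [|lra]. apply Rmult_lt_0_compat; lra. }
  assert (Hsg1 : sg <= 1 / 10) by apply Rmin_l.
  assert (Hsg2 : (1 + r) * (40 * sg) <= (r - 1) * PI / 4).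
  { apply Rle_trans with ((1 + r) * (40 * ((r - 1) * PI / 4 / (40 * (1 + r))))).
    - apply Rmult_le_compat_l; [lra|]. apply Rmult_le_compat_l; [lra|]. apply Rmin_r.
    - right. field. lra. }
  destruct (Hlam e ltac:(lra)) as [d1 [Hd1 H1]], (Hhp e ltac:(lra)) as [d2 [Hd2 H2]],
    (Hperp sg Hsg) as [d3 [Hd3 H3]].
  set (t := Rmin (Rmin (T / 2) (d1 / 2)) (Rmin (d2 / 2) (d3 / 2))).
  assert (Ht : 0 < t) by (unfold t; repeat apply Rmin_glb_lt; lra).
  assert (HtT : t <= T / 2) by (eapply Rle_trans; [apply Rmin_l|apply Rmin_l]).
  assert (Ht1 : t <= d1 / 2) by (eapply Rle_trans; [apply Rmin_l|apply Rmin_r]).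
  assert (Ht2 : t <= d2 / 2) by (eapply Rle_trans; [apply Rmin_r|apply Rmin_l]).
  assert (Ht3 : t <= d3 / 2) by (eapply Rle_trans; [apply Rmin_r|apply Rmin_r]).
  assert (L : forall s, 0 < s <= t -> (c - e) * sqrt s <= lam s <= (c + e) * sqrt s).
  { intros s Hs. specialize (H1 s ltac:(lra)). apply Rabs_le_between' in H1. lra. }
  assert (Hh : forall s, 0 < s <= t -> (b - e) * sqrt s <= hp s <= (b + e) * sqrt s).
  { intros s Hs. specialize (H2 s ltac:(lra)). apply Rabs_le_between' in H2. lra. }
  assert (HY : 0 < Im (gamma t)).
  { destruct (gsm_arc _ _ _ _ Hg) as [_ [_ [_ Hp]]]. apply Hp. lra. }
  assert (HX := H3 t ltac:(lra)).
  set (Y := Im (gamma t)) in *.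
  (* The sqrt bounds on the boundary flows hold from a positive time on only. [a] is so small that
     before it neither the point near the tip nor [v x] moves by more than a few sg Y. *)
  set (a := Rmin t (sg ^ 2 * Y ^ 2 / 4)).
  assert (Hsg3 : 0 < sg ^ 2 <= 1 / 100) by (split; nra).
  assert (HY2 : 0 < Y ^ 2) by nra.
  assert (Ha : 0 < a <= t).
  { unfold a. split; [|apply Rmin_l]. apply Rmin_glb_lt; [assumption|]. nra. }
  assert (Ha2 : 4 * a <= sg ^ 2 * Y ^ 2).
  { assert (a <= sg ^ 2 * Y ^ 2 / 4) by apply Rmin_r. lra. }
  assert (Ha3 : 2 * sqrt a <= sg * Y).
  { assert (sqrt a * sqrt a = a) by (apply sqrt_sqrt; lra). assert (H0 := sqrt_pos a).
    assert (0 < sg * Y) by nra. nra. }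
  destruct (right_flow_sqrt_bound lam T hp u b c e t a Hu ltac:(lra) ltac:(lra) ltac:(lra) Ha ltac:(lra)
    (fun s Hs => proj2 (L s Hs)) Hh) as [x1 [Hx1 Hux]].
  assert (L' : forall s, 0 <= s <= t -> 0 <= lam s <= (c + e) * sqrt s).
  { intros s Hs. destruct (Req_dec s 0) as [->|Hs0].
    - rewrite Hl0, sqrt_0. lra.
    - specialize (L s ltac:(lra)). assert (0 <= (c - e) * sqrt s); [|lra].
      apply Rmult_le_pos; [lra|apply sqrt_pos]. }
  destruct (left_flow_sqrt_bound lam T v c e t a Hv He ltac:(lra) Ha ltac:(lra) L')
    as [x2 [Hx2 Hvx]].
  set (x := Rmin (sg * Y) (Rmin (x1 / 2) (x2 / 2))).
  assert (Hx : 0 < x) by (unfold x; repeat apply Rmin_glb_lt; nra).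
  assert (Hxa : x <= sg * Y) by apply Rmin_l.
  assert (Hxb : x <= x1 / 2) by (eapply Rle_trans; [apply Rmin_r|apply Rmin_l]).
  assert (Hxc : x <= x2 / 2) by (eapply Rle_trans; [apply Rmin_r|apply Rmin_r]).
  specialize (Hux x ltac:(lra)). specialize (Hvx x ltac:(lra)).
  destruct (proj1 Hu x Hx) as [Hutr [Hu0 [Hul _]]].
  destruct (Hv x Hx) as [Hvtr [Hv0 Hvl]].
  (* Then r atan M = (r + 1) pi / 4, and even if the other term is as low as - pi / 2 the sum at
     time t exceeds (r - 1) pi / 4. *)
  set (M := tan (PI / 2 * ((r + 1) / (2 * r)))).
  assert (Hrange : 0 < (r + 1) / (2 * r) < 1).
  { split; [apply Rdiv_lt_0_compat; lra|].
    apply (Rmult_lt_reg_r (2 * r)); [lra|].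
    replace ((r + 1) / (2 * r) * (2 * r)) with (r + 1) by (field; lra). lra. }
  assert (HatM : atan M = PI / 2 * ((r + 1) / (2 * r))).
  { apply atan_tan. split; [apply Rlt_trans with 0; [lra|apply Rmult_lt_0_compat; lra]|].
    rewrite <- (Rmult_1_r (PI / 2)) at 2. apply Rmult_lt_compat_l; lra. }
  assert (HM : 0 < M).
  { apply tan_gt_0; nra. }
  set (d := lam t - v x t).
  assert (Hd : 0 < d) by (unfold d; specialize (Hvl t ltac:(lra)); lra).
  (* The last two entries give X t - v x t > d / 2 >= M V t; the first keeps z within sg Y of the
     tip in each coordinate. *)
  set (sz := Rmin (sg * Y) (Rmin (d / 2) (d / (2 * M)))).
  assert (Hsz : 0 < sz).
  { repeat apply Rmin_glb_lt; [nra|lra|apply Rdiv_lt_0_compat; lra]. }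
  assert (Hsza : sz <= sg * Y) by apply Rmin_l.
  assert (Hszb : sz <= d / 2) by (eapply Rle_trans; [apply Rmin_r|apply Rmin_l]).
  assert (Hszc : sz <= d / (2 * M)) by (eapply Rle_trans; [apply Rmin_r|apply Rmin_r]).
  destruct (hull_tip_approx T lam h gamma t sz Hg ltac:(lra) Hsz)
    as [z [Hz [Hz1 [Hz2 [Hz3 Hz4]]]]].
  destruct (slit_trajectory T lam h gamma t z Hg ltac:(lra) Hz) as [X [V [Htr [HX0 [HV0 Heq]]]]].
  destruct (Heq t ltac:(lra)) as [EX EV].
  apply Rabs_lt_between' in Hz1. apply Rabs_lt_between' in Hz2. apply Rabs_lt_between' in Hz3.
  rewrite <- EX in Hz3. rewrite <- EV in Hz4. rewrite <- HX0 in Hz1. rewrite <- HV0 in Hz2.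
  apply Rabs_le_between in HX. fold Y in Hz2.
  assert (HVt : 0 < V t) by (apply Htr; lra).
  (* At time t almost all of the harmonic measure lies on the left of lam. *)
  assert (Hend : (r - 1) * PI / 4
    < atan ((X t - u x t) / V t) + r * atan ((X t - v x t) / V t)).
  { destruct (atan_bound ((X t - u x t) / V t)) as [Hat1 _].
    assert (M <= (X t - v x t) / V t).
    { apply (Rmult_le_reg_r (V t)); [assumption|].
      replace ((X t - v x t) / V t * V t) with (X t - v x t) by (field; lra).
      assert (M * V t <= M * (d / (2 * M))) by (apply Rmult_le_compat_l; lra).
      replace (M * (d / (2 * M))) with (d / 2) in * by (field; lra).
      unfold d in *; lra. }
    assert (atan M <= atan ((X t - v x t) / V t)).
    { destruct H as [H|H]; [left; now apply atan_increasing|right; now f_equal]. }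
    assert (r * atan M <= r * atan ((X t - v x t) / V t)) by (apply Rmult_le_compat_l; lra).
    replace (r * atan M) with (PI / 2 * (r + 1) / 2) in * by (rewrite HatM; field; lra).
    lra. }
  assert (Hrate : forall s, a <= s <= t -> 0 < u x s - lam s /\
    r * (u x s - lam s) <= lam s - v x s /\ 0 < lam s - v x s).
  { intros s Hs. specialize (Hul s ltac:(lra)). specialize (Hvl s ltac:(lra)).
    split; [lra|]. split; [|lra].
    specialize (Hux s Hs). destruct (Hvx s Hs) as [Hvx1 _]. specialize (L s ltac:(lra)).
    assert (u x s - lam s <= P * sqrt s) by (unfold P; lra).
    assert (Q * sqrt s <= lam s - v x s) by (unfold Q; lra).
    apply Rle_trans with (r * (P * sqrt s)); [apply Rmult_le_compat_l; lra|].
    rewrite <- Rmult_assoc, HrP. assumption. }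
  assert (Hmon := trajectory_angle_sum_nonincreasing lam t X V (u x) (v x) r a t Htr
    (fun s Hs => Hutr s ltac:(lra)) (fun s Hs => Hvtr s ltac:(lra))
    ltac:(lra) ltac:(lra) ltac:(lra) Hrate).
  assert (HsY : sg * Y <= 1 / 10 * Y) by (apply Rmult_le_compat_r; lra).
  assert (HV0Y : Y / 2 <= V 0) by lra.
  assert (HsY0 : 0 < sg * Y) by (apply Rmult_lt_0_compat; assumption).
  assert (Haq : 4 * a <= (sg * Y) * (sg * Y)) by lra.
  destruct (trajectory_abscissa_change lam t X V a Htr ltac:(lra) ltac:(lra)) as [HXa HVa].
  { assert ((Y / 2) ^ 2 <= V 0 ^ 2) by (apply pow_incr; lra).
    assert ((sg * Y) * (sg * Y) <= 1 / 10 * Y * (1 / 10 * Y)) by (apply Rmult_le_compat; lra).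
    lra. }
  assert (HaV : 2 * a / V 0 <= sg * Y).
  { apply (Rmult_le_reg_r (V 0)); [lra|].
    replace (2 * a / V 0 * V 0) with (2 * a) by (field; lra).
    assert (sg * Y * (sg * Y) <= sg * Y * V 0) by (apply Rmult_le_compat_l; lra). lra. }
  destruct (Hvx a ltac:(lra)) as [_ Hva].
  assert (Hua : v x a < u x a) by (specialize (Hul a ltac:(lra)); specialize (Hvl a ltac:(lra)); lra).
  (* One sg Y each for Re (gamma t), the distance of z from the tip, the drift of X up to [a], x,
     and 2 sqrt a. With V a >= Y / 4 this becomes 20 sg. *)
  assert (Hnum : X a - v x a <= 5 * (sg * Y)) by lra.
  assert (Hq : (X a - v x a) / V a <= 20 * sg).
  { apply (Rmult_le_reg_r (V a)); [lra|].
    replace ((X a - v x a) / V a * V a) with (X a - v x a) by (field; lra).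
    assert (20 * sg * (Y / 4) <= 20 * sg * V a) by (apply Rmult_le_compat_l; lra). lra. }
  assert (Hq' : (X a - u x a) / V a <= 20 * sg).
  { apply Rle_trans with (2 := Hq). apply Rmult_le_compat_r; [|lra].
    left; apply Rinv_0_lt_compat; lra. }
  assert (Hsmall : forall y, y <= 20 * sg -> atan y <= 20 * sg).
  { intros y [Hy| ->]; [|apply atan_le_id; lra].
    apply Rle_trans with (atan (20 * sg)); [left; now apply atan_increasing|apply atan_le_id; lra]. }
  assert (A1 := Hsmall _ Hq). assert (A2 := Hsmall _ Hq').
  assert (r * atan ((X a - v x a) / V a) <= r * (20 * sg)) by (apply Rmult_le_compat_l; lra).
  assert (0 < r * sg) by (apply Rmult_lt_0_compat; lra). lra.
Qed.

(** * The slit near its base point *)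

Lemma Cmod_le_components (z : C) : Cmod z <= Rabs (Re z) + Rabs (Im z).
Proof.
  assert (H1 := Rabs_pos (Re z)). assert (H2 := Rabs_pos (Im z)).
  apply Rsqr_incr_0_var; [|lra]. rewrite !Rsqr_pow2, Cmod2_alt.
  rewrite <- (pow2_abs (Re z)), <- (pow2_abs (Im z)). nra.
Qed.

Lemma im_le_Cmod (z : C) : Rabs (Im z) <= Cmod z.
Proof. apply Rle_trans with (2 := Rmax_Cmod z). apply Rmax_r. Qed.

(** Stands in for additivity of length: increments of [f] telescope along each inscribed polygon.
    They are nonnegative, so polygons that do not span all of [0, t] are covered too. *)
Lemma arc_length_le_telescope gamma t (f : R -> R) :
  0 <= t ->
  (forall a b, 0 <= a -> a <= b -> b <= t -> Cmod (gamma b - gamma a)%C <= f b - f a) ->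
  Rbar_le (arc_length gamma t) (f t - f 0).
Proof.
  intros Ht Hf. destruct (Lub_Rbar_correct (inscribed_length gamma t)) as [_ Hl].
  apply Hl. intros l [n [u [Hu [Hm ->]]]]. simpl.
  assert (Hsum : forall k, (k <= n)%nat ->
    sum_f_R0 (fun i => Cmod (gamma (u (S i)) - gamma (u i))%C) k <= f (u (S k)) - f (u O)).
  { induction k as [|k IH]; intros Hk; simpl.
    - apply Hf; [apply Hu|apply Hm|apply Hu]; lia.
    - assert (H1 := IH ltac:(lia)).
      assert (H2 : Cmod (gamma (u (S (S k))) - gamma (u (S k)))%C <= f (u (S (S k))) - f (u (S k)))
        by (apply Hf; [apply Hu|apply Hm|apply Hu]; lia).
      lra. }
  assert (Hfm : forall a b, 0 <= a -> a <= b -> b <= t -> f a <= f b).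
  { intros a b Ha Hab Hb. assert (A := Hf a b Ha Hab Hb).
    assert (B := Cmod_ge_0 (gamma b - gamma a)). lra. }
  assert (H0 := Hu O ltac:(lia)). assert (H1 := Hu (S n) ltac:(lia)).
  assert (A := Hfm 0 (u O) ltac:(lra) ltac:(lra) ltac:(lra)).
  assert (B := Hfm (u (S n)) t ltac:(lra) ltac:(lra) ltac:(lra)).
  specialize (Hsum n ltac:(lia)). lra.
Qed.

Lemma chord_le_arc_length gamma t a b :
  0 <= a -> a <= b -> b <= t -> Rbar_le (Cmod (gamma b - gamma a)%C) (arc_length gamma t).
Proof.
  intros Ha Hab Hb. destruct (Lub_Rbar_correct (inscribed_length gamma t)) as [H _].
  apply H. exists O, (fun i => match i with O => a | _ => b end).
  repeat split.
  - destruct i; lra.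
  - destruct i; lra.
  - intros i Hi. destruct i; [exact Hab|lia].
Qed.

Lemma arc_length_nondecreasing_Rbar gamma s t :
  s <= t -> Rbar_le (arc_length gamma s) (arc_length gamma t).
Proof.
  intros Hst. destruct (Lub_Rbar_correct (inscribed_length gamma s)) as [_ Hs].
  apply Hs. intros l [n [u [Hu [Hm Hl]]]].
  apply (proj1 (Lub_Rbar_correct (inscribed_length gamma t))).
  exists n, u. split; [|split; assumption]. intros i Hi. specialize (Hu i Hi). lra.
Qed.

Lemma arc_length_finite gamma T t :
  is_finite (arc_length gamma T) -> 0 <= t <= T -> is_finite (arc_length gamma t).
Proof.
  intros HT Ht. assert (H1 := arc_length_nondecreasing_Rbar gamma t T ltac:(lra)).
  assert (H2 := chord_le_arc_length gamma t 0 0 ltac:(lra) ltac:(lra) ltac:(lra)).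
  destruct (arc_length gamma t), (arc_length gamma T); simpl in *; try easy.
Qed.

(** The properties of length on which the rest relies. The last clause is the means of bounding a
    length from above. *)
Lemma arc_length_facts gamma T (s : R -> R) :
  0 < T -> is_finite (arc_length gamma T) -> gamma 0 = RtoC 0 ->
  (forall t, s t = real (arc_length gamma t)) ->
  s 0 = 0 /\
  (forall a b, 0 <= a -> a <= b -> b <= T -> s a <= s b) /\
  (forall a b, 0 <= a -> a <= b -> b <= T -> Cmod (gamma b - gamma a)%C <= s b) /\
  (forall t, 0 <= t <= T -> forall f : R -> R,
    (forall a b, 0 <= a -> a <= b -> b <= t -> Cmod (gamma b - gamma a)%C <= f b - f a) ->
    s t <= f t - f 0).
Proof.
  intros HT Hfin H0 Es.
  assert (Hs : forall t, 0 <= t <= T -> arc_length gamma t = Finite (s t)).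
  { intros t Ht. rewrite Es. symmetry. apply (arc_length_finite gamma T t Hfin Ht). }
  assert (Hle : forall t, 0 <= t <= T -> forall f : R -> R,
    (forall a b, 0 <= a -> a <= b -> b <= t -> Cmod (gamma b - gamma a)%C <= f b - f a) ->
    s t <= f t - f 0).
  { intros t Ht f Hf. assert (A := arc_length_le_telescope gamma t f ltac:(lra) Hf).
    rewrite Hs in A by lra. exact A. }
  assert (Hch : forall a b, 0 <= a -> a <= b -> b <= T -> Cmod (gamma b - gamma a)%C <= s b).
  { intros a b Ha Hab Hb. assert (A := chord_le_arc_length gamma b a b Ha Hab ltac:(lra)).
    rewrite Hs in A by lra. exact A. }
  split; [|split; [|split; assumption]].
  - apply Rle_antisym.
    + assert (A := Hle 0 ltac:(lra) (fun _ => 0)). cbv beta in A. rewrite Rminus_0_r in A. apply A.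
      intros a b Ha Hab Hb. replace b with a by lra.
      replace (gamma a - gamma a)%C with (RtoC 0) by ring. rewrite Cmod_0. lra.
    + apply Rle_trans with (2 := Hch 0 0 ltac:(lra) ltac:(lra) ltac:(lra)). apply Cmod_ge_0.
  - intros a b Ha Hab Hb. assert (A := arc_length_nondecreasing_Rbar gamma a b Hab).
    rewrite !Hs in A by lra. exact A.
Qed.

(** Strict differentiability estimates chords whose two ends are both near x0, as needed for
    polygons. It comes from continuity of the derived power series, also when x0 is an end of
    [a, b]. *)
Lemma analytic_on_strictly_differentiable (f : R -> R) (a b x0 : R) :
  a < b -> a <= x0 <= b -> analytic_on f a b ->
  exists l, forall eps, 0 < eps -> exists d, 0 < d /\
    forall x y, a <= x <= b -> a <= y <= b -> Rabs (x - x0) < d -> Rabs (y - x0) < d ->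
      Rabs (f x - f y - l * (x - y)) <= eps * Rabs (x - y).
Proof.
  intros Hab Hx0 Han. destruct (Han x0 Hx0) as [p [r [Hr Hp]]].
  assert (Hx1 : exists x1, a <= x1 <= b /\ Rabs (x1 - x0) < r /\ x1 <> x0).
  { set (m := Rmin (r / 2) ((b - a) / 2)).
    assert (m <= r / 2) by apply Rmin_l. assert (m <= (b - a) / 2) by apply Rmin_r.
    assert (0 < m) by (apply Rmin_glb_lt; lra).
    destruct (Rle_dec (x0 + m) b).
    - exists (x0 + m). repeat split; try lra. rewrite Rabs_pos_eq; lra.
    - exists (x0 - m). repeat split; try lra. rewrite Rabs_left; lra. }
  destruct Hx1 as [x1 [Hx1 [Hx1r Hne]]].
  set (rho := Rabs (x1 - x0)). assert (Hrho : 0 < rho) by (apply Rabs_pos_lt; lra).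
  (* [analytic_on] gives convergence at points of [a, b] only; a single such point x1 <> x0 bounds
     the radius below, and with it the series converges on both sides of x0. *)
  assert (HCV : Rbar_le rho (CV_radius p)).
  { apply Rbar_not_lt_le. intros Hlt. apply (CV_disk_outside p (x1 - x0) Hlt).
    assert (Hser := ex_intro (fun l => is_pseries p (x1 - x0) l) _ (Hp x1 Hx1 Hx1r)).
    apply ex_series_lim_0.
    apply ex_series_ext with (2 := Hser). intros n. simpl. rewrite pow_n_pow.
    unfold scal; simpl; unfold mult; simpl. ring. }
  assert (Hin : forall h, Rabs h < rho -> Rbar_lt (Rabs h) (CV_radius p)).
  { intros h Hh. apply Rbar_lt_le_trans with (2 := HCV). exact Hh. }
  set (dp := PSeries (PS_derive p)).
  assert (Hder : forall h, Rabs h < rho -> is_derive (PSeries p) h (dp h)).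
  { intros h Hh. apply is_derive_PSeries, Hin, Hh. }
  assert (Hcont : continuity_pt dp 0).
  { apply PSeries_continuity. rewrite CV_radius_derive.
    apply Hin. now rewrite Rabs_R0. }
  exists (dp 0). intros eps Heps. destruct (Hcont eps Heps) as [d [Hd Hdd]].
  exists (Rmin d (Rmin rho r)). split; [repeat apply Rmin_glb_lt; lra|].
  assert (Hval : forall x, a <= x <= b -> Rabs (x - x0) < r -> f x = PSeries p (x - x0)).
  { intros x Hx Hxr. symmetry. apply is_pseries_unique. now apply Hp. }
  intros x y Hx Hy Hxd Hyd.
  assert (HR : forall z, Rabs (z - x0) < Rmin d (Rmin rho r) ->
    Rabs (z - x0) < d /\ Rabs (z - x0) < rho /\ Rabs (z - x0) < r).
  { intros z Hz. assert (A := Rmin_l d (Rmin rho r)). assert (B := Rmin_r d (Rmin rho r)).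
    assert (A' := Rmin_l rho r). assert (B' := Rmin_r rho r). lra. }
  destruct (HR x Hxd) as [Hx1' [Hx2 Hx3]], (HR y Hyd) as [Hy1 [Hy2 Hy3]].
  rewrite (Hval x Hx Hx3), (Hval y Hy Hy3).
  set (x' := x - x0) in *. set (y' := y - x0) in *.
  replace (x - y) with (x' - y') by (unfold x', y'; ring).
  assert (Hseg : forall z, Rmin y' x' <= z <= Rmax y' x' -> Rabs z < rho /\ Rabs z < d).
  { intros z Hz. revert Hz. unfold Rmin, Rmax. destruct (Rle_dec y' x'); intros Hz;
    apply Rabs_lt_between in Hx1', Hx2, Hy1, Hy2; split; apply Rabs_lt_between; lra. }
  destruct (MVT_gen (PSeries p) y' x' dp) as [z [Hz ->]].
  - intros z Hz. apply Hder, Hseg. lra.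
  - intros z Hz. eapply is_derive_continuity_pt. apply Hder, Hseg, Hz.
  - replace (dp z * (x' - y') - dp 0 * (x' - y')) with ((dp z - dp 0) * (x' - y')) by ring.
    rewrite Rabs_mult. apply Rmult_le_compat_r; [apply Rabs_pos|].
    destruct (Req_dec z 0) as [->|Hz0].
    + rewrite Rminus_diag, Rabs_R0. lra.
    + left. apply Hdd. split; [split; [exact I|lra]|]. simpl. unfold R_dist.
      rewrite Rminus_0_r. apply Hseg, Hz.
Qed.

(** Continuity of [gamma] alone does not keep length from jumping at time 0. Let m be the infimum of
    s over positive times. Near the parameter m the curve (x, y) is Lipschitz, so short pieces of
    the slit starting after 0 have length at most K (s - m), and the chord from gamma 0 is small;
    hence s is small near 0 and m = 0. *)
Lemma slit_arc_length_tends_to_0 gamma T (x y : R -> R) :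
  0 < T -> is_finite (arc_length gamma T) -> simple_arc T gamma ->
  let s := fun t => real (arc_length gamma t) in
  let S := s T in
  analytic_on x (- S) S -> analytic_on y (- S) S ->
  (forall t, 0 <= t <= T -> gamma t = (x (s t), y (s t))) ->
  0 < S ->
  forall eps, 0 < eps -> exists d, 0 < d <= T /\ forall t, 0 <= t <= d -> s t < eps.
Proof.
  intros HT Hfin [Hcont [_ [H0 _]]] s S Hx Hy Hxy HS eps Heps.
  destruct (arc_length_facts gamma T s HT Hfin H0 (fun t => eq_refl)) as [Hs0 [Hmono [Hch Htel]]].
  assert (Hpos : forall t, 0 <= t <= T -> 0 <= s t).
  { intros t Ht. rewrite <- Hs0. apply Hmono; lra. }
  (* The infimum of s, as the supremum of its lower bounds. *)
  destruct (completeness (fun v => forall t, 0 < t <= T -> v <= s t)) as [m [Hm1 Hm2]].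
  { exists (s T). intros v Hv. apply Hv; lra. }
  { exists 0. intros t Ht. apply Hpos; lra. }
  assert (Hms : forall t, 0 < t <= T -> m <= s t).
  { intros t Ht. apply Hm2. intros v Hv. now apply Hv. }
  assert (Hm0 : 0 <= m) by (apply Hm1; intros t Ht; apply Hpos; lra).
  assert (Happ : forall e, 0 < e -> exists t, 0 < t <= T /\ s t < m + e).
  { intros e He. apply NNPP. intros Hn. assert (m + e <= m); [|lra].
    apply Hm1. intros t Ht. apply Rnot_lt_le. intros Hlt. apply Hn. now exists t. }
  enough (Hmz : m <= 0).
  { destruct (Happ eps Heps) as [t [Ht Hst]]. exists t. split; [exact Ht|].
    intros t' Ht'. apply Rle_lt_trans with (s t); [apply Hmono; lra|lra]. }
  assert (HmS : - S <= m <= S) by (split; [lra|unfold S; apply Hms; lra]).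
  destruct (analytic_on_strictly_differentiable x (- S) S m ltac:(lra) HmS Hx) as [lx Hlx].
  destruct (analytic_on_strictly_differentiable y (- S) S m ltac:(lra) HmS Hy) as [ly Hly].
  destruct (Hlx 1 ltac:(lra)) as [dx [Hdx Hdx']], (Hly 1 ltac:(lra)) as [dy [Hdy Hdy']].
  set (K := Rabs lx + Rabs ly + 2).
  assert (HK : 2 <= K) by (unfold K; assert (A := Rabs_pos lx); assert (B := Rabs_pos ly); lra).
  apply le_of_le_add_eps with (K := 2) (e0 := 1); [lra|]. intros e He.
  destruct (Happ (Rmin (Rmin dx dy) (e / K))) as [t1 [Ht1 Hst1]].
  { repeat apply Rmin_glb_lt; try lra. apply Rdiv_lt_0_compat; lra. }
  assert (M1 := Rmin_l (Rmin dx dy) (e / K)). assert (M2 := Rmin_r (Rmin dx dy) (e / K)).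
  assert (M3 := Rmin_l dx dy). assert (M4 := Rmin_r dx dy).
  assert (HeK : e / K * K = e) by (field; lra).
  destruct (Hcont 0 ltac:(simpl; lra) (ball (gamma 0) (e / 2))) as [d2 Hd2].
  { exists (mkposreal (e / 2) ltac:(lra)). intros w Hw. exact Hw. }
  set (t := Rmin t1 (d2 / 2)).
  assert (Hd2p := cond_pos d2).
  assert (Ht : 0 < t <= t1 /\ t < d2).
  { assert (A := Rmin_l t1 (d2 / 2)). assert (B := Rmin_r t1 (d2 / 2)).
    assert (0 < t) by (apply Rmin_glb_lt; lra). unfold t in *. lra. }
  assert (Hgam : forall a, 0 <= a <= t -> Cmod (gamma a) <= e).
  { intros a Ha. assert (B : ball (gamma 0) (e / 2) (gamma a)).
    { apply Hd2; [|lra]. unfold ball; simpl; unfold AbsRing_ball, abs, minus, plus, opp; simpl.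
      rewrite Ropp_0, Rplus_0_r, Rabs_pos_eq; lra. }
    destruct B as [B1 B2]. rewrite H0 in B1, B2.
    unfold ball in B1, B2; simpl in B1, B2; unfold AbsRing_ball, abs, minus, plus, opp in B1, B2; simpl in B1, B2.
    rewrite Ropp_0, Rplus_0_r in B1, B2.
    eapply Rle_trans; [apply Cmod_le_components|]. unfold Re, Im. lra. }
  (* The jump [e] at 0 pays for the one side of a polygon that starts at gamma 0. *)
  set (f := fun a => if Rle_dec a 0 then 0 else e + K * (s a - m)).
  assert (Hst : s t <= f t - f 0).
  { apply Htel; [lra|]. intros a b Ha Hab Hb. unfold f.
    destruct (Rle_dec a 0) as [Ha0|Ha0], (Rle_dec b 0) as [Hb0|Hb0]; try lra.
    - replace b with a by lra. replace (gamma a - gamma a)%C with (RtoC 0) by ring.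
      rewrite Cmod_0; lra.
    - replace a with 0 by lra. rewrite H0. replace (gamma b - RtoC 0)%C with (gamma b) by ring.
      assert (A := Hgam b ltac:(lra)). assert (B := Hms b ltac:(lra)).
      assert (0 <= K * (s b - m)) by (apply Rmult_le_pos; lra). lra.
    - assert (Hnear : forall w, 0 < w <= t -> - S <= s w <= S /\ Rabs (s w - m) < Rmin dx dy).
      { intros w Hw. assert (A := Hms w ltac:(lra)). assert (B := Hmono w t1 ltac:(lra) ltac:(lra) ltac:(lra)).
        assert (B' := Hmono w T ltac:(lra) ltac:(lra) ltac:(lra)). fold S in B'.
        split; [lra|]. rewrite Rabs_pos_eq; lra. }
      destruct (Hnear a ltac:(lra)) as [A1 A2], (Hnear b ltac:(lra)) as [B1 B2].
      specialize (Hdx' (s b) (s a) B1 A1 ltac:(lra) ltac:(lra)).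
      specialize (Hdy' (s b) (s a) B1 A1 ltac:(lra) ltac:(lra)).
      assert (Hsab := Hmono a b ltac:(lra) ltac:(lra) ltac:(lra)).
      rewrite (Rabs_pos_eq (s b - s a)) in Hdx', Hdy' by lra.
      eapply Rle_trans; [apply Cmod_le_components|].
      rewrite (Hxy a ltac:(lra)), (Hxy b ltac:(lra)).
      change (Re ((x (s b), y (s b)) - (x (s a), y (s a)))%C) with (x (s b) - x (s a)).
      change (Im ((x (s b), y (s b)) - (x (s a), y (s a)))%C) with (y (s b) - y (s a)).
      assert (Q : forall g l, Rabs (g - l * (s b - s a)) <= 1 * (s b - s a) ->
        Rabs g <= (Rabs l + 1) * (s b - s a)).
      { intros g l Hgl. replace g with (g - l * (s b - s a) + l * (s b - s a)) by ring.
        eapply Rle_trans; [apply Rabs_triang|]. rewrite Rabs_mult, (Rabs_pos_eq (s b - s a)); lra. }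
      assert (Q1 := Q _ _ Hdx'). assert (Q2 := Q _ _ Hdy').
      unfold K. lra. }
  unfold f in Hst. destruct (Rle_dec t 0); [lra|]. destruct (Rle_dec 0 0); [|lra].
  assert (A := Hms t ltac:(lra)). assert (B := Hmono t t1 ltac:(lra) ltac:(lra) ltac:(lra)).
  assert (K * (s t - m) <= K * (e / K)) by (apply Rmult_le_compat_l; lra). lra.
Qed.

(** [k] is y'(0), and x'(0) = 0 because x is even. Estimates in the parameter s become estimates in
    t because s -> 0. *)
Lemma slit_perpendicular_at_0 gamma T :
  0 < T -> simple_arc T gamma -> analytic_slit T gamma ->
  let s := fun t => real (arc_length gamma t) in
  exists k, 0 < k /\ forall eps, 0 < eps -> exists d, 0 < d <= T /\
    forall t, 0 < t < d -> 0 < s t /\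
      Rabs (Re (gamma t)) <= eps * s t /\ Rabs (Im (gamma t) - k * s t) <= eps * s t.
Proof.
  intros HT Harc [Hfin [x [y [Hx [Hy [Hsym Hxy]]]]]] s.
  assert (Harc' := Harc). destruct Harc' as [_ [_ [H0 Hup]]].
  destruct (arc_length_facts gamma T s HT Hfin H0 (fun t => eq_refl)) as [Hs0 [Hmono [Hch Htel]]].
  set (S := real (arc_length gamma T)) in *.
  assert (Hpos : forall t, 0 < t <= T -> 0 < s t).
  { intros t Ht. apply Rlt_le_trans with (2 := Hch 0 t ltac:(lra) ltac:(lra) ltac:(lra)).
    rewrite H0. replace (gamma t - RtoC 0)%C with (gamma t) by ring.
    apply Rlt_le_trans with (2 := im_le_Cmod _). specialize (Hup t Ht). unfold upper in Hup.
    rewrite Rabs_pos_eq; lra. }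
  assert (HS : 0 < S) by (apply (Hpos T); lra).
  assert (Hlim := slit_arc_length_tends_to_0 gamma T x y HT Hfin Harc Hx Hy Hxy HS). fold s in Hlim.
  destruct (analytic_on_strictly_differentiable x (- S) S 0 ltac:(lra) ltac:(lra) Hx) as [lx Hlx].
  destruct (analytic_on_strictly_differentiable y (- S) S 0 ltac:(lra) ltac:(lra) Hy) as [k Hk].
  assert (Hx0 : x 0 = 0 /\ y 0 = 0).
  { assert (E := Hxy 0 ltac:(lra)). simpl in E. rewrite H0 in E. fold (s 0) in E. rewrite Hs0 in E.
    injection E as E1 E2. lra. }
  (* Strict differentiability on the chord from - w to w, whose ends have equal abscissa, reads |lx|
     2 w <= e 2 w. *)
  assert (Hlx0 : lx = 0).
  { assert (Rabs lx <= 0).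
    { apply le_of_le_add_eps with (K := 1) (e0 := 1); [lra|]. intros e He.
      destruct (Hlx e ltac:(lra)) as [d [Hd Hdd]].
      set (w := Rmin (d / 2) S). assert (W1 := Rmin_l (d / 2) S). assert (W2 := Rmin_r (d / 2) S).
      assert (W : 0 < w) by (apply Rmin_glb_lt; lra). fold w in W1, W2.
      specialize (Hdd (- w) w ltac:(lra) ltac:(lra)).
      rewrite (proj1 (Hsym w ltac:(lra))) in Hdd.
      rewrite !Rminus_0_r, Rabs_Ropp, (Rabs_pos_eq w) in Hdd by lra.
      specialize (Hdd ltac:(lra) ltac:(lra)).
      replace (x w - x w - lx * (- w - w)) with (lx * (2 * w)) in Hdd by ring.
      replace (- w - w) with (- (2 * w)) in Hdd by ring.
      rewrite Rabs_Ropp, Rabs_mult, (Rabs_pos_eq (2 * w)) in Hdd by lra.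
      apply (Rmult_le_reg_r (2 * w)); lra. }
    assert (A := Rabs_pos lx). apply NNPP. intros Hn. apply Rabs_no_R0 in Hn. lra. }
  subst lx.
  assert (Hest : forall eps, 0 < eps -> exists d, 0 < d <= T /\
    forall a b, 0 <= a -> a <= b -> b <= d ->
      Rabs (x (s b) - x (s a)) <= eps * (s b - s a) /\
      Rabs (y (s b) - y (s a) - k * (s b - s a)) <= eps * (s b - s a)).
  { intros eps Heps. destruct (Hlx eps Heps) as [dx [Hdx Hdx']], (Hk eps Heps) as [dy [Hdy Hdy']].
    destruct (Hlim (Rmin dx dy)) as [d [Hd Hds]]; [apply Rmin_glb_lt; lra|].
    assert (M3 := Rmin_l dx dy). assert (M4 := Rmin_r dx dy).
    exists d. split; [exact Hd|]. intros a b Ha Hab Hb.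
    assert (Hnear : forall w, 0 <= w <= d -> - S <= s w <= S /\ Rabs (s w - 0) < Rmin dx dy).
    { intros w Hw. assert (A := Hmono 0 w ltac:(lra) ltac:(lra) ltac:(lra)).
      assert (B' := Hmono w T ltac:(lra) ltac:(lra) ltac:(lra)). specialize (Hds w Hw).
      change (s T) with S in B'.
      split; [lra|]. rewrite Rabs_pos_eq; lra. }
    destruct (Hnear a ltac:(lra)) as [A1 A2], (Hnear b ltac:(lra)) as [B1 B2].
    assert (Hsab := Hmono a b ltac:(lra) ltac:(lra) ltac:(lra)).
    specialize (Hdx' (s b) (s a) B1 A1 ltac:(lra) ltac:(lra)).
    specialize (Hdy' (s b) (s a) B1 A1 ltac:(lra) ltac:(lra)).
    rewrite (Rabs_pos_eq (s b - s a)) in Hdx', Hdy' by lra.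
    rewrite Rmult_0_l, Rminus_0_r in Hdx'. split; assumption. }
  assert (Hxy' : forall t, 0 <= t <= T -> Re (gamma t) = x (s t) /\ Im (gamma t) = y (s t)).
  { intros t Ht. rewrite (Hxy t Ht). split; reflexivity. }
  assert (Hest0 : forall eps, 0 < eps -> exists d, 0 < d <= T /\
    forall t, 0 < t < d -> 0 < s t /\
      Rabs (Re (gamma t)) <= eps * s t /\ Rabs (Im (gamma t) - k * s t) <= eps * s t).
  { intros eps Heps. destruct (Hest eps Heps) as [d [Hd Hdd]]. exists d; split; [exact Hd|].
    intros t Ht. destruct (Hxy' t ltac:(lra)) as [-> ->].
    destruct (Hdd 0 t ltac:(lra) ltac:(lra) ltac:(lra)) as [A B].
    rewrite Hs0, (proj1 Hx0), !Rminus_0_r in A. rewrite Hs0, (proj2 Hx0), !Rminus_0_r in B.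
    split; [apply Hpos; lra|]. split; assumption. }
  exists k. split; [|exact Hest0].
  assert (Hk0 : 0 <= k).
  { apply Rnot_lt_le. intros Hkn. destruct (Hest0 (- k / 2) ltac:(lra)) as [d [Hd Hdd]].
    destruct (Hdd (d / 2) ltac:(lra)) as [A [_ B]].
    specialize (Hup (d / 2) ltac:(lra)). unfold upper in Hup.
    apply Rabs_le_between' in B. nra. }
  (* Were the curve to leave 0 with velocity 0, its chords would be too short
     for an arc-length parametrization. *)
  destruct Hk0 as [|Hk0]; [assumption|exfalso]. subst k.
  destruct (Hest (1 / 4) ltac:(lra)) as [d [Hd Hdd]].
  assert (Hsd : s d <= (fun a => 1 / 2 * s a) d - (fun a => 1 / 2 * s a) 0).
  { apply (Htel d ltac:(lra) (fun a => 1 / 2 * s a)). intros a b Ha Hab Hb.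
    destruct (Hdd a b Ha Hab Hb) as [A B]. rewrite Rmult_0_l, Rminus_0_r in B.
    eapply Rle_trans; [apply Cmod_le_components|].
    rewrite (Hxy a ltac:(lra) : gamma a = (x (s a), y (s a))),
      (Hxy b ltac:(lra) : gamma b = (x (s b), y (s b))).
    change (Re ((x (s b), y (s b)) - (x (s a), y (s a)))%C) with (x (s b) - x (s a)).
    change (Im ((x (s b), y (s b)) - (x (s a), y (s a)))%C) with (y (s b) - y (s a)).
    lra. }
  assert (A := Hpos d ltac:(lra)). cbv beta in Hsd; rewrite Hs0 in Hsd. lra.
Qed.

(** * The mean value property *)

Definition curve_derive (p : R -> C) (t : R) (q : C) : Prop :=
  forall eps, 0 < eps -> exists d, 0 < d /\ forall h, Rabs h < d ->
    Cmod (p (t + h)%R - p t - RtoC h * q)%C <= eps * Rabs h.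

Lemma is_derive_increment (f : R -> R) (t l : R) :
  is_derive f t l <->
  (forall eps, 0 < eps -> exists d, 0 < d /\ forall h, Rabs h < d ->
    Rabs (f (t + h) - f t - h * l) <= eps * Rabs h).
Proof.
  split.
  - intros H eps Heps. apply is_derive_Reals in H. destruct (H eps Heps) as [d Hd].
    exists d; split; [apply cond_pos|]. intros h Hh.
    destruct (Req_dec h 0) as [->|Hh0].
    + replace (f (t + 0) - f t - 0 * l) with 0 by (rewrite Rplus_0_r; ring).
      rewrite Rabs_R0. lra.
    + specialize (Hd h Hh0 Hh).
      replace (f (t + h) - f t - h * l) with (((f (t + h) - f t) / h - l) * h) by (field; assumption).
      rewrite Rabs_mult. apply Rmult_le_compat_r; [apply Rabs_pos|lra].
  - intros H. apply is_derive_Reals. intros eps Heps.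
    destruct (H (eps / 2) ltac:(lra)) as [d [Hd Hdd]].
    exists (mkposreal d Hd). intros h Hh0 Hh. specialize (Hdd h Hh).
    assert (0 < Rabs h) by now apply Rabs_pos_lt.
    replace ((f (t + h) - f t) / h - l) with ((f (t + h) - f t - h * l) / h) by (field; assumption).
    unfold Rdiv. rewrite Rabs_mult, Rabs_inv.
    apply Rle_lt_trans with (eps / 2 * Rabs h * / Rabs h).
    + apply Rmult_le_compat_r; [left; now apply Rinv_0_lt_compat|exact Hdd].
    + rewrite Rmult_assoc, Rinv_r by lra. lra.
Qed.

Lemma curve_derive_pair (a b : R -> R) (t a' b' : R) :
  is_derive a t a' -> is_derive b t b' -> curve_derive (fun s => (a s, b s)) t (a', b').
Proof.
  intros Ha Hb eps Heps.
  destruct (proj1 (is_derive_increment _ _ _) Ha (eps / 2) ltac:(lra)) as [d1 [Hd1 H1]].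
  destruct (proj1 (is_derive_increment _ _ _) Hb (eps / 2) ltac:(lra)) as [d2 [Hd2 H2]].
  exists (Rmin d1 d2). split; [now apply Rmin_glb_lt|]. intros h Hh.
  specialize (H1 h (Rlt_le_trans _ _ _ Hh (Rmin_l _ _))).
  specialize (H2 h (Rlt_le_trans _ _ _ Hh (Rmin_r _ _))).
  eapply Rle_trans; [apply Cmod_le_components|].
  replace (Re _) with (a (t + h) - a t - h * a') by (unfold Re; simpl; ring).
  replace (Im _) with (b (t + h) - b t - h * b') by (unfold Im; simpl; ring).
  lra.
Qed.

Lemma curve_derive_components (p : R -> C) (t : R) (q : C) :
  curve_derive p t q -> is_derive (fun s => Re (p s)) t (Re q) /\ is_derive (fun s => Im (p s)) t (Im q).
Proof.
  intros H. split; apply is_derive_increment; intros eps Heps;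
  destruct (H eps Heps) as [d [Hd Hdd]]; exists d; (split; [exact Hd|]); intros h Hh;
  apply Rle_trans with (2 := Hdd h Hh).
  - eapply Rle_trans; [|apply re_le_Cmod]. right. f_equal. unfold Re; simpl; ring.
  - eapply Rle_trans; [|apply im_le_Cmod]. right. f_equal. unfold Im; simpl; ring.
Qed.

Lemma complex_derive_increment (f : C -> C) (z l : C) :
  is_derive (K := C_AbsRing) (V := C_NormedModule) f z l ->
  forall eps, 0 < eps -> exists d, 0 < d /\ forall w, Cmod (w - z)%C < d ->
    Cmod (f w - f z - (w - z) * l)%C <= eps * Cmod (w - z)%C.
Proof.
  intros [_ H] eps Heps.
  destruct (H z (fun P HP => HP) (mkposreal eps Heps)) as [d Hd].
  exists d; split; [apply cond_pos|]. intros w Hw. exact (Hd w Hw).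
Qed.

(** A chain rule across scalar fields: f is differentiable over C, p over R. The increment form of
    [curve_derive] makes the two compatible. *)
Lemma curve_derive_comp (f : C -> C) (p : R -> C) (t : R) (l q : C) :
  is_derive (K := C_AbsRing) (V := C_NormedModule) f (p t) l ->
  curve_derive p t q -> curve_derive (fun s => f (p s)) t (l * q)%C.
Proof.
  intros Hf Hp eps Heps.
  assert (Hl := Cmod_ge_0 l). assert (Hq := Cmod_ge_0 q).
  set (e1 := eps / (2 * (Cmod q + 1))).
  assert (He1 : 0 < e1) by (apply Rdiv_lt_0_compat; lra).
  set (e2 := Rmin 1 (eps / (2 * (Cmod l + 1)))).
  assert (He2 : 0 < e2) by (apply Rmin_glb_lt; [lra|apply Rdiv_lt_0_compat; lra]).
  destruct (complex_derive_increment f _ _ Hf e1 He1) as [d1 [Hd1 H1]].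
  destruct (Hp e2 He2) as [d2 [Hd2 H2]].
  exists (Rmin d2 (d1 / (Cmod q + 1))).
  split; [apply Rmin_glb_lt; [lra|apply Rdiv_lt_0_compat; lra]|]. intros h Hh.
  assert (Hh2 := Rlt_le_trans _ _ _ Hh (Rmin_l _ _)). assert (Hh1 := Rlt_le_trans _ _ _ Hh (Rmin_r _ _)).
  specialize (H2 h Hh2).
  assert (Hh0 := Rabs_pos h).
  assert (Hinc : Cmod (p (t + h)%R - p t)%C <= (Cmod q + 1) * Rabs h).
  { replace (p (t + h)%R - p t)%C with ((p (t + h)%R - p t - RtoC h * q) + RtoC h * q)%C by ring.
    eapply Rle_trans; [apply Cmod_triangle|]. rewrite Cmod_mult, Cmod_R.
    assert (e2 * Rabs h <= 1 * Rabs h) by (apply Rmult_le_compat_r; [lra|apply Rmin_l]). lra. }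
  assert (Hd1' : Cmod (p (t + h)%R - p t)%C < d1).
  { eapply Rle_lt_trans; [exact Hinc|].
    apply Rlt_le_trans with ((Cmod q + 1) * (d1 / (Cmod q + 1))); [apply Rmult_lt_compat_l; lra|].
    right; field; lra. }
  specialize (H1 _ Hd1').
  replace (f (p (t + h)%R) - f (p t) - RtoC h * (l * q))%C
    with ((f (p (t + h)%R) - f (p t) - (p (t + h)%R - p t) * l) + l * (p (t + h)%R - p t - RtoC h * q))%C by ring.
  eapply Rle_trans; [apply Cmod_triangle|]. rewrite Cmod_mult.
  assert (A : e1 * Cmod (p (t + h)%R - p t)%C <= eps / 2 * Rabs h).
  { apply Rle_trans with (e1 * ((Cmod q + 1) * Rabs h)); [apply Rmult_le_compat_l; lra|].
    unfold e1. right. field. lra. }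
  assert (B : Cmod l * Cmod (p (t + h)%R - p t - RtoC h * q)%C <= eps / 2 * Rabs h).
  { apply Rle_trans with ((Cmod l + 1) * (eps / (2 * (Cmod l + 1)) * Rabs h)).
    - apply Rmult_le_compat; try lra; [apply Cmod_ge_0|].
      apply Rle_trans with (1 := H2). apply Rmult_le_compat_r; [lra|apply Rmin_r].
    - right. field. lra. }
  lra.
Qed.

Definition circle_point (z : C) (r a : R) : C := (Re z + r * cos a, Im z + r * sin a).

Lemma Cmod_circle_point z r a : Cmod (circle_point z r a - z)%C = Rabs r.
Proof.
  replace (circle_point z r a - z)%C with (r * cos a, r * sin a).
  2:{ unfold circle_point. destruct z as [x y]. apply injective_projections; simpl; ring. }
  unfold Cmod; simpl. rewrite <- sqrt_Rsqr_abs. f_equal. unfold Rsqr.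
  assert (H := sin2_cos2 a). unfold Rsqr in H.
  replace (r * cos a * (r * cos a * 1) + r * sin a * (r * sin a * 1))
    with (r * r * (sin a * sin a + cos a * cos a)) by ring.
  rewrite H. ring.
Qed.

Section Circle.

Variables (f df : C -> C) (z : C) (R0 : R).
Hypothesis Hf : forall w, Cmod (w - z)%C < R0 ->
  is_derive (K := C_AbsRing) (V := C_NormedModule) f w (df w).
Hypothesis Hdf : forall w, Cmod (w - z)%C < R0 -> forall eps, 0 < eps ->
  exists d, 0 < d /\ forall w', Cmod (w' - w)%C < d -> Cmod (df w' - df w)%C < eps.

(** Im (e^{ia} f'), taken at the point of the circle with radius r and angle a. *)
Let D r a := Re (df (circle_point z r a)) * sin a + Im (df (circle_point z r a)) * cos a.

Lemma circle_radial_derive r a :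
  Rabs r < R0 -> is_derive (fun s => Im (f (circle_point z s a))) r (D r a).
Proof.
  intros Hr. assert (Hd := Hf (circle_point z r a)). rewrite Cmod_circle_point in Hd.
  specialize (Hd Hr).
  assert (Hp : curve_derive (fun s => circle_point z s a) r (cos a, sin a)).
  { apply curve_derive_pair; auto_derive; trivial; ring. }
  destruct (curve_derive_components _ _ _ (curve_derive_comp f _ r _ _ Hd Hp)) as [_ H].
  replace (D r a) with (Im (df (circle_point z r a) * (cos a, sin a))%C); [exact H|].
  unfold D, Re, Im; simpl; ring.
Qed.

Lemma circle_angular_derive r a :
  Rabs r < R0 -> is_derive (fun s => Re (f (circle_point z r s))) a (- r * D r a).
Proof.
  intros Hr. assert (Hd := Hf (circle_point z r a)). rewrite Cmod_circle_point in Hd.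
  specialize (Hd Hr).
  assert (Hp : curve_derive (fun s => circle_point z r s) a (- r * sin a, r * cos a)).
  { apply curve_derive_pair; auto_derive; trivial; ring. }
  destruct (curve_derive_components _ _ _ (curve_derive_comp f _ a _ _ Hd Hp)) as [H _].
  replace (- r * D r a) with (Re (df (circle_point z r a) * ((- r * sin a)%R, (r * cos a)%R))%C); [exact H|].
  unfold D, Re, Im; simpl; ring.
Qed.

Lemma circle_angular_derive_im r a :
  Rabs r < R0 -> exists l, is_derive (fun s => Im (f (circle_point z r s))) a l.
Proof.
  intros Hr. assert (Hd := Hf (circle_point z r a)). rewrite Cmod_circle_point in Hd.
  specialize (Hd Hr).
  assert (Hp : curve_derive (fun s => circle_point z r s) a (- r * sin a, r * cos a)).
  { apply curve_derive_pair; auto_derive; trivial; ring. }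
  destruct (curve_derive_components _ _ _ (curve_derive_comp f _ a _ _ Hd Hp)) as [_ H].
  eexists; exact H.
Qed.

Lemma circle_continuity_2d (g : C -> R) r a :
  (forall eps, 0 < eps -> exists d, 0 < d /\ forall w,
     Cmod (w - circle_point z r a)%C < d -> Rabs (g w - g (circle_point z r a)) < eps) ->
  continuity_2d_pt (fun u v => g (circle_point z u v)) r a.
Proof.
  intros Hg eps. destruct (Hg eps (cond_pos eps)) as [d [Hd Hdd]].
  assert (Hc : forall t : R -> R, (forall x, continuity_pt t x) ->
    continuity_2d_pt (fun u v => u * t v) r a).
  { intros t Ht. apply continuity_2d_pt_mult; [apply continuity_2d_pt_id1|].
    apply (continuity_1d_2d_pt_comp t (fun _ v => v)); [apply Ht|apply continuity_2d_pt_id2]. }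
  destruct (Hc cos (fun x => continuity_cos x) (mkposreal (d / 2) ltac:(lra))) as [d1 H1].
  destruct (Hc sin (fun x => continuity_sin x) (mkposreal (d / 2) ltac:(lra))) as [d2 H2].
  assert (Hm : 0 < Rmin d1 d2) by (apply Rmin_glb_lt; apply cond_pos).
  exists (mkposreal _ Hm). simpl. intros u v Hu Hv. apply Hdd.
  specialize (H1 u v (Rlt_le_trans _ _ _ Hu (Rmin_l _ _)) (Rlt_le_trans _ _ _ Hv (Rmin_l _ _))).
  specialize (H2 u v (Rlt_le_trans _ _ _ Hu (Rmin_r _ _)) (Rlt_le_trans _ _ _ Hv (Rmin_r _ _))).
  simpl in H1, H2. eapply Rle_lt_trans; [apply Cmod_le_components|].
  replace (Re _) with (u * cos v - r * cos a) by (unfold Re; simpl; ring).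
  replace (Im _) with (u * sin v - r * sin a) by (unfold Im; simpl; ring).
  lra.
Qed.

Lemma circle_D_continuity_2d r a : Rabs r < R0 -> continuity_2d_pt D r a.
Proof.
  intros Hr. assert (Hd := Hdf (circle_point z r a)). rewrite Cmod_circle_point in Hd.
  specialize (Hd Hr). unfold D.
  apply continuity_2d_pt_plus; apply continuity_2d_pt_mult.
  - apply (circle_continuity_2d (fun w => Re (df w))). intros eps Heps.
    destruct (Hd eps Heps) as [d [Hd0 Hdd]]. exists d; split; [exact Hd0|]. intros w Hw.
    eapply Rle_lt_trans; [|apply (Hdd w Hw)]. apply Rle_trans with (2 := re_le_Cmod _). right; reflexivity.
  - apply (continuity_1d_2d_pt_comp sin (fun _ v => v)); [apply continuity_sin|apply continuity_2d_pt_id2].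
  - apply (circle_continuity_2d (fun w => Im (df w))). intros eps Heps.
    destruct (Hd eps Heps) as [d [Hd0 Hdd]]. exists d; split; [exact Hd0|]. intros w Hw.
    eapply Rle_lt_trans; [|apply (Hdd w Hw)]. apply Rle_trans with (2 := im_le_Cmod _). right; reflexivity.
  - apply (continuity_1d_2d_pt_comp cos (fun _ v => v)); [apply continuity_cos|apply continuity_2d_pt_id2].
Qed.

Lemma circle_ex_RInt r a b : Rabs r < R0 -> ex_RInt (fun t => Im (f (circle_point z r t))) a b.
Proof.
  intros Hr. apply (ex_RInt_continuous (V := R_CompleteNormedModule)). intros t _.
  destruct (circle_angular_derive_im r t Hr) as [l Hl].
  apply (ex_derive_continuous (K := R_AbsRing) (V := R_NormedModule)). now exists l.
Qed.

(* By the Cauchy-Riemann equations the radial derivative of Im f is, up to the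
   factor - 1 / r, the angular derivative of Re f, which integrates to 0. *)
Lemma circle_mean_value r :
  0 <= r < R0 -> RInt (fun t => Im (f (circle_point z r t))) 0 (2 * PI) = 2 * PI * Im (f z).
Proof.
  intros [[Hr0|Hr0] HrR].
  2:{ subst r. rewrite (RInt_ext _ (fun _ => Im (f z))).
      - rewrite RInt_const. unfold scal; simpl; unfold mult; simpl. ring.
      - intros t _. f_equal. f_equal. unfold circle_point. destruct z as [x y].
        apply injective_projections; simpl; ring. }
  assert (HPI := PI_RGT_0).
  assert (Hnear : forall s, Rabs s < R0 -> locally s (fun u => Rabs u < R0)).
  { intros s Hs. assert (Hp : 0 < R0 - Rabs s) by lra. exists (mkposreal _ Hp).
    intros u Hu. unfold ball in Hu; simpl in Hu; unfold AbsRing_ball, abs, minus, plus, opp in Hu; simpl in Hu.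
    replace u with (s + (u + - s)) by ring.
    eapply Rle_lt_trans; [apply Rabs_triang|]. lra. }
  set (F := fun s => RInt (fun t => Im (f (circle_point z s t))) 0 (2 * PI)).
  assert (HF : forall s, Rabs s < R0 -> is_derive F s (RInt (fun t => D s t) 0 (2 * PI))).
  { intros s Hs.
    rewrite (RInt_ext _ (fun t => Derive (fun u => Im (f (circle_point z u t))) s)).
    2:{ intros t _. symmetry. apply is_derive_unique. now apply circle_radial_derive. }
    apply (is_derive_RInt_param (fun s t => Im (f (circle_point z s t)))).
    - apply filter_imp with (2 := Hnear s Hs). intros u Hu t _. eexists. now apply circle_radial_derive.
    - intros t _. apply continuity_2d_pt_ext_loc with D; [|now apply circle_D_continuity_2d].
      destruct (Hnear s Hs) as [d Hd]. exists d. intros u v Hu _. symmetry.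
      apply is_derive_unique. apply circle_radial_derive. apply Hd. exact Hu.
    - apply filter_imp with (2 := Hnear s Hs). intros u Hu. now apply circle_ex_RInt. }
  assert (HD0 : forall s, 0 < s < R0 -> RInt (fun t => D s t) 0 (2 * PI) = 0).
  { intros s Hs. assert (Hsa : Rabs s < R0) by (rewrite Rabs_pos_eq; lra).
    assert (H : is_RInt (fun t => D s t) 0 (2 * PI)
      (minus (- / s * Re (f (circle_point z s (2 * PI)))) (- / s * Re (f (circle_point z s 0))))).
    { apply (is_RInt_derive (V := R_CompleteNormedModule) (fun t => - / s * Re (f (circle_point z s t)))).
      - intros t _. replace (D s t) with (- / s * (- s * D s t)) by (field; lra).
        apply (is_derive_scal (fun t => Re (f (circle_point z s t)))). now apply circle_angular_derive.
      - intros t _. intros P [e He].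
        destruct (circle_D_continuity_2d s t Hsa e) as [d Hd].
        exists d. intros t' Ht'. apply He. apply Hd; [rewrite Rminus_diag, Rabs_R0; apply cond_pos|].
        exact Ht'. }
    rewrite (is_RInt_unique _ _ _ _ H).
    replace (circle_point z s (2 * PI)) with (circle_point z s 0).
    - unfold minus, plus, opp; simpl. ring.
    - unfold circle_point. rewrite cos_2PI, sin_2PI, cos_0, sin_0. reflexivity. }
  (* The intermediate point is interior, so the vanishing of the integral, which divides by s, is
     used for s > 0 only. *)
  destruct (MVT_cor2 F (fun s => RInt (fun t => D s t) 0 (2 * PI)) 0 r Hr0) as [c [Hc1 Hc2]].
  { intros s Hs. apply is_derive_Reals. apply HF. rewrite Rabs_pos_eq; lra. }
  rewrite HD0, Rmult_0_l in Hc1 by lra.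
  fold (F r). replace (F r) with (F 0) by lra. unfold F.
  rewrite (RInt_ext _ (fun _ => Im (f z))).
  - rewrite RInt_const. unfold scal; simpl; unfold mult; simpl. ring.
  - intros t _. f_equal. f_equal. unfold circle_point. destruct z as [x y].
    apply injective_projections; simpl; ring.
Qed.

(** A Harnack-type bound: Im f is nonnegative on the circle, so dropping the rest of the circle only
    lowers the mean. *)
Lemma circle_arc_lower_bound r a b k :
  0 <= r < R0 -> 0 <= a -> a <= b -> b <= 2 * PI ->
  (forall t, 0 <= Im (f (circle_point z r t))) ->
  (forall t, a <= t <= b -> k <= Im (f (circle_point z r t))) ->
  (b - a) * k <= 2 * PI * Im (f z).
Proof.
  intros Hr Ha Hab Hb Hpos Hk.
  assert (Hra : Rabs r < R0) by (rewrite Rabs_pos_eq; lra).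
  rewrite <- (circle_mean_value r Hr).
  assert (Hex := fun c d => circle_ex_RInt r c d Hra).
  rewrite <- (RInt_Chasles (V := R_CompleteNormedModule) _ 0 a (2 * PI)) by apply Hex.
  rewrite <- (RInt_Chasles (V := R_CompleteNormedModule) _ a b (2 * PI)) by apply Hex.
  unfold plus; simpl.
  assert (A := RInt_ge_0 (fun t => Im (f (circle_point z r t))) 0 a Ha (Hex 0 a) (fun t _ => Hpos t)).
  assert (B := RInt_ge_0 (fun t => Im (f (circle_point z r t))) b (2 * PI) Hb (Hex _ _) (fun t _ => Hpos t)).
  assert (M : RInt (fun _ => k) a b <= RInt (fun t => Im (f (circle_point z r t))) a b).
  { apply RInt_le; [assumption| |apply Hex|].
    - apply ex_RInt_const.
    - intros t Ht. apply Hk. lra. }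
  rewrite RInt_const in M. unfold scal in M; simpl in M; unfold mult in M; simpl in M. lra.
Qed.

End Circle.

(** * Continuity of the derivative of the hull map *)

Lemma gronwall (f df : R -> R) (t K M : R) :
  0 <= t -> 0 <= K -> 0 <= M ->
  (forall s, 0 <= s <= t -> is_derive f s (df s)) ->
  (forall s, 0 <= s <= t -> df s <= K * f s + M) ->
  f t <= (f 0 + M * t) * exp (K * t).
Proof.
  intros Ht HK HM Hf Hle.
  assert (H : f t * exp (- K * t) - f 0 * exp (- K * 0) <= M * t - M * 0).
  { apply (le_of_derive_le (fun s => f s * exp (- K * s)) (fun s => M * s)
      (fun s => (df s - K * f s) * exp (- K * s)) (fun _ => M)); [assumption|..].
    - intros s Hs. specialize (Hf s Hs). auto_derive; [eexists; eauto|].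
      rewrite (is_derive_unique (fun x : R => f x) _ _ Hf). ring.
    - intros s Hs. auto_derive; [easy|ring].
    - intros s Hs. specialize (Hle s Hs).
      assert (He : exp (- K * s) <= 1).
      { rewrite <- exp_0. destruct (Req_dec (- K * s) 0) as [->|Hne]; [lra|].
        left. apply exp_increasing. assert (0 <= K * s) by (apply Rmult_le_pos; lra). lra. }
      assert (He0 := exp_pos (- K * s)).
      apply Rle_trans with (M * exp (- K * s)); [apply Rmult_le_compat_r; lra|].
      rewrite <- (Rmult_1_r M) at 2. apply Rmult_le_compat_l; lra. }
  rewrite Rmult_0_r, exp_0 in H.
  assert (E : exp (- K * t) * exp (K * t) = 1).
  { rewrite <- exp_plus. replace (- K * t + K * t) with 0 by ring. apply exp_0. }
  apply Rle_trans with (f t * exp (- K * t) * exp (K * t)).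
  - rewrite Rmult_assoc, E. lra.
  - apply Rmult_le_compat_r; [left; apply exp_pos|]. lra.
Qed.

(* The coefficient in (h1 - h2)' = - 2 (h1 - h2) / ((h1 - lam) (h2 - lam)). *)
Definition difference_rate (lam X1 V1 X2 V2 : R -> R) (s : R) : C :=
  (/ ((X1 s - lam s, V1 s)%R * (X2 s - lam s, V2 s)%R))%C.

Lemma Cmod_ge_height (a v m : R) : m <= v -> m <= Cmod (a, v).
Proof.
  intros H. apply Rle_trans with (2 := im_le_Cmod (a, v)). unfold Im; simpl.
  apply Rle_trans with (1 := H). apply Rle_abs.
Qed.

Lemma Cneq0_of_Cmod_ge (z : C) (m : R) : 0 < m -> m <= Cmod z -> z <> RtoC 0.
Proof. intros Hm H ->. rewrite Cmod_0 in H. lra. Qed.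

Lemma trajectory_difference_derive lam t X1 V1 X2 V2 s :
  upper_trajectory lam t X1 V1 -> upper_trajectory lam t X2 V2 -> 0 <= s <= t ->
  let c := difference_rate lam X1 V1 X2 V2 s in
  is_derive (fun s => X1 s - X2 s) s
    (- 2 * (Re c * (X1 s - X2 s) - Im c * (V1 s - V2 s))) /\
  is_derive (fun s => V1 s - V2 s) s
    (- 2 * (Re c * (V1 s - V2 s) + Im c * (X1 s - X2 s))).
Proof.
  intros H1 H2 Hs c.
  destruct (H1 s Hs) as [HV1 [DX1 DV1]], (H2 s Hs) as [HV2 [DX2 DV2]].
  set (a := X1 s - lam s) in *. set (b := X2 s - lam s) in *.
  assert (HN1 := sum_sq_pos a _ HV1). assert (HN2 := sum_sq_pos b _ HV2).
  set (v := V1 s) in *. set (w := V2 s) in *.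
  assert (HNN : (a * b - v * w) ^ 2 + (a * w + v * b) ^ 2 <> 0).
  { replace ((a * b - v * w) ^ 2 + (a * w + v * b) ^ 2) with ((a ^ 2 + v ^ 2) * (b ^ 2 + w ^ 2)) by ring.
    apply Rgt_not_eq, Rmult_lt_0_compat; assumption. }
  assert (Ec : Re c = (a * b - v * w) / ((a ^ 2 + v ^ 2) * (b ^ 2 + w ^ 2)) /\
    Im c = - (a * w + v * b) / ((a ^ 2 + v ^ 2) * (b ^ 2 + w ^ 2))).
  { unfold c, difference_rate. fold a b v w. unfold Cinv, Cmult, Re, Im; simpl.
    split; field; repeat split; try lra; intros E; apply HNN; rewrite <- E; ring. }
  destruct Ec as [-> ->].
  assert (Ex : X1 s - X2 s = a - b) by (unfold a, b; ring).
  rewrite Ex. split.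
  - replace (-2 * _) with (2 * a / (a ^ 2 + v ^ 2) - 2 * b / (b ^ 2 + w ^ 2)).
    + apply (is_derive_minus (K := R_AbsRing) (V := R_NormedModule)); assumption.
    + field. lra.
  - replace (-2 * _) with (- (2 * v) / (a ^ 2 + v ^ 2) - - (2 * w) / (b ^ 2 + w ^ 2)).
    + apply (is_derive_minus (K := R_AbsRing) (V := R_NormedModule)); assumption.
    + field. lra.
Qed.

Lemma Cmod_difference_rate_le lam X1 V1 X2 V2 s m :
  0 < m -> m <= V1 s -> m <= V2 s ->
  Cmod (difference_rate lam X1 V1 X2 V2 s) <= / m ^ 2.
Proof.
  intros Hm H1 H2. unfold difference_rate.
  assert (A := Cmod_ge_height (X1 s - lam s) _ _ H1).
  assert (B := Cmod_ge_height (X2 s - lam s) _ _ H2).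
  rewrite Cmod_inv, Cmod_mult.
  - apply Rinv_le_contravar; [apply pow_lt; lra|].
    replace (m ^ 2) with (m * m) by ring. apply Rmult_le_compat; lra.
  - apply Cmult_neq_0; eapply Cneq0_of_Cmod_ge; try exact Hm; assumption.
Qed.

Lemma Cmod_difference_rate_sub lam X1 V1 X2 V2 Y1 W1 Y2 W2 s m e :
  0 < m -> m <= V1 s -> m <= V2 s -> m <= W1 s -> m <= W2 s ->
  Cmod (X1 s - Y1 s, V1 s - W1 s) <= e -> Cmod (X2 s - Y2 s, V2 s - W2 s) <= e ->
  Cmod (difference_rate lam X1 V1 X2 V2 s - difference_rate lam Y1 W1 Y2 W2 s)%C
    <= 2 * e / m ^ 3.
Proof.
  intros Hm H1 H2 K1 K2 E1 E2. unfold difference_rate.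
  assert (A := Cmod_ge_height (X1 s - lam s) _ _ H1).
  assert (B := Cmod_ge_height (X2 s - lam s) _ _ H2).
  assert (A' := Cmod_ge_height (Y1 s - lam s) _ _ K1).
  assert (B' := Cmod_ge_height (Y2 s - lam s) _ _ K2).
  replace ((X1 s - Y1 s)%R, (V1 s - W1 s)%R) with ((X1 s - lam s, V1 s)%R - (Y1 s - lam s, W1 s)%R)%C in E1
    by (apply injective_projections; simpl; ring).
  replace ((X2 s - Y2 s)%R, (V2 s - W2 s)%R) with ((X2 s - lam s, V2 s)%R - (Y2 s - lam s, W2 s)%R)%C in E2
    by (apply injective_projections; simpl; ring).
  set (a := (X1 s - lam s, V1 s)%R : C) in *. set (b := (X2 s - lam s, V2 s)%R : C) in *.
  set (a' := (Y1 s - lam s, W1 s)%R : C) in *. set (b' := (Y2 s - lam s, W2 s)%R : C) in *.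
  assert (Na := Cneq0_of_Cmod_ge _ _ Hm A). assert (Nb := Cneq0_of_Cmod_ge _ _ Hm B).
  assert (Na' := Cneq0_of_Cmod_ge _ _ Hm A'). assert (Nb' := Cneq0_of_Cmod_ge _ _ Hm B').
  (* Exchanges a for a' first and b for b' second, so that each term carries one small factor and
     three reciprocals. *)
  replace (/ (a * b) - / (a' * b'))%C
    with (- ((a - a') * (/ a * / a' * / b)) - (b - b') * (/ b * / b' * / a'))%C
    by (field; repeat split; assumption).
  assert (He : 0 <= e) by (apply Rle_trans with (2 := E1); apply Cmod_ge_0).
  assert (Hi : forall x : C, m <= Cmod x -> 0 <= Cmod (/ x)%C <= / m).
  { intros x Hx. split; [apply Cmod_ge_0|]. rewrite Cmod_inv by (now apply Cneq0_of_Cmod_ge with m).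
    apply Rinv_le_contravar; lra. }
  assert (H3 : forall d x y z : C, Cmod d <= e -> m <= Cmod x -> m <= Cmod y -> m <= Cmod z ->
    Cmod (d * (/ x * / y * / z))%C <= e / m ^ 3).
  { intros d x y z Hd Hx Hy Hz. rewrite !Cmod_mult.
    destruct (Hi x Hx), (Hi y Hy), (Hi z Hz).
    replace (e / m ^ 3) with (e * (/ m * / m * / m)) by (field; lra).
    apply Rmult_le_compat; [apply Cmod_ge_0| |assumption|].
    - repeat apply Rmult_le_pos; assumption.
    - apply Rmult_le_compat; try assumption; [apply Rmult_le_pos; assumption|].
      apply Rmult_le_compat; assumption. }
  unfold Cminus at 1. eapply Rle_trans; [apply Cmod_triangle|]. rewrite !Cmod_opp.
  assert (G1 := H3 _ _ _ _ E1 A A' B). assert (G2 := H3 _ _ _ _ E2 B B' A').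
  replace (2 * e / m ^ 3) with (e / m ^ 3 + e / m ^ 3) by (field; lra). lra.
Qed.

(** The real inner product of x + i y with c z, that is Re (conj (x + i y) c z). It appears in the
    derivative of a squared modulus under a linear complex equation. *)
Lemma Re_Im_bilinear_le (c z : C) (x y : R) :
  Rabs (x * (Re c * Re z - Im c * Im z) + y * (Re c * Im z + Im c * Re z)) <= Cmod (x, y) * (Cmod c * Cmod z).
Proof.
  rewrite <- Cmod_mult, <- Cmod_conj with (c := (x, y)), <- Cmod_mult.
  apply Rle_trans with (2 := re_le_Cmod _). right. f_equal.
  unfold Re, Im; simpl. ring.
Qed.

(** Gronwall for the squared modulus, which stays differentiable at 0, with rate 4 / m^2; the square
    root halves the exponent. *)
Lemma trajectory_difference_bound lam t X1 V1 X2 V2 m s :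
  upper_trajectory lam t X1 V1 -> upper_trajectory lam t X2 V2 -> 0 < m ->
  (forall s, 0 <= s <= t -> m <= V1 s /\ m <= V2 s) -> 0 <= s <= t ->
  Cmod (X1 s - X2 s, V1 s - V2 s) <= Cmod (X1 0 - X2 0, V1 0 - V2 0) * exp (2 / m ^ 2 * t).
Proof.
  intros H1 H2 Hm Hmv Hs.
  assert (Hm2 : 0 < / m ^ 2) by (apply Rinv_0_lt_compat, pow_lt; assumption).
  set (f := fun s => (X1 s - X2 s) ^ 2 + (V1 s - V2 s) ^ 2).
  assert (Hf2 : forall s, f s = Cmod (X1 s - X2 s, V1 s - V2 s) ^ 2).
  { intros w. rewrite Cmod2_alt. reflexivity. }
  assert (G : f s <= (f 0 + 0 * s) * exp (4 / m ^ 2 * s)).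
  { set (c := difference_rate lam X1 V1 X2 V2).
    apply (gronwall f (fun s => 2 * ((X1 s - X2 s) * (- 2 * (Re (c s) * (X1 s - X2 s) - Im (c s) * (V1 s - V2 s)))
      + (V1 s - V2 s) * (- 2 * (Re (c s) * (V1 s - V2 s) + Im (c s) * (X1 s - X2 s)))))); try lra.
    - intros w Hw.
      destruct (trajectory_difference_derive lam t X1 V1 X2 V2 w H1 H2 ltac:(lra)) as [D1 D2].
      fold c in D1, D2. unfold f.
      set (A := fun s => X1 s - X2 s) in *. set (B := fun s => V1 s - V2 s) in *.
      apply (is_derive_ext (fun s => A s ^ 2 + B s ^ 2)); [reflexivity|].
      auto_derive; [repeat split; eexists; eauto|].
      rewrite (is_derive_unique (fun x : R => A x) _ _ D1), (is_derive_unique (fun x : R => B x) _ _ D2).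
      unfold A, B. ring.
    - intros w Hw. destruct (Hmv w ltac:(lra)) as [M1 M2].
      assert (Bc := Cmod_difference_rate_le lam X1 V1 X2 V2 w m Hm M1 M2). fold c in Bc. fold (c w) in Bc.
      set (d := (X1 w - X2 w, V1 w - V2 w) : C).
      assert (Bl := Re_Im_bilinear_le (c w) d (X1 w - X2 w) (V1 w - V2 w)).
      change (Re d) with (X1 w - X2 w) in Bl. change (Im d) with (V1 w - V2 w) in Bl.
      fold d in Bl. rewrite Hf2. fold d. rewrite Rplus_0_r.
      apply Rabs_le_between in Bl.
      assert (Cmod d * (Cmod (c w) * Cmod d) <= / m ^ 2 * Cmod d ^ 2).
      { replace (Cmod d * (Cmod (c w) * Cmod d)) with (Cmod (c w) * Cmod d ^ 2) by ring.
        apply Rmult_le_compat_r; [apply pow2_ge_0|exact Bc]. }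
      unfold Rdiv. lra. }
  rewrite Rmult_0_l, Rplus_0_r, !Hf2 in G.
  set (u := Cmod (X1 s - X2 s, V1 s - V2 s)) in *.
  set (u0 := Cmod (X1 0 - X2 0, V1 0 - V2 0)) in *.
  assert (Hu : 0 <= u) by apply Cmod_ge_0. assert (Hu0 : 0 <= u0) by apply Cmod_ge_0.
  apply Rsqr_incr_0_var; [|apply Rmult_le_pos; [assumption|left; apply exp_pos]].
  rewrite !Rsqr_pow2. apply Rle_trans with (1 := G).
  rewrite Rpow_mult_distr. apply Rmult_le_compat_l; [apply pow2_ge_0|].
  replace (exp (2 / m ^ 2 * t) ^ 2) with (exp (4 / m ^ 2 * t)).
  - destruct (Req_dec s t) as [->|]; [lra|]. left. apply exp_increasing.
    apply Rmult_lt_compat_l; [unfold Rdiv|]; lra.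
  - rewrite <- (Rsqr_pow2 (exp _)). unfold Rsqr. rewrite <- exp_plus. f_equal. field. lra.
Qed.

(** Compares difference quotients of h(., t) with the same real step [z] at two base points [e]
    apart. Their difference A + i B starts at 0, both quotients being 1 at time 0, and solves a
    linear equation with rate [c1] forced by (c1 - c2) (p + i q). The bound is free of [z], so it
    passes to derivatives. *)
Lemma trajectory_quotient_bound lam t X1 V1 X2 V2 Y1 W1 Y2 W2 m z e L :
  0 < t -> upper_trajectory lam t X1 V1 -> upper_trajectory lam t X2 V2 ->
  upper_trajectory lam t Y1 W1 -> upper_trajectory lam t Y2 W2 ->
  0 < m -> (forall s, 0 <= s <= t -> m <= V1 s /\ m <= V2 s /\ m <= W1 s /\ m <= W2 s) ->
  0 < z -> X1 0 - X2 0 = z -> V1 0 = V2 0 -> Y1 0 - Y2 0 = z -> W1 0 = W2 0 ->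
  L = exp (2 / m ^ 2 * t) ->
  Cmod (X1 0 - Y1 0, V1 0 - W1 0) = e -> Cmod (X2 0 - Y2 0, V2 0 - W2 0) = e ->
  Cmod (((X1 t - X2 t) - (Y1 t - Y2 t)) / z, ((V1 t - V2 t) - (W1 t - W2 t)) / z) ^ 2
    <= 2 * (2 * (e * L) / m ^ 3 * L) ^ 2 * t * exp ((4 / m ^ 2 + 2) * t).
Proof.
  intros Ht HX1 HX2 HY1 HY2 Hm Hmv Hz IX IV IY IW EL Ee1 Ee2.
  assert (Hm2 : 0 < / m ^ 2) by (apply Rinv_0_lt_compat, pow_lt; assumption).
  set (c1 := difference_rate lam X1 V1 X2 V2). set (c2 := difference_rate lam Y1 W1 Y2 W2).
  set (A := fun s => ((X1 s - X2 s) - (Y1 s - Y2 s)) / z).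
  set (B := fun s => ((V1 s - V2 s) - (W1 s - W2 s)) / z).
  set (p := fun s => (Y1 s - Y2 s) / z). set (q := fun s => (W1 s - W2 s) / z).
  set (dl := fun s => (c1 s - c2 s)%C).
  set (dA := fun s => - 2 * (Re (c1 s) * A s - Im (c1 s) * B s + (Re (dl s) * p s - Im (dl s) * q s))).
  set (dB := fun s => - 2 * (Re (c1 s) * B s + Im (c1 s) * A s + (Re (dl s) * q s + Im (dl s) * p s))).
  assert (HD : forall s, 0 <= s <= t -> is_derive A s (dA s) /\ is_derive B s (dB s)).
  { intros s Hs.
    destruct (trajectory_difference_derive lam t X1 V1 X2 V2 s HX1 HX2 Hs) as [D1 D2].
    destruct (trajectory_difference_derive lam t Y1 W1 Y2 W2 s HY1 HY2 Hs) as [D3 D4].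
    fold c1 in D1, D2. fold c2 in D3, D4. fold (c1 s) in D1, D2. fold (c2 s) in D3, D4.
    assert (Gen : forall (f g : R -> R) df dg, is_derive f s df -> is_derive g s dg ->
      is_derive (fun s => (f s - g s) / z) s ((df - dg) / z)).
    { intros f g df dg Hf Hg. auto_derive; [repeat split; eexists; eauto|].
      rewrite (is_derive_unique (fun x : R => f x) _ _ Hf), (is_derive_unique (fun x : R => g x) _ _ Hg).
      field. lra. }
    assert (G1 := Gen _ _ _ _ D1 D3). assert (G2 := Gen _ _ _ _ D2 D4).
    split.
    - replace (dA s) with ((- 2 * (Re (c1 s) * (X1 s - X2 s) - Im (c1 s) * (V1 s - V2 s)) -
        - 2 * (Re (c2 s) * (Y1 s - Y2 s) - Im (c2 s) * (W1 s - W2 s))) / z); [exact G1|].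
      unfold dA, dl, A, B, p, q. change (Re (c1 s - c2 s)%C) with (Re (c1 s) - Re (c2 s)).
      change (Im (c1 s - c2 s)%C) with (Im (c1 s) - Im (c2 s)). field. lra.
    - replace (dB s) with ((- 2 * (Re (c1 s) * (V1 s - V2 s) + Im (c1 s) * (X1 s - X2 s)) -
        - 2 * (Re (c2 s) * (W1 s - W2 s) + Im (c2 s) * (Y1 s - Y2 s))) / z); [exact G2|].
      unfold dB, dl, A, B, p, q. change (Re (c1 s - c2 s)%C) with (Re (c1 s) - Re (c2 s)).
      change (Im (c1 s - c2 s)%C) with (Im (c1 s) - Im (c2 s)). field. lra. }
  set (mu := 2 * (e * L) / m ^ 3).
  assert (HL : 0 < L) by (rewrite EL; apply exp_pos).
  assert (He : 0 <= e) by (rewrite <- Ee1; apply Cmod_ge_0).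
  assert (Hmu : 0 <= mu).
  { unfold mu. apply Rmult_le_pos; [|left; apply Rinv_0_lt_compat, pow_lt; assumption].
    apply Rmult_le_pos; [lra|apply Rmult_le_pos; lra]. }
  assert (Hdl : forall s, 0 <= s <= t -> Cmod (dl s) <= mu).
  { intros s Hs. destruct (Hmv s Hs) as [M1 [M2 [M3 M4]]].
    apply Cmod_difference_rate_sub; try assumption.
    - rewrite EL, <- Ee1. apply (trajectory_difference_bound lam); try assumption.
      intros w Hw. destruct (Hmv w Hw) as [? [? [? ?]]]. split; assumption.
    - rewrite EL, <- Ee2. apply (trajectory_difference_bound lam); try assumption.
      intros w Hw. destruct (Hmv w Hw) as [? [? [? ?]]]. split; assumption. }
  assert (Hpq : forall s, 0 <= s <= t -> Cmod (p s, q s) <= L).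
  { intros s Hs.
    assert (Hb := trajectory_difference_bound lam t Y1 W1 Y2 W2 m s HY1 HY2 Hm
      (fun w Hw => conj (proj1 (proj2 (proj2 (Hmv w Hw)))) (proj2 (proj2 (proj2 (Hmv w Hw))))) Hs).
    rewrite <- EL, IY, IW, Rminus_diag in Hb.
    change (z, 0) with (RtoC z) in Hb. rewrite Cmod_R, (Rabs_pos_eq z) in Hb by lra.
    replace (p s, q s) with (RtoC (/ z) * (Y1 s - Y2 s, W1 s - W2 s)%R)%C.
    - rewrite Cmod_mult, Cmod_R, Rabs_pos_eq by (left; apply Rinv_0_lt_compat; lra).
      apply Rle_trans with (/ z * (z * L)); [apply Rmult_le_compat_l; [left; apply Rinv_0_lt_compat; lra|assumption]|].
      right. field. lra.
    - unfold p, q. apply injective_projections; simpl; field; lra. }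
  set (f := fun s => A s ^ 2 + B s ^ 2).
  assert (Hf2 : forall s, f s = Cmod (A s, B s) ^ 2) by (intros w; rewrite Cmod2_alt; reflexivity).
  assert (HK : 0 <= 4 / m ^ 2 + 2) by (unfold Rdiv; lra).
  assert (HM : 0 <= 2 * (mu * L) ^ 2) by (apply Rmult_le_pos; [lra|apply pow2_ge_0]).
  assert (G : f t <= (f 0 + 2 * (mu * L) ^ 2 * t) * exp ((4 / m ^ 2 + 2) * t)).
  { apply (gronwall f (fun s => 2 * (A s * dA s + B s * dB s))); try lra.
    - intros s Hs. destruct (HD s Hs) as [D1 D2].
      unfold f. auto_derive; [repeat split; eexists; eauto|].
      rewrite (is_derive_unique (fun x : R => A x) _ _ D1), (is_derive_unique (fun x : R => B x) _ _ D2).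
      ring.
    - intros s Hs. destruct (Hmv s Hs) as [M1 [M2 [M3 M4]]].
      assert (Bc := Cmod_difference_rate_le lam X1 V1 X2 V2 s m Hm M1 M2). fold c1 in Bc. fold (c1 s) in Bc.
      assert (B1 := Re_Im_bilinear_le (c1 s) (A s, B s) (A s) (B s)).
      assert (B2 := Re_Im_bilinear_le (dl s) (p s, q s) (A s) (B s)).
      rewrite Hf2. set (d := Cmod (A s, B s)) in *.
      change (Re (A s, B s)) with (A s) in B1. change (Im (A s, B s)) with (B s) in B1.
      change (Re (p s, q s)) with (p s) in B2. change (Im (p s, q s)) with (q s) in B2.
      assert (Hd : 0 <= d) by apply Cmod_ge_0.
      assert (C1 : d * (Cmod (c1 s) * d) <= / m ^ 2 * d ^ 2).
      { replace (d * (Cmod (c1 s) * d)) with (Cmod (c1 s) * d ^ 2) by ring.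
        apply Rmult_le_compat_r; [apply pow2_ge_0|exact Bc]. }
      assert (C2 : d * (Cmod (dl s) * Cmod (p s, q s)) <= d * (mu * L)).
      { apply Rmult_le_compat_l; [assumption|].
        apply Rmult_le_compat; [apply Cmod_ge_0|apply Cmod_ge_0|now apply Hdl|now apply Hpq]. }
      (* The forcing term 4 d mu L is at most 2 d^2 + 2 (mu L)^2: hence the 2 in the exponent and in
         the prefactor. *)
      assert (C3 : 0 <= (d - mu * L) ^ 2) by apply pow2_ge_0.
      apply Rabs_le_between in B1. apply Rabs_le_between in B2.
      unfold dA, dB, Rdiv. lra. }
  replace (f 0) with 0 in G.
  - rewrite Rplus_0_l, Hf2 in G. exact G.
  - unfold f, A, B. rewrite IX, IY, IV, IW. field. lra.
Qed.

(** Difference quotients at nearby base points differ by at most a constant times the distance,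
    whatever the step; letting the step tend to 0 shows that the derivative is locally Lipschitz. *)
Lemma hull_map_derivative_continuous T lam h gamma t y0 :
  generates_slit_maps T lam h gamma -> 0 < t <= T -> 0 <= y0 ->
  (forall u, 0 < u <= t -> Im (gamma u) <= y0) ->
  exists df : C -> C, forall z, y0 < Im z ->
    is_derive (K := C_AbsRing) (V := C_NormedModule) (fun z => h z t) z (df z) /\
    forall eps, 0 < eps -> exists d, 0 < d /\
      forall w, Cmod (w - z)%C < d -> Cmod (df w - df z)%C < eps.
Proof.
  intros Hg Ht Hy0 Hgam.
  assert (Hdom : forall z, y0 < Im z -> slit_domain gamma t z).
  { intros z Hz. split; [unfold upper; lra|]. intros [u [Hu ->]]. specialize (Hgam u Hu). lra. }
  assert (Hex : forall z, exists l, y0 < Im z ->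
    is_derive (K := C_AbsRing) (V := C_NormedModule) (fun z => h z t) z l).
  { intros z. destruct (classic (y0 < Im z)) as [Hz|Hz].
    - destruct (proj1 (gsm_conformal _ _ _ _ Hg t ltac:(lra)) z (Hdom z Hz)) as [l Hl].
      exists l. intros _. exact Hl.
    - exists (RtoC 0). intros; contradiction. }
  set (df := fun z => proj1_sig (constructive_indefinite_description _ (Hex z))).
  assert (Hdf : forall z, y0 < Im z ->
    is_derive (K := C_AbsRing) (V := C_NormedModule) (fun z => h z t) z (df z)).
  { intros z. unfold df. apply proj2_sig. }
  exists df. intros z Hz. split; [now apply Hdf|]. intros eps Heps.
  destruct (slit_trajectory T lam h gamma t z Hg Ht (Hdom z Hz)) as [Xz [Vz [Htz [_ [_ Hzeq]]]]].
  assert (HVz : 0 < Im (h z t)).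
  { destruct (Hzeq t ltac:(lra)) as [_ <-]. apply Htz; lra. }
  (* Near z the final height is at least m by continuity of h(., t), and heights do not increase, so
     m bounds the whole trajectories from below. *)
  set (m := Im (h z t) / 2).
  assert (Hm : 0 < m) by (unfold m; lra).
  assert (Hloc : exists d, 0 < d /\ forall w, Cmod (w - z)%C < d -> y0 < Im w /\ m <= Im (h w t)).
  { destruct (complex_derive_increment _ _ _ (Hdf z Hz) 1 ltac:(lra)) as [d1 [Hd1 H1]].
    assert (Hl := Cmod_ge_0 (df z)).
    exists (Rmin (Im z - y0) (Rmin d1 (m / (Cmod (df z) + 1)))). split.
    { repeat apply Rmin_glb_lt; try lra. apply Rdiv_lt_0_compat; lra. }
    intros w Hw.
    assert (W1 := Rlt_le_trans _ _ _ Hw (Rmin_l _ _)).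
    assert (W2 := Rlt_le_trans _ _ _ Hw (Rle_trans _ _ _ (Rmin_r _ _) (Rmin_l _ _))).
    assert (W3 := Rlt_le_trans _ _ _ Hw (Rle_trans _ _ _ (Rmin_r _ _) (Rmin_r _ _))).
    split.
    - assert (I1 := im_le_Cmod (w - z)%C). change (Im (w - z)%C) with (Im w - Im z) in I1.
      apply Rabs_le_between in I1. lra.
    - specialize (H1 w W2).
      assert (I2 : Cmod (h w t - h z t)%C <= m).
      { replace (h w t - h z t)%C with ((h w t - h z t - (w - z) * df z) + (w - z) * df z)%C by ring.
        eapply Rle_trans; [apply Cmod_triangle|]. rewrite Cmod_mult.
        apply Rle_trans with ((Cmod (df z) + 1) * Cmod (w - z)%C); [lra|].
        apply Rle_trans with ((Cmod (df z) + 1) * (m / (Cmod (df z) + 1))).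
        - apply Rmult_le_compat_l; lra.
        - right. field. lra. }
      assert (I1 := im_le_Cmod (h w t - h z t)%C).
      change (Im (h w t - h z t)%C) with (Im (h w t) - Im (h z t)) in I1.
      apply Rabs_le_between in I1. unfold m in *. lra. }
  destruct Hloc as [d0 [Hd0 Hloc]].
  set (L := exp (2 / m ^ 2 * t)).
  (* The bound for the squared difference of quotients with e^2 taken out, so sqrt K is the
     Lipschitz constant. *)
  set (K := 2 * (2 * L / m ^ 3 * L) ^ 2 * t * exp ((4 / m ^ 2 + 2) * t)).
  assert (HK : 0 <= K).
  { unfold K. apply Rmult_le_pos; [|left; apply exp_pos].
    apply Rmult_le_pos; [|lra]. apply Rmult_le_pos; [lra|apply pow2_ge_0]. }
  assert (HsK := sqrt_pos K).
  exists (Rmin (d0 / 2) (eps / (sqrt K + 1))). split.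
  { apply Rmin_glb_lt; [lra|apply Rdiv_lt_0_compat; lra]. }
  intros w Hw.
  assert (W1 := Rlt_le_trans _ _ _ Hw (Rmin_l _ _)). assert (W2 := Rlt_le_trans _ _ _ Hw (Rmin_r _ _)).
  set (e := Cmod (w - z)%C) in *. assert (He : 0 <= e) by apply Cmod_ge_0.
  assert (Hew : e * (sqrt K + 1) < eps).
  { apply Rlt_le_trans with (eps / (sqrt K + 1) * (sqrt K + 1)); [apply Rmult_lt_compat_r; lra|].
    right; field; lra. }
  enough (Hmain : Cmod (df w - df z)%C <= e * sqrt K).
  { destruct (Req_dec e 0) as [E|E]; [rewrite E in *; lra|]. lra. }
  apply le_of_le_add_eps with (K := 2) (e0 := 1); [lra|]. intros sg Hsg.
  destruct (Hloc w ltac:(fold e; lra)) as [Hwy Hwm].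
  destruct (complex_derive_increment _ _ _ (Hdf z Hz) sg ltac:(lra)) as [d1 [Hd1 H1]].
  destruct (complex_derive_increment _ _ _ (Hdf w Hwy) sg ltac:(lra)) as [d2 [Hd2 H2]].
  set (x := Rmin (d0 / 4) (Rmin (d1 / 2) (d2 / 2))).
  assert (Hx : 0 < x) by (repeat apply Rmin_glb_lt; lra).
  assert (X1 : x <= d0 / 4) by apply Rmin_l.
  assert (X2 : x <= d1 / 2) by (eapply Rle_trans; [apply Rmin_r|apply Rmin_l]).
  assert (X3 : x <= d2 / 2) by (eapply Rle_trans; [apply Rmin_r|apply Rmin_r]).
  assert (Hshift : forall v, Cmod (v + RtoC x - v)%C = x).
  { intros v. replace (v + RtoC x - v)%C with (RtoC x) by ring. rewrite Cmod_R. apply Rabs_pos_eq; lra. }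
  assert (Hpt : forall v, Cmod (v - z)%C < d0 -> exists X V, upper_trajectory lam t X V /\
    (forall s, 0 <= s <= t -> m <= V s) /\ X 0 = Re v /\ V 0 = Im v /\ X t = Re (h v t) /\ V t = Im (h v t)).
  { intros v Hv. destruct (Hloc v Hv) as [Hvy Hvm].
    destruct (slit_trajectory T lam h gamma t v Hg Ht (Hdom v Hvy)) as [X [V [Htr [E1 [E2 E3]]]]].
    destruct (E3 t ltac:(lra)) as [E4 E5].
    exists X, V. repeat split; try assumption; try (apply Htr; assumption).
    intros s Hs. apply Rle_trans with (V t); [lra|].
    apply (trajectory_height_nonincreasing lam t X V s t Htr); lra. }
  destruct (Hpt z) as [Y2 [W2' [TY2 [MY2 [Y20 [W20 [Y2t W2t]]]]]]].
  { replace (z - z)%C with (RtoC 0) by ring. rewrite Cmod_0. lra. }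
  destruct (Hpt (z + RtoC x)%C) as [Y1 [W1' [TY1 [MY1 [Y10 [W10 [Y1t W1t]]]]]]].
  { rewrite Hshift. lra. }
  destruct (Hpt w) as [U2 [V2 [TU2 [MU2 [U20 [V20 [U2t V2t]]]]]]].
  { fold e. lra. }
  destruct (Hpt (w + RtoC x)%C) as [U1 [V1 [TU1 [MU1 [U10 [V10 [U1t V1t]]]]]]].
  { replace (w + RtoC x - z)%C with ((w - z) + RtoC x)%C by ring.
    eapply Rle_lt_trans; [apply Cmod_triangle|]. rewrite Cmod_R, (Rabs_pos_eq x) by lra. fold e. lra. }
  assert (RIx : forall v, Re (v + RtoC x)%C = Re v + x /\ Im (v + RtoC x)%C = Im v).
  { intros v. unfold Re, Im; simpl. split; ring. }
  destruct (RIx z) as [Rz Iz], (RIx w) as [Rw Iw].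
  assert (Hdist : Cmod (Re w - Re z, Im w - Im z) = e) by reflexivity.
  assert (HQ := trajectory_quotient_bound lam t U1 V1 U2 V2 Y1 W1' Y2 W2' m x e L ltac:(lra)
    TU1 TU2 TY1 TY2 Hm (fun s Hs => conj (MU1 s Hs) (conj (MU2 s Hs) (conj (MY1 s Hs) (MY2 s Hs)))) Hx
    ltac:(rewrite U10, U20, Rw; ring) ltac:(rewrite V10, V20, Iw; reflexivity)
    ltac:(rewrite Y10, Y20, Rz; ring) ltac:(rewrite W10, W20, Iz; reflexivity) eq_refl
    ltac:(rewrite U10, Y10, V10, W10, Rw, Rz, Iw, Iz; rewrite <- Hdist; f_equal; f_equal; ring)
    ltac:(rewrite U20, Y20, V20, W20; exact Hdist)).
  replace (2 * (2 * (e * L) / m ^ 3 * L) ^ 2 * t * exp ((4 / m ^ 2 + 2) * t)) with (e ^ 2 * K) in HQ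
    by (unfold K; field; lra).
  set (Q := (((U1 t - U2 t) - (Y1 t - Y2 t)) / x, ((V1 t - V2 t) - (W1' t - W2' t)) / x) : C) in *.
  assert (HQ' : Cmod Q <= e * sqrt K).
  { apply Rsqr_incr_0_var; [|apply Rmult_le_pos; assumption].
    rewrite !Rsqr_pow2, Rpow_mult_distr, pow2_sqrt; assumption. }
  assert (EQ : (RtoC x * Q = (h (w + RtoC x) t - h w t) - (h (z + RtoC x) t - h z t))%C).
  { unfold Q. rewrite U1t, U2t, Y1t, Y2t, V1t, V2t, W1t, W2t.
    apply injective_projections; unfold Re, Im; simpl; field; lra. }
  specialize (H1 (z + RtoC x)%C). specialize (H2 (w + RtoC x)%C). rewrite Hshift in H1, H2.
  specialize (H1 ltac:(lra)). specialize (H2 ltac:(lra)).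
  apply (Rmult_le_reg_l x); [assumption|].
  replace (x * Cmod (df w - df z)%C) with (Cmod (RtoC x * (df w - df z))%C)
    by (rewrite Cmod_mult, Cmod_R, Rabs_pos_eq; lra).
  replace (RtoC x * (df w - df z))%C with (RtoC x * Q
    + (h (z + RtoC x) t - h z t - (z + RtoC x - z) * df z)
    + - (h (w + RtoC x) t - h w t - (w + RtoC x - w) * df w))%C by (rewrite EQ; ring).
  eapply Rle_trans; [apply Cmod_triangle|]. rewrite Cmod_opp.
  assert (T1 := Cmod_triangle (RtoC x * Q)%C (h (z + RtoC x) t - h z t - (z + RtoC x - z) * df z)%C).
  rewrite Cmod_mult, Cmod_R, (Rabs_pos_eq x) in T1 by lra.
  assert (x * Cmod Q <= x * (e * sqrt K)) by (apply Rmult_le_compat_l; lra).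
  lra.
Qed.

(** * Height of the slit *)

(** With heights in units of sqrt t, the logarithm of V 0 / V b is at most ln 2 - ln k whatever t
    is, so the defect is O(e) t. *)
Lemma trajectory_defect_at_height lam t X V e k y b :
  0 < t -> 0 <= e -> upper_trajectory lam t X V ->
  (forall s, 0 <= s <= t -> Rabs (lam s) <= e * sqrt t) ->
  0 < y <= 2 -> V 0 = y * sqrt t -> 0 < k -> 0 <= b <= t -> k * sqrt t <= V b ->
  Rabs (X b ^ 2 - V b ^ 2 - 4 * b - (X 0 ^ 2 - V 0 ^ 2)) <= e * (2 + ln 2 - ln k) * t /\
  Rabs (2 * (X b * V b) - 2 * (X 0 * V 0)) <= e * (2 + ln 2 - ln k) * t.
Proof.
  intros Ht He Htr Hl Hy HV0 Hk Hb HVb.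
  assert (Hq : 0 < sqrt t) by (apply sqrt_lt_R0; lra).
  destruct (trajectory_square_defect lam t X V e Ht He Htr Hl b Hb) as [A B].
  assert (L1 : ln (V 0) <= ln 2 + ln (sqrt t)).
  { rewrite HV0, <- ln_mult by lra.
    apply ln_le; [apply Rmult_lt_0_compat; lra|apply Rmult_le_compat_r; lra]. }
  assert (L2 : ln k + ln (sqrt t) <= ln (V b)).
  { rewrite <- ln_mult by assumption. apply ln_le; [apply Rmult_lt_0_compat; lra|assumption]. }
  assert (H : 2 * e * b + e * t * (ln (V 0) - ln (V b)) <= e * (2 + ln 2 - ln k) * t).
  { assert (e * b <= e * t) by (apply Rmult_le_compat_l; lra).
    assert (e * t * (ln (V 0) - ln (V b)) <= e * t * (ln 2 - ln k)).
    { apply Rmult_le_compat_l; [apply Rmult_le_pos; lra|lra]. }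
    lra. }
  split; lra.
Qed.

(** A bootstrap, as the defect bound itself presupposes a height. At a time when V = k sqrt t, the
    real part of h^2 gives |X| <= 3 sqrt t, so |2 X V| <= 6 k t = n t / 4 with k = n / 24; but |2 X
    V| starts at n t or more and changes by at most n t / 2. Hence V never falls so low, and X V,
    thus X, keeps its sign. *)
Lemma trajectory_off_axis lam t X V e n x y :
  0 < t -> 0 <= e -> 0 < n <= 1 -> upper_trajectory lam t X V ->
  (forall s, 0 <= s <= t -> Rabs (lam s) <= e * sqrt t) ->
  1 <= y <= 2 -> n / 2 <= Rabs x <= 1 -> X 0 = x * sqrt t -> V 0 = y * sqrt t ->
  e * (2 + ln 2 - ln (n / 24)) <= n / 2 ->
  n / 24 * sqrt t <= V t /\ 0 < x * X t.
Proof.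
  intros Ht He Hn Htr Hl Hy Hx HX0 HV0 Hsmall.
  set (q := sqrt t) in *. assert (Hq : 0 < q) by (apply sqrt_lt_R0; lra).
  assert (Hqq : q * q = t) by (apply sqrt_sqrt; lra).
  set (k := n / 24) in *. assert (Hk : 0 < k) by (unfold k; lra).
  set (La := 2 + ln 2 - ln k) in *.
  assert (E0 : 2 * (X 0 * V 0) = 2 * (x * y) * t) by (rewrite HX0, HV0, <- Hqq; ring).
  assert (Hsm : e * La * t <= n / 2 * t) by (apply Rmult_le_compat_r; lra).
  assert (HxA : n / 2 * 1 <= Rabs x * y) by (apply Rmult_le_compat; lra).
  assert (HV : k * q <= V t).
  { apply Rnot_lt_le. intros Hlt.
    destruct (Ranalysis5.IVT_interv (fun s => k * q - V s) 0 t) as [b [Hb HVb]]; [|lra| |lra|].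
    - intros a Ha. apply continuity_pt_minus; [apply continuity_pt_const; intros ? ?; reflexivity|].
      eapply is_derive_continuity_pt. apply Htr; lra.
    - rewrite HV0. assert (k * q < y * q) by (apply Rmult_lt_compat_r; unfold k; lra). lra.
    - destruct (trajectory_defect_at_height lam t X V e k y b Ht He Htr Hl ltac:(lra) HV0 Hk Hb
        ltac:(fold q; lra)) as [A B]. fold La in A, B.
      assert (HVq : V b = k * q) by lra.
      assert (HV2 : V b ^ 2 <= V 0 ^ 2).
      { apply pow_incr. split; [apply Rlt_le, Htr; lra|].
        apply (trajectory_height_nonincreasing lam t X V 0 b Htr); lra. }
      apply Rabs_le_between in A.
      assert (HX2 : X b ^ 2 <= 6 * t).
      { assert (X 0 ^ 2 <= 1 * t).
        { rewrite HX0, Rpow_mult_distr, <- (pow2_abs x). replace (q ^ 2) with t by (rewrite <- Hqq; ring).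
          apply Rmult_le_compat_r; [lra|]. assert (0 <= Rabs x) by apply Rabs_pos. nra. }
        assert (n / 2 * t <= 1 * t) by (apply Rmult_le_compat_r; lra). lra. }
      assert (HXq : Rabs (X b) <= 3 * q).
      { apply Rsqr_incr_0_var; [|lra]. rewrite !Rsqr_pow2, pow2_abs, Rpow_mult_distr.
        replace (q ^ 2) with t by (rewrite <- Hqq; ring). lra. }
      assert (H1 : Rabs (2 * (X b * V b)) <= n / 4 * t).
      { rewrite HVq, !Rabs_mult, (Rabs_pos_eq 2), (Rabs_pos_eq k), (Rabs_pos_eq q) by lra.
        assert (Rabs (X b) * (k * q) <= 3 * q * (k * q)).
        { apply Rmult_le_compat_r; [apply Rmult_le_pos; lra|assumption]. }
        replace (3 * q * (k * q)) with (n / 8 * t) in * by (unfold k; rewrite <- Hqq; field). lra. }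
      assert (H2 : Rabs (2 * (X 0 * V 0)) = 2 * (Rabs x * y) * t).
      { rewrite E0, !Rabs_mult, (Rabs_pos_eq 2), (Rabs_pos_eq y), (Rabs_pos_eq t); lra. }
      assert (H3 := Rabs_triang_inv2 (2 * (X b * V b)) (2 * (X 0 * V 0))).
      rewrite Rabs_minus_sym in H3. assert (H4 := Rle_abs (Rabs (2 * (X 0 * V 0)) - Rabs (2 * (X b * V b)))).
      assert (n * t <= 2 * (Rabs x * y) * t) by (apply Rmult_le_compat_r; lra).
      assert (0 < n * t) by (apply Rmult_lt_0_compat; lra). lra. }
  split; [exact HV|].
  destruct (trajectory_defect_at_height lam t X V e k y t Ht He Htr Hl ltac:(lra) HV0 Hk ltac:(lra) HV)
    as [_ B]. fold La in B. rewrite E0 in B. apply Rabs_le_between in B.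
  assert (HVt : 0 < V t) by (apply Htr; lra).
  assert (0 < n * t) by (apply Rmult_lt_0_compat; lra).
  assert (Hxy : n * t <= 2 * (Rabs x * y) * t) by (apply Rmult_le_compat_r; lra).
  unfold Rabs in Hxy, Hx. destruct (Rcase_abs x) as [Hneg|Hpos].
  - assert (X t * V t < 0) by lra. assert (X t < 0) by nra. nra.
  - assert (0 < X t * V t) by lra. assert (0 < X t) by nra. nra.
Qed.

(* If the slit stays below height (2 - d / 2) sqrt t, then points slightly above
   that height, on both sides of and on the imaginary axis, survive to time t.
   The mean value property bounds Im h from below on a horizontal segment there,
   so h^2 is close to z^2 + 4 t, which has positive real part: h cannot cross the
   imaginary axis along the segment although its ends lie on different sides. *)
Lemma hull_height_lower_bound d :
  0 < d < 1 -> exists e, 0 < e /\ forall T lam h gamma t,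
    generates_slit_maps T lam h gamma -> 0 < t <= T ->
    (forall s, 0 <= s <= t -> Rabs (lam s) <= e * sqrt t) ->
    ~ (forall u, 0 < u <= t -> Im (gamma u) <= (2 - d / 2) * sqrt t).
Proof.
  intros Hd. set (n := d / 8). assert (Hn : 0 < n <= 1) by (unfold n; lra).
  set (k := n / 24). assert (Hk : 0 < k) by (unfold k; lra).
  (* The height near the axis is only k / 6: the mean is taken over an arc of pi / 3 out of 2 pi.
     [La] serves this weaker bound as well as the bound [k] off the axis. *)
  set (La := 2 + ln 2 - ln (k / 6)).
  assert (HLk : ln (k / 6) < ln k) by (apply ln_increasing; lra).
  assert (HLa : 0 < La).
  { unfold La. assert (ln (k / 6) < ln 2) by (apply ln_increasing; unfold k, n in *; lra). lra. }
  exists (n / 2 / La). split; [apply Rdiv_lt_0_compat; lra|].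
  set (e := n / 2 / La).
  assert (He : 0 < e) by (unfold e; apply Rdiv_lt_0_compat; lra).
  assert (HeLa : e * La = n / 2) by (unfold e; field; lra).
  assert (HeLk : e * (2 + ln 2 - ln k) <= n / 2).
  { rewrite <- HeLa. apply Rmult_le_compat_l; unfold La; lra. }
  intros T lam h gamma t Hg Ht Hl Hgam.
  set (q := sqrt t) in *. assert (Hq : 0 < q) by (apply sqrt_lt_R0; lra).
  assert (Hqq : q * q = t) by (apply sqrt_sqrt; lra).
  set (y0 := (2 - d / 2) * q) in *.
  assert (Hy0 : 0 <= y0) by (unfold y0; apply Rmult_le_pos; lra).
  destruct (hull_map_derivative_continuous T lam h gamma t y0 Hg Ht Hy0 Hgam) as [df Hdf].
  assert (Hdom : forall z, y0 < Im z -> slit_domain gamma t z).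
  { intros z Hz. split; [unfold upper; lra|]. intros [u [Hu ->]]. specialize (Hgam u Hu). lra. }
  set (f := fun z => h z t).
  assert (Hpos : forall z, y0 < Im z -> 0 < Im (f z)).
  { intros z Hz. destruct (gsm_conformal _ _ _ _ Hg t ltac:(lra)) as [_ [_ Hon]].
    apply (Hon (f z)). exists z. split; [now apply Hdom|reflexivity]. }
  set (y := 2 - d / 4).
  assert (Hoff : forall x v, 1 <= v <= 2 -> 2 - d / 2 < v -> n / 2 <= Rabs x <= 1 ->
    k * q <= Im (f (x * q, v * q)) /\ 0 < x * Re (f (x * q, v * q))).
  { intros x v Hv Hv2 Hx.
    assert (Hz : y0 < Im (x * q, v * q)).
    { unfold y0, Im; simpl. apply Rmult_lt_compat_r; lra. }
    destruct (slit_trajectory T lam h gamma t _ Hg Ht (Hdom _ Hz)) as [X [V [Htr [HX0 [HV0 Heq]]]]].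
    destruct (Heq t ltac:(lra)) as [E1 E2]. unfold f. rewrite <- E1, <- E2.
    apply (trajectory_off_axis lam t X V e n x v); try assumption; lra. }
  assert (Hseg : forall x, - (n / 2) <= x <= n / 2 -> k / 6 * q <= Im (f (x * q, y * q))).
  { intros x Hx. set (z := (x * q, y * q) : C).
    assert (Hdisc : forall w, Cmod (w - z)%C < 2 * n * q -> y0 < Im w).
    { intros w Hw. assert (I1 := im_le_Cmod (w - z)%C).
      change (Im (w - z)%C) with (Im w - y * q) in I1. apply Rabs_le_between in I1.
      assert (y0 = y * q - 2 * n * q) by (unfold y0, y, n; field). lra. }
    assert (Hpt : forall a, Cmod (circle_point z (n * q) a - z)%C < 2 * n * q).
    { intros a. rewrite Cmod_circle_point, Rabs_pos_eq by (apply Rmult_le_pos; lra).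
      apply Rmult_lt_compat_r; lra. }
    assert (HPI := PI_RGT_0).
    assert (Hring : 0 <= n * q < 2 * n * q).
    { split; [apply Rmult_le_pos; lra|apply Rmult_lt_compat_r; lra]. }
    (* The arc faces away from the imaginary axis: |cos| >= 1 / 2 on it, with the sign of x, so its
       points are at least n / 2 off the axis in units of sqrt t. *)
    assert (Harc : forall a b, 0 <= a -> a <= b -> b <= 2 * PI -> b - a = PI / 3 ->
      (forall s, a <= s <= b -> n / 2 <= Rabs (x + n * cos s) <= 1 /\ -1 <= sin s <= 1) ->
      k / 6 * q <= Im (f z)).
    { intros a b Ha Hab Hb Hlen Hs.
      assert (M := circle_arc_lower_bound f df z (2 * n * q)
        (fun w Hw => proj1 (Hdf w (Hdisc w Hw))) (fun w Hw => proj2 (Hdf w (Hdisc w Hw)))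
        (n * q) a b (k * q) Hring Ha Hab Hb
        (fun s => Rlt_le _ _ (Hpos _ (Hdisc _ (Hpt s))))).
      assert (HM : forall s, a <= s <= b -> k * q <= Im (f (circle_point z (n * q) s))).
      { intros s Hss. destruct (Hs s Hss) as [S1 S2].
        replace (circle_point z (n * q) s) with (((x + n * cos s) * q, (y + n * sin s) * q) : C)
          by (unfold circle_point, z; apply injective_projections; simpl; ring).
        assert (- n <= n * sin s <= n) by nra.
        apply Hoff; [| |exact S1]; unfold y, n in *; lra. }
      specialize (M HM). rewrite Hlen in M.
      apply (Rmult_le_reg_l (2 * PI)); [lra|]. lra. }
    destruct (Rle_dec 0 x) as [Hx0|Hx0].
    - apply (Harc 0 (PI / 3)); try lra. intros s Hs. split; [|apply SIN_bound].
      assert (C1 : 1 / 2 <= cos s) by (rewrite <- cos_PI3; apply cos_decr_1; lra).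
      destruct (COS_bound s) as [_ C2].
      assert (n * (1 / 2) <= n * cos s) by (apply Rmult_le_compat_l; lra).
      assert (n * cos s <= n * 1) by (apply Rmult_le_compat_l; lra).
      rewrite Rabs_pos_eq by lra. unfold n in *; lra.
    - apply (Harc (2 * (PI / 3)) PI); try lra. intros s Hs. split; [|apply SIN_bound].
      assert (C1 : cos s <= - 1 / 2) by (rewrite <- cos_2PI3; apply cos_decr_1; lra).
      destruct (COS_bound s) as [C2 _].
      assert (n * cos s <= n * (- 1 / 2)) by (apply Rmult_le_compat_l; lra).
      assert (n * - 1 <= n * cos s) by (apply Rmult_le_compat_l; lra).
      rewrite Rabs_left by lra. unfold n in *; lra. }
  destruct (Ranalysis5.IVT_interv (fun x => Re (f (x * q, y * q))) (- (n / 2)) (n / 2)) as [x [Hx HRe]].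
  - intros x Hx.
    assert (Hz : y0 < Im (x * q, y * q)).
    { unfold y0, y, Im; simpl. apply Rmult_lt_compat_r; lra. }
    assert (Hp : curve_derive (fun x => (x * q, y * q)) x (q, 0)).
    { apply (curve_derive_pair (fun x => x * q) (fun _ => y * q)); auto_derive; trivial; ring. }
    destruct (curve_derive_components _ _ _
      (curve_derive_comp f (fun x => (x * q, y * q)) x _ _ (proj1 (Hdf _ Hz)) Hp)) as [H _].
    eapply is_derive_continuity_pt. exact H.
  - lra.
  - destruct (Hoff (- (n / 2)) y) as [_ H]; [unfold y; lra|unfold y; lra| |].
    + rewrite Rabs_Ropp, Rabs_pos_eq; lra.
    + assert (0 < n / 2) by lra. apply Rnot_le_lt. intros Hc.
      assert (0 <= n / 2 * Re (f (- (n / 2) * q, y * q))) by (apply Rmult_le_pos; lra). lra.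
  - destruct (Hoff (n / 2) y) as [_ H]; [unfold y; lra|unfold y; lra| |].
    + rewrite Rabs_pos_eq; lra.
    + assert (0 < n / 2) by lra. apply Rnot_le_lt. intros Hc.
      assert (0 <= n / 2 * - Re (f (n / 2 * q, y * q))) by (apply Rmult_le_pos; lra). lra.
  - assert (Hz : y0 < Im (x * q, y * q)).
    { unfold y0, y, Im; simpl. apply Rmult_lt_compat_r; lra. }
    destruct (slit_trajectory T lam h gamma t _ Hg Ht (Hdom _ Hz)) as [X [V [Htr [HX0 [HV0 Heq]]]]].
    destruct (Heq t ltac:(lra)) as [E1 E2].
    assert (HVt := Hseg x Hx). unfold f in HVt, HRe. rewrite <- E2 in HVt. rewrite <- E1 in HRe.
    (* Where Re h = 0 the real part of h^2 is negative, whereas z^2 + 4 t has real part at least (4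
       - y^2) t >= (d - d / 16) t, beyond the permitted defect d t / 16. *)
    destruct (trajectory_defect_at_height lam t X V e (k / 6) y t ltac:(lra) ltac:(lra) Htr Hl
      ltac:(unfold y; lra) HV0 ltac:(lra) ltac:(lra) HVt) as [A _].
    fold La in A. rewrite HeLa, HRe, HX0, HV0 in A. apply Rabs_le_between in A.
    unfold Re, Im in A; simpl in A.
    assert (0 <= V t * V t) by apply Rle_0_sqr.
    assert (0 <= x * q * (x * q)) by apply Rle_0_sqr.
    assert (Ey : y * q * (y * q) = y * y * t) by (rewrite <- Hqq; ring).
    assert (Hyy : y * y <= 4 - d + d / 16) by (unfold y; nra).
    assert (y * y * t <= (4 - d + d / 16) * t) by (apply Rmult_le_compat_r; lra).
    assert (0 < d * t) by (apply Rmult_lt_0_compat; lra).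
    unfold n in A. lra.
Qed.

(** * Limits at time 0 and the conclusion *)

Lemma driving_starts_at_0 T lam c :
  0 < T -> continuous_on (fun t => 0 <= t <= T) lam ->
  (forall eps, 0 < eps -> exists d, 0 < d /\
    forall t, 0 < t < d -> Rabs (lam t - c * sqrt t) <= eps * sqrt t) ->
  lam 0 = 0.
Proof.
  intros HT Hc Hl.
  assert (H : Rabs (lam 0) <= 0).
  { apply le_of_le_add_eps with (K := Rabs c + 2) (e0 := 1); [lra|]. intros e He.
    destruct (Hl 1 ltac:(lra)) as [d1 [Hd1 H1]].
    destruct (Hc 0 ltac:(simpl; lra) (ball (lam 0) e)) as [d2 Hd2].
    { exists (mkposreal e (proj1 He)). intros w Hw. exact Hw. }
    assert (Hd2p := cond_pos d2).
    set (t := Rmin (Rmin T (e * e)) (Rmin (d1 / 2) (d2 / 2))).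
    assert (Ht : 0 < t) by (unfold t; repeat apply Rmin_glb_lt; nra).
    assert (T1 : t <= T) by (eapply Rle_trans; [apply Rmin_l|apply Rmin_l]).
    assert (T2 : t <= e * e) by (eapply Rle_trans; [apply Rmin_l|apply Rmin_r]).
    assert (T3 : t <= d1 / 2) by (eapply Rle_trans; [apply Rmin_r|apply Rmin_l]).
    assert (T4 : t <= d2 / 2) by (eapply Rle_trans; [apply Rmin_r|apply Rmin_r]).
    specialize (H1 t ltac:(lra)).
    assert (B : ball (lam 0) e (lam t)).
    { apply Hd2; [|lra]. unfold ball; simpl; unfold AbsRing_ball, abs, minus, plus, opp; simpl.
      rewrite Ropp_0, Rplus_0_r, Rabs_pos_eq; lra. }
    unfold ball in B; simpl in B; unfold AbsRing_ball, abs, minus, plus, opp in B; simpl in B.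
    assert (Hs : sqrt t <= e) by (rewrite <- (sqrt_square e) by lra; apply sqrt_le_1; lra).
    assert (Hs0 := sqrt_pos t). assert (Hc0 := Rabs_pos c).
    replace (lam 0) with (- (lam t + - lam 0) + (lam t - c * sqrt t) + c * sqrt t) by ring.
    eapply Rle_trans; [apply Rabs_triang|]. rewrite Rabs_mult, (Rabs_pos_eq (sqrt t)) by lra.
    assert (A := Rabs_triang (- (lam t + - lam 0)) (lam t - c * sqrt t)). rewrite Rabs_Ropp in A.
    assert (Rabs c * sqrt t <= Rabs c * e) by (apply Rmult_le_compat_l; lra). lra. }
  assert (A := Rabs_pos (lam 0)). apply NNPP. intros Hn. apply Rabs_no_R0 in Hn. lra.
Qed.

Lemma Rpower_tends_to_0 a eps :
  0 < a -> 0 < eps -> exists d, 0 < d /\ forall t, 0 < t < d -> Rpower t a < eps.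
Proof.
  intros Ha He. exists (Rpower eps (/ a)). split; [apply exp_pos|]. intros t Ht.
  replace eps with (Rpower (Rpower eps (/ a)) a) at 1.
  - apply Rlt_Rpower_l; assumption.
  - rewrite Rpower_mult, Rinv_l by lra. now apply Rpower_1.
Qed.

Lemma Rpower_opp_half t : 0 < t -> Rpower t (- (1 / 2)) = / sqrt t.
Proof.
  intros Ht. rewrite Rpower_Ropp. f_equal. replace (1 / 2) with (/ 2) by lra. now apply Rpower_sqrt.
Qed.

Theorem theorem6 (T : R) (lam : R -> R) (h : C -> R -> C) (gamma : R -> C)
    (hminus hplus : R -> R) (c b : R)
    (T_pos : 0 < T)
    (lam_cont : continuous_on (fun t : R => 0 <= t <= T) lam)
    (h_slit : generates_slit_maps T lam h gamma)
    (gamma_analytic : analytic_slit T gamma)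
    (h_reflected : reflected_slit_maps T lam h gamma hminus hplus)
    (c_ge0 : 0 <= c)
    (lam_lim : filterlim (fun t : R => lam t / sqrt t) (at_right 0) (locally c))
    (hplus_lim :
       filterlim (fun t : R => hplus t / sqrt t) (at_right 0) (locally b)) :
  c = 0 /\ b = 2 /\
  (exists L : R,
     filterlim (fun t : R => real (arc_length gamma t) * Rpower t (- (1 / 2)))
       (at_right 0) (locally L)) /\
  (forall eps : R, 0 < eps ->
     filterlim (fun t : R => (gamma t * RtoC (Rpower t (- (1 / 2) + eps)))%C)
       (at_right 0) (locally (RtoC 0))).
Proof.
  assert (Hlam := sqrt_asymptotic _ _ lam_lim). assert (Hhp := sqrt_asymptotic _ _ hplus_lim).
  assert (Hl0 := driving_starts_at_0 T lam c T_pos lam_cont Hlam).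
  destruct (boundary_flows_exist T lam h gamma hminus hplus T_pos lam_cont Hl0 h_slit h_reflected)
    as [u [v [Hu Hv]]].
  assert (Harc := gsm_arc _ _ _ _ h_slit). assert (Harc' := Harc). destruct Harc' as [_ [_ [H0 _]]].
  set (s := fun t => real (arc_length gamma t)).
  destruct (arc_length_facts gamma T s T_pos (proj1 gamma_analytic) H0 (fun t => eq_refl))
    as [_ [Hmono [Hch _]]].
  destruct (slit_perpendicular_at_0 gamma T T_pos Harc gamma_analytic) as [k [Hk Hperp]].
  fold s in Hperp.
  assert (Hc : c = 0).
  { apply (driving_limit_zero T lam h gamma hplus u v b c); try assumption.
    (* The first entry gives Im (gamma t) >= (k / 2) s t, the second |Re (gamma t)| <= e (k / 2) s
       t. *)
    intros e He. set (sg := Rmin (k / 2) (e * k / 2)).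
    assert (G1 : sg <= k / 2) by apply Rmin_l. assert (G2 : sg <= e * k / 2) by apply Rmin_r.
    assert (Hek : 0 < e * k) by (apply Rmult_lt_0_compat; lra).
    destruct (Hperp sg) as [d [Hd Hdd]]; [apply Rmin_glb_lt; lra|].
    exists d. split; [lra|]. intros t Ht. destruct (Hdd t Ht) as [D0 [D1 D2]]. fold (s t) in D0, D1, D2.
    apply Rabs_le_between in D2.
    assert (sg * s t <= k / 2 * s t) by (apply Rmult_le_compat_r; lra).
    assert (sg * s t <= e * k / 2 * s t) by (apply Rmult_le_compat_r; lra).
    assert (e * (k / 2 * s t) <= e * Im (gamma t)) by (apply Rmult_le_compat_l; lra). lra. }
  destruct (hplus_limit_equation lam T hplus u b c T_pos c_ge0 Hu Hlam Hhp) as [Hb Hcb].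
  rewrite Hc in *. assert (Hb2 : b = 2) by nra.
  assert (Hheight : forall d, 0 < d < 1 -> exists r, 0 < r /\
    forall t, 0 < t < r -> (2 - d) * sqrt t <= Im (gamma t) <= 2 * sqrt t).
  { intros d Hd. destruct (hull_height_lower_bound d Hd) as [e [He Hlow]].
    destruct (Hlam e He) as [r1 [Hr1 H1]].
    (* The height bound concerns the whole slit, not just its tip. Up to the factor (k + sg) / (k -
       sg), no earlier point is higher than the tip, and this [sg] makes (k + sg) (2 - d) <= (k -
       sg) (2 - d / 2). *)
    set (sg := k * d / 8).
    assert (Hkd : 0 < k * d < k) by (split; nra).
    destruct (Hperp sg) as [r2 [Hr2 H2]]; [unfold sg; lra|].
    exists (Rmin r1 r2). split; [apply Rmin_glb_lt; lra|]. intros t Ht.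
    assert (R1 := Rlt_le_trans _ _ _ (proj2 Ht) (Rmin_l _ _)).
    assert (R2 := Rlt_le_trans _ _ _ (proj2 Ht) (Rmin_r _ _)).
    assert (Hq : 0 < sqrt t) by (apply sqrt_lt_R0; lra).
    split; [|apply (hull_height_le T lam h); [assumption|lra]].
    apply Rnot_lt_le. intros Hlt.
    apply (Hlow T lam h gamma t h_slit ltac:(lra)).
    - intros w Hw. destruct (Req_dec w 0) as [->|Hw0].
      + rewrite Hl0, Rabs_R0. apply Rmult_le_pos; lra.
      + specialize (H1 w ltac:(lra)). rewrite Rmult_0_l, Rminus_0_r in H1.
        apply Rle_trans with (1 := H1). apply Rmult_le_compat_l; [lra|]. apply sqrt_le_1; lra.
    - intros w Hw. destruct (H2 w ltac:(lra)) as [_ [_ A]], (H2 t ltac:(lra)) as [_ [_ B]].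
      apply Rabs_le_between in A. apply Rabs_le_between in B. fold (s w) in A. fold (s t) in B.
      assert (Hst := Hmono w t ltac:(lra) ltac:(lra) ltac:(lra)).
      assert (Hks : 0 < k - sg) by (unfold sg; lra).
      apply (Rmult_le_reg_l (k - sg)); [assumption|].
      assert (C1 : Im (gamma w) <= (k + sg) * s t).
      { assert ((k + sg) * s w <= (k + sg) * s t) by (apply Rmult_le_compat_l; unfold sg in *; lra). lra. }
      assert (C2 : (k - sg) * Im (gamma w) <= (k + sg) * ((k - sg) * s t)).
      { apply Rle_trans with ((k - sg) * ((k + sg) * s t)); [apply Rmult_le_compat_l; lra|].
        right; ring. }
      assert (C3 : (k + sg) * ((k - sg) * s t) <= (k + sg) * ((2 - d) * sqrt t)).
      { apply Rmult_le_compat_l; unfold sg in *; lra. }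
      assert (C4 : (k + sg) * (2 - d) <= (k - sg) * (2 - d / 2)).
      { assert (0 <= sg * d) by (apply Rmult_le_pos; unfold sg; lra). unfold sg in *. lra. }
      assert (C5 : (k + sg) * (2 - d) * sqrt t <= (k - sg) * (2 - d / 2) * sqrt t)
        by (apply Rmult_le_compat_r; lra).
      lra. }
  assert (Hlen : forall eps, 0 < eps -> exists r, 0 < r /\
    forall t, 0 < t < r -> Rabs (s t * / sqrt t - 2 / k) < eps).
  { intros eps Heps.
    assert (Hek : 0 < eps * k) by (apply Rmult_lt_0_compat; lra).
    (* The error in k s - 2 sqrt t is at most sg s + d sqrt t. As sg <= k / 2 gives k s <= 4 sqrt t,
       each part is at most a quarter of eps k sqrt t. *)
    set (d := Rmin (1 / 2) (eps * k / 4)). set (sg := Rmin (k / 2) (k * (eps * k) / 16)).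
    assert (G1 : d <= 1 / 2) by apply Rmin_l. assert (G2 : d <= eps * k / 4) by apply Rmin_r.
    assert (G3 : sg <= k / 2) by apply Rmin_l. assert (G4 : sg <= k * (eps * k) / 16) by apply Rmin_r.
    assert (Hkk : 0 < k * (eps * k)) by (apply Rmult_lt_0_compat; lra).
    assert (Hd : 0 < d) by (apply Rmin_glb_lt; lra).
    assert (Hsg : 0 < sg) by (apply Rmin_glb_lt; lra).
    destruct (Hheight d ltac:(lra)) as [r1 [Hr1 H1]], (Hperp sg Hsg) as [r2 [Hr2 H2]].
    exists (Rmin r1 r2). split; [apply Rmin_glb_lt; lra|]. intros t Ht.
    specialize (H1 t (conj (proj1 Ht) (Rlt_le_trans _ _ _ (proj2 Ht) (Rmin_l _ _)))).
    destruct (H2 t (conj (proj1 Ht) (Rlt_le_trans _ _ _ (proj2 Ht) (Rmin_r _ _)))) as [D0 [_ D1]].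
    fold (s t) in D0, D1. apply Rabs_le_between in D1.
    assert (Hq : 0 < sqrt t) by (apply sqrt_lt_R0; lra).
    assert (E1 : sg * s t <= k / 2 * s t) by (apply Rmult_le_compat_r; lra).
    assert (E2 : sg * s t <= eps * k / 4 * sqrt t).
    { apply Rle_trans with (k * (eps * k) / 16 * s t); [apply Rmult_le_compat_r; lra|].
      assert (eps * k / 16 * (k * s t) <= eps * k / 16 * (4 * sqrt t)) by (apply Rmult_le_compat_l; lra).
      lra. }
    assert (E3 : d * sqrt t <= eps * k / 4 * sqrt t) by (apply Rmult_le_compat_r; lra).
    assert (E4 : 0 < eps * k * sqrt t) by (apply Rmult_lt_0_compat; lra).
    replace (s t * / sqrt t - 2 / k) with ((k * s t - 2 * sqrt t) * / (k * sqrt t)) by (field; lra).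
    assert (Hkq : 0 < k * sqrt t) by (apply Rmult_lt_0_compat; lra).
    rewrite Rabs_mult, (Rabs_pos_eq (/ (k * sqrt t))) by (left; apply Rinv_0_lt_compat; lra).
    apply (Rmult_lt_reg_r (k * sqrt t)); [assumption|].
    rewrite Rmult_assoc, Rinv_l, Rmult_1_r by lra.
    apply Rabs_lt_between. lra. }
  split; [reflexivity|]. split; [assumption|]. split.
  - exists (2 / k). apply at_right_0_eps. intros eps Heps. destruct (Hlen eps Heps) as [r [Hr HHr]].
    exists r. split; [assumption|]. intros t Ht. rewrite Rpower_opp_half by lra. now apply HHr.
  - intros a Ha Q [e He].
    destruct (Hlen 1 ltac:(lra)) as [r1 [Hr1 H1]].
    assert (H2k : 0 < 2 / k) by (apply Rdiv_lt_0_compat; lra).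
    destruct (Rpower_tends_to_0 a (e / (2 / k + 1)) Ha) as [r2 [Hr2 H2]].
    { apply Rdiv_lt_0_compat; [apply cond_pos|lra]. }
    assert (Hr : 0 < Rmin T (Rmin r1 r2)) by (repeat apply Rmin_glb_lt; lra).
    exists (mkposreal _ Hr). intros t Ht Ht0.
    unfold ball in Ht; simpl in Ht; unfold AbsRing_ball, abs, minus, plus, opp in Ht; simpl in Ht.
    rewrite Ropp_0, Rplus_0_r, Rabs_pos_eq in Ht by lra.
    assert (R0 := Rlt_le_trans _ _ _ Ht (Rmin_l _ _)).
    assert (R1 := Rlt_le_trans _ _ _ Ht (Rle_trans _ _ _ (Rmin_r _ _) (Rmin_l _ _))).
    assert (R2 := Rlt_le_trans _ _ _ Ht (Rle_trans _ _ _ (Rmin_r _ _) (Rmin_r _ _))).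
    specialize (H1 t ltac:(lra)). specialize (H2 t ltac:(lra)).
    (* The chord from gamma 0 = 0 is no longer than the arc, so the tip inherits the bound (2 / k +
       1) sqrt t. *)
    assert (Hg : Cmod (gamma t) <= s t).
    { assert (A := Hch 0 t ltac:(lra) ltac:(lra) ltac:(lra)). rewrite H0 in A.
      now replace (gamma t - RtoC 0)%C with (gamma t) in A by ring. }
    assert (Hq : 0 < sqrt t) by (apply sqrt_lt_R0; lra).
    apply Rabs_lt_between' in H1.
    assert (Hsmall : Cmod (gamma t * RtoC (Rpower t (- (1 / 2) + a)))%C < e).
    { assert (Hp := exp_pos (a * ln t)). fold (Rpower t a) in Hp.
      rewrite Cmod_mult, Cmod_R, Rpower_plus, Rpower_opp_half by lra.
      rewrite Rabs_pos_eq by (apply Rmult_le_pos; [left; now apply Rinv_0_lt_compat|lra]).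
      apply Rle_lt_trans with (s t * (/ sqrt t * Rpower t a)).
      - apply Rmult_le_compat_r; [|assumption].
        apply Rmult_le_pos; [left; now apply Rinv_0_lt_compat|lra].
      - rewrite <- Rmult_assoc. apply Rle_lt_trans with ((2 / k + 1) * Rpower t a).
        + apply Rmult_le_compat_r; lra.
        + apply Rlt_le_trans with ((2 / k + 1) * (e / (2 / k + 1))); [apply Rmult_lt_compat_l; lra|].
          right. field. lra. }
    apply He. set (w := (gamma t * RtoC (Rpower t (- (1 / 2) + a)))%C) in *.
    split; unfold ball; simpl; unfold AbsRing_ball, abs, minus, plus, opp; simpl;
      rewrite Ropp_0, Rplus_0_r.
    + apply Rle_lt_trans with (2 := Hsmall). apply (re_le_Cmod w).
    + apply Rle_lt_trans with (2 := Hsmall). apply (im_le_Cmod w).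
Qed.
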